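(* Let $(X,\mathbb F)$ be an $\mathbb R^d$-valued $\mathbb F$-quasi-left continuous step process, where $\mathbb F:=\mathbb F^X\vee\mathcal R$ for a $\sigma$-field $\mathcal R$, and let $\tau:\Omega\to(0,+\infty]$ be a random time such that the law $\eta$ of $\tau$ is a diffuse probability measure and, for every $t\ge0$, the regular conditional distribution $P_t(du)$ of $\tau$ given $\mathcal F_t$ is absolutely continuous with respect to $\eta(du)$. Let $\mathbb G$ be the progressive enlargement of $\mathbb F$ by $\tau$. Then the $\mathbb G$-dual predictable projection $\nu^{\mathbb G,X}$ of $\mu^X$ is given by $$\nu^{\mathbb G,X}(\omega,dt,dx)=\Big(1_{[0,\tau]}(\omega,t)\Big(1+\frac{W'(\omega,t,x)}{A_{t-}(\omega)}\Big)+1_{(\tau,+\infty)}(\omega,t)\big(1+U(\omega,t,x)\big)\Big)\nu^{\mathbb F,X}(\omega,dt,dx),$$ where $W'$ is an $\mathbb F$-predictable function such that $A_-+W'\ge0$ and $U$ is a $\mathbb G$-predictable function such that $1+U\ge0$ identically. In particular, $X$ is a $\mathbb G$-quasi-left continuous step process.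
   Context: All objects live on a probability space $(\Omega,\mathcal F,\mathbb P)$. $\mathbb F^X$ is the smallest right-continuous filtration to which $X$ is adapted, and $\mathbb F^X\vee\mathcal R=(\mathcal F^X_t\vee\mathcal R)_{t\ge0}$. A step process is a semimartingale $X=\sum_{n\ge1}\xi_n1_{[\tau_n,+\infty)}$ with $\mathbb F$-stopping times $\tau_n\uparrow+\infty$, $\tau_n<\tau_{n+1}$ on $\{\tau_n<\infty\}$, and $\mathcal F_{\tau_n}$-measurable $\xi_n$, $\xi_n\neq0$ iff $\tau_n<\infty$. The progressive enlargement $\mathbb G$ of $\mathbb F$ by $\tau$ is the smallest right-continuous filtration containing $\mathbb F$ and making $\tau$ a stopping time. An adapted càdlàg process $Y$ is quasi-left continuous with respect to a filtration if $\Delta Y_\sigma=0$ a.s. for every finite-valued predictable stopping time $\sigma$ of that filtration. The law of $\tau$ is $\eta(B)=\mathbb P(\tau^{-1}(B))$, $B\in\mathcal B(\mathbb R)$, and $P_t(\omega,B)$ is a regular version of $\mathbb P[\tau\in B\mid\mathcal F_t]$; absolute continuity is understood for almost every $\omega$. $\mu^X(\omega,dt,dx)=\sum_{s>0}1_{\{\Delta X_s(\omega)\neq0\}}\delta_{(s,\Delta X_s(\omega))}(dt,dx)$ is the jump measure of $X$; $\nu^{\mathbb F,X}$ and $\nu^{\mathbb G,X}$ are its $\mathbb F$- and $\mathbb G$-dual predictable projections (compensators). $A$ is the Azéma supermartingale of $\tau$, i.e. the $\mathbb F$-optional projection of $1_{[0,\tau)}$, a càdlàg $\mathbb F$-supermartingale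 with $A_t=\mathbb P[\tau>t\mid\mathcal F_t]$ a.s. for every $t\ge 0$; the quotient by $A_-$ is used only on $[0,\tau]$, where $A_->0$. An $\mathbb F$-predictable (resp. $\mathbb G$-predictable) function is a $\mathcal P(\mathbb F)\otimes\mathcal B(\mathbb R^d)$-measurable (resp. $\mathcal P(\mathbb G)\otimes\mathcal B(\mathbb R^d)$-measurable) real map on $\Omega\times\mathbb R_+\times\mathbb R^d$. *)

(* Defs.v *)
From HB Require Import structures.
From mathcomp Require Import all_boot all_order all_algebra.
From mathcomp Require Import all_classical all_reals all_analysis.
From mathcomp Require Import measurable_realfun.
Set Implicit Arguments.
Unset Strict Implicit.
Unset Printing Implicit Defensive.
Import Order.TTheory GRing.Theory Num.Theory.
Import numFieldNormedType.Exports.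
Local Open Scope classical_set_scope.
Local Open Scope ring_scope.

(* Time is [0, +oo[ inside R: processes and filtrations are indexed by R, but
   their values at negative times are never used. Random times take values in
   \bar R. No filtration is assumed to be complete. *)

(* R^d with its Borel sigma-algebra (the library puts no measurable structure
   on 'rV[R]_d itself). *)
Definition borel_rV (R : realType) (d : nat) :=
  g_sigma_algebraType (@open 'rV[R]_d).

(* Measurability relative to a sigma-algebra S of subsets of D, where S is not
   attached to the type T. *)
Definition measurable_wrt {T : Type} {dU : measure_display}
    {U : measurableType dU} (S : set (set T)) (D : set T) (f : T -> U) : Prop :=
  forall B : set U, measurable B -> S (D `&` f @^-1` B).

Section paths.
Context {R : realType} {E : ptopologicalType}.

Definition cadlag (y : R -> E) : Prop :=
  (forall t, 0 <= t -> y s @[s --> t^'+] --> y t) /\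
  (forall t, 0 < t -> cvg (y s @[s --> t^'-])).

(* With the convention y_{0-} = y_0. *)
Definition left_lim (y : R -> E) (t : R) : E :=
  if t == 0 then y 0 else lim (y s @[s --> t^'-]).

End paths.

Definition jump {R : realType} {d : nat} (x : R -> 'rV[R]_d) (t : R) : 'rV[R]_d :=
  x t - left_lim x t.

Section filtrations.
Context {R : realType} {dO : measure_display} {Omega : measurableType dO}.

Definition filtration (F : R -> set (set Omega)) : Prop :=
  [/\ forall t, 0 <= t -> sigma_algebra setT (F t),
      forall t, 0 <= t -> F t `<=` measurable
    & forall s t, 0 <= s -> s <= t -> F s `<=` F t].

Definition right_continuous_filtration (F : R -> set (set Omega)) : Prop :=
  filtration F /\
  forall t, 0 <= t -> \bigcap_(s in [set s | t < s]) F s `<=` F t.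

(* An intersection of right-continuous filtrations is again one, so this is the
   smallest right-continuous filtration satisfying C as soon as C is stable
   under intersections and satisfied by some right-continuous filtration. *)
Definition smallest_filtration (C : (R -> set (set Omega)) -> Prop)
    (t : R) : set (set Omega) :=
  [set A | forall H, right_continuous_filtration H -> C H -> H t A].

Definition adapted {dE : measure_display} {E : measurableType dE}
    (F : R -> set (set Omega)) (Y : R -> Omega -> E) : Prop :=
  forall t, 0 <= t -> measurable_wrt (F t) setT (Y t).

Definition natural_filtration {dE : measure_display} {E : measurableType dE}
    (Y : R -> Omega -> E) : R -> set (set Omega) :=
  smallest_filtration (fun H => adapted H Y).

Definition join_filtration (F : R -> set (set Omega)) (S : set (set Omega))
    (t : R) : set (set Omega) := <<s F t `|` S >>.

Definition stopping_time (F : R -> set (set Omega)) (sigma : Omega -> \bar R) : Prop :=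
  (forall w, (0 <= sigma w)%E) /\
  forall t, 0 <= t -> F t [set w | (sigma w <= t%:E)%E].

Definition stopped_sigma_algebra (F : R -> set (set Omega))
    (sigma : Omega -> \bar R) : set (set Omega) :=
  [set C | measurable C /\
    forall t, 0 <= t -> F t (C `&` [set w | (sigma w <= t%:E)%E])].

Definition progressive_enlargement (F : R -> set (set Omega))
    (tau : Omega -> \bar R) : R -> set (set Omega) :=
  smallest_filtration (fun H =>
    (forall t, 0 <= t -> F t `<=` H t) /\ stopping_time H tau).

Definition time_space : set (Omega * R) := setT `*` `[0, +oo[.

Definition optional (F : R -> set (set Omega)) : set (set (Omega * R)) :=
  <<s time_space,
    [set S | exists Y : R -> Omega -> R,
       [/\ adapted F Y, (forall w, cadlag (Y ^~ w)) &
           exists2 B : set R, measurable B &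
             S = time_space `&` [set p | B (Y p.2 p.1)]]] >>.

Definition left_continuous_path (y : R -> R) : Prop :=
  forall t, 0 < t -> y s @[s --> t^'-] --> y t.

Definition predictable (F : R -> set (set Omega)) : set (set (Omega * R)) :=
  <<s time_space,
    [set S | exists Y : R -> Omega -> R,
       [/\ adapted F Y, (forall w, left_continuous_path (Y ^~ w)) &
           exists2 B : set R, measurable B &
             S = time_space `&` [set p | B (Y p.2 p.1)]]] >>.

Definition predictable_time (F : R -> set (set Omega)) (sigma : Omega -> \bar R) : Prop :=
  stopping_time F sigma /\
  predictable F [set p | 0 <= p.2 /\ (p.2%:E < sigma p.1)%E].

Definition predictable_function {d : nat} (F : R -> set (set Omega))
    (W : Omega * R * borel_rV R d -> R) : Prop :=
  measurable_wrt
    <<s time_space `*` setT,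
      [set S | exists C (B : set (borel_rV R d)),
         [/\ predictable F C, measurable B & S = C `*` B]] >>
    (time_space `*` setT) W.

End filtrations.

Section processes.
Context {R : realType} {dO : measure_display} {Omega : measurableType dO}
  (P : probability Omega R).
Implicit Types (F : R -> set (set Omega)).

Definition optional_projection F (Y Z : R -> Omega -> R) : Prop :=
  measurable_wrt (optional F) time_space (fun p : Omega * R => Z p.2 p.1) /\
  forall (sigma : Omega -> \bar R) (C : set Omega), stopping_time F sigma ->
    stopped_sigma_algebra F sigma C ->
    (\int[P]_(w in C `&` [set w | sigma w < +oo]) (Z (fine (sigma w)) w)%:E =
     \int[P]_(w in C `&` [set w | sigma w < +oo]) (Y (fine (sigma w)) w)%:E)%E.

Definition azema F (tau : Omega -> \bar R) (A : R -> Omega -> R) : Prop :=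
  optional_projection F (fun t w => if (t%:E < tau w)%E then 1 else 0) A /\
  forall w, cadlag (A ^~ w).

(* kappa w B is a regular version of P[tau \in B | F_t], B a Borel set of R. *)
Definition regular_conditional_distribution F (t : R) (tau : Omega -> \bar R)
    (kappa : Omega -> probability (measurableTypeR R) R) : Prop :=
  forall B : set (measurableTypeR R), measurable B ->
    measurable_wrt (F t) setT (fun w => kappa w B) /\
    forall C, F t C ->
      (\int[P]_(w in C) kappa w B = P (C `&` tau @^-1` (EFin @` B)))%E.

Definition law (tau : Omega -> \bar R) (B : set (measurableTypeR R)) : \bar R :=
  P (tau @^-1` (EFin @` B)).

Definition martingale F (M : R -> Omega -> R) : Prop :=
  [/\ adapted F M, (forall w, cadlag (M ^~ w)),
      (forall t, 0 <= t -> P.-integrable setT (EFin \o M t))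
    & forall s t C, 0 <= s -> s <= t -> F s C ->
        (\int[P]_(w in C) (M t w)%:E = \int[P]_(w in C) (M s w)%:E)%E].

Definition stopped (M : R -> Omega -> R) (sigma : Omega -> \bar R)
    (t : R) (w : Omega) : R := M (fine (Order.min t%:E (sigma w))) w.

Definition local_martingale F (M : R -> Omega -> R) : Prop :=
  exists sigma : nat -> Omega -> \bar R,
    [/\ forall n, stopping_time F (sigma n),
        forall w, nondecreasing_seq (sigma ^~ w),
        {ae P, forall w, sigma ^~ w @ \oo --> +oo%E}
      & forall n, martingale F (stopped M (sigma n))].

Definition real_semimartingale F (Y : R -> Omega -> R) : Prop :=
  measurable_wrt (F 0) setT (Y 0) /\
  exists M V : R -> Omega -> R,
    [/\ local_martingale F M /\ (forall w, M 0 w = 0),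
        adapted F V /\ (forall w, V 0 w = 0),
        forall w, cadlag (V ^~ w),
        forall w t, 0 <= t -> bounded_variation 0 t (V ^~ w)
      & forall w t, 0 <= t -> Y t w = Y 0 w + M t w + V t w].

Definition semimartingale {d : nat} F (X : R -> Omega -> 'rV[R]_d) : Prop :=
  forall i : 'I_d, real_semimartingale F (fun t w => X t w ord0 i).

(* T n and xi n stand for tau_{n+1} and xi_{n+1}; the sum at (t, w) is finite
   because T ^~ w tends to +oo. *)
Definition step_process {d : nat} F (X : R -> Omega -> 'rV[R]_d) : Prop :=
  semimartingale F X /\
  exists (T : nat -> Omega -> \bar R) (xi : nat -> Omega -> 'rV[R]_d),
    [/\ forall n, stopping_time F (T n),
        forall w, nondecreasing_seq (T ^~ w) /\ T ^~ w @ \oo --> +oo%E,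
        forall n w, (T n w < +oo)%E -> (T n w < T n.+1 w)%E,
        forall n, measurable_wrt (stopped_sigma_algebra F (T n)) setT
                    (xi n : Omega -> borel_rV R d) /\
                  (forall w, xi n w != 0 <-> (T n w < +oo)%E)
      & forall t w, 0 <= t ->
          X t w = \sum_(n \in [set n | (T n w <= t%:E)%E]) xi n w].

Definition quasi_left_continuous {d : nat} F (X : R -> Omega -> 'rV[R]_d) : Prop :=
  [/\ adapted F (X : R -> Omega -> borel_rV R d),
      forall w, cadlag (X ^~ w)
    & forall sigma : Omega -> \bar R, predictable_time F sigma ->
        (forall w, (sigma w < +oo)%E) ->
        {ae P, forall w, jump (X ^~ w) (fine (sigma w)) = 0}].

Definition jump_measure {d : nat} (X : R -> Omega -> 'rV[R]_d) (w : Omega)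
    (B : set (R * borel_rV R d)) : \bar R :=
  \esum_(s in [set s | 0 < s /\ jump (X ^~ w) s != 0])
    \d_((s, jump (X ^~ w) s) : R * borel_rV R d) B.

(* The random measures nu w live on R * R^d; only their restrictions to
   [0, +oo[ * R^d matter. *)
Definition predictable_random_measure {d : nat} F
    (nu : Omega -> set (R * borel_rV R d) -> \bar R) : Prop :=
  forall W : Omega * R * borel_rV R d -> R, predictable_function F W ->
    (forall q, 0 <= W q) ->
    measurable_wrt (predictable F) time_space (fun p : Omega * R =>
      (\int[nu p.1]_(q in `[0%R, p.2] `*` setT) (W (p.1, q.1, q.2))%:E)%E).

(* The dual predictable projection of mu is unique up to a P-null set; this
   says that nu is a version of it. *)
Definition dual_predictable_projection {d : nat} F
    (mu nu : Omega -> set (R * borel_rV R d) -> \bar R) : Prop :=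
  predictable_random_measure F nu /\
  forall W : Omega * R * borel_rV R d -> R, predictable_function F W ->
    (forall q, 0 <= W q) ->
    (\int[P]_w \int[nu w]_(q in `[0%R, +oo[ `*` setT) (W (w, q.1, q.2))%:E =
     \int[P]_w \int[mu w]_(q in `[0%R, +oo[ `*` setT) (W (w, q.1, q.2))%:E)%E.

End processes.

(* Main.v *)
Require Import Defs.
From HB Require Import structures.
From mathcomp Require Import all_boot all_order all_algebra.
From mathcomp Require Import all_classical all_reals all_analysis.
From mathcomp Require Import measurable_realfun.
Set Implicit Arguments.
Unset Strict Implicit.
Unset Printing Implicit Defensive.
Import Order.TTheory GRing.Theory Num.Theory.
Import numFieldNormedType.Exports.
Local Open Scope classical_set_scope.
Local Open Scope ring_scope.

(** Write F for the small filtration, G for the enlarged one, and m for the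
    F-compensator of the jumps multiplied by an F-predictable weight, almost
    surely positive, that makes its total mass at most 1 ([weight], [wnu]).

    The heart of the matter is that the jumps stay absolutely continuous with
    respect to m when they are tested on G-predictable sets S: if the expected
    m-mass of S is 0, then almost surely S contains no jump
    ([enlargement_null_no_jump]).  On {tau < +oo}, which has probability 1, and
    at positive times, a G-predictable set is the section at u = tau of a set
    that is predictable for the filtration with an extra coordinate u
    ([PredX_enlargement_hat]).  Keep of this set only the part that precedes
    the times at which m starts charging it.  This part is m-null for every u,
    so for every fixed u it contains no jump, by the defining property of the
    F-compensator.  Since the conditional laws of tau are absolutely
    continuous with respect to its law, the same is true for u = tau
    ([law_transfer]); and if S is not charged by m, the part kept at u = tau
    is all of S.

    The Radon-Nikodym theorem on the G-predictable sigma-algebra then provides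
    a density k >= 0 such that k times the F-compensator is the G-compensator
    ([enlarged_density], [nu_enlarged_dual]).  Up to tau, G-predictable
    functions coincide with F-predictable ones, so k agrees on ]0, tau] with an
    F-predictable kF ([predictable_version_before]).  By a maximal inequality
    for the supermartingale A, almost surely A_- > 0 on [0, tau]
    ([azema_left_lim_pos_ae]).  Therefore the formula holds with
    W' = max(A_-, 0) kF - A_- and U = k - 1, and both positivity requirements
    hold everywhere.

    Finally, F-quasi-left continuity means that the F-compensator has no atom
    in time: its cumulated mass would leap at such an atom, which would thus
    lie on the graph of one of countably many first passage times of this
    predictable process, where X does not jump
    ([wnu_no_time_atom]).  The graph of a G-predictable time is then m-null,
    hence free of jumps, which is G-quasi-left continuity; and a step process
    has paths of bounded variation, so it is a semimartingale for any
    filtration to which it is adapted. *)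

(** * Integration against densities and mixtures of measures *)

Section integral_functional.
Local Open Scope ereal_scope.
Context d (T : measurableType d) (R : realType).
Variables (mu : {measure set T -> \bar R}) (Phi : (T -> \bar R) -> \bar R).
Let nnm (f : T -> \bar R) := measurable_fun setT f /\ forall x, 0 <= f x.
Hypothesis Phi_indic : forall A, measurable A ->
  Phi (fun x => (\1_A x)%:E) = mu A.
Hypothesis PhiZ : forall (r : R) f, (0 <= r)%R -> nnm f ->
  Phi (fun x => r%:E * f x) = r%:E * Phi f.
Hypothesis PhiD : forall f g, nnm f -> nnm g ->
  Phi (fun x => f x + g x) = Phi f + Phi g.
Hypothesis Phi_lim : forall f : nat -> T -> \bar R, (forall n, nnm (f n)) ->
  (forall x, nondecreasing_seq (f ^~ x)) ->
  Phi (fun x => limn (f ^~ x)) = limn (fun n => Phi (f n)).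

Import HBNNSimple.

(** Nonnegative measurable functions are increasing limits of simple ones, so
    a functional that is additive, positively homogeneous and continuous
    along increasing sequences is an integral as soon as it agrees with the
    measure on indicators. This gives at once the change of variables for
    densities and for mixtures. *)
Lemma integral_functionalE f : nnm f -> \int[mu]_x f x = Phi f.
Proof.
have Phi0 : Phi (fun=> 0) = 0.
  transitivity (Phi (fun x => (\1_set0 x)%:E)); last by rewrite Phi_indic.
  by congr Phi; apply/funext => x; rewrite indic0.
have Phi_sum (s : seq R) (h : R -> T -> \bar R) : (forall r, nnm (h r)) ->
    Phi (fun x => \sum_(r <- s) h r x) = \sum_(r <- s) Phi (h r).
  move=> nh; elim: s => [|r s ih].
    rewrite big_nil -[RHS]Phi0; congr Phi.
    by apply/funext => x; rewrite big_nil.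
  rewrite big_cons -ih -PhiD//.
    by congr Phi; apply/funext => x; rewrite big_cons.
  split=> [|x]; last by apply: sume_ge0 => i _; exact: (nh i).2.
  by apply: emeasurable_sum => i; exact: (nh i).1.
have Phi_nn (h : {nnsfun T >-> R}) : Phi (EFin \o h) = \int[mu]_x (h x)%:E.
  have nnmh r : nnm (fun x => (\1_(h @^-1` [set r]) x)%:E).
    split; last by move=> x; rewrite lee_fin.
    by apply/measurable_EFinP; exact: measurable_indic.
  have -> : EFin \o h = fun x => \sum_(r <- finmap.enum_fset (fset_set (range h)))
      (r * \1_(h @^-1` [set r]) x)%:E.
    apply/funext => x /=; rewrite [in LHS](fimfunE h) fsbig_finite//=.
    by rewrite sumEFin.
  have -> : (fun x => \sum_(r <- finmap.enum_fset (fset_set (range h)))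
       (r * \1_(h @^-1` [set r]) x)%:E) =
       (fun x => \sum_(r <- finmap.enum_fset (fset_set (range h)))
         ((Num.max r 0)%:E * (\1_(h @^-1` [set r]) x)%:E)).
    apply/funext => x; apply: eq_big_seq => r.
    rewrite in_fset_set// inE => -[t _ <-]; rewrite -EFinM; congr (_ * _)%:E.
    by apply/esym/max_idPl.
  rewrite Phi_sum; last first.
    move=> r; split; first by apply: measurable_funeM; exact: (nnmh r).1.
    by move=> x; rewrite mule_ge0 ?lee_fin// le_max lexx orbT.
  transitivity (sintegral mu h); last by rewrite integralT_nnsfun.
  rewrite sintegralE fsbig_finite//=; apply: eq_big_seq => r.
  rewrite in_fset_set// inE => -[t _ <-].
  rewrite PhiZ//; last by rewrite le_max lexx orbT.
  by rewrite Phi_indic//; congr (_%:E * _); apply/max_idPl.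
move=> [mf f0].
pose f_ := nnsfun_approx measurableT mf.
have fE : f = fun x => limn (fun n => (f_ n x)%:E).
  by apply/funext => x; apply/esym/cvg_lim => //=; exact: cvg_nnsfun_approx.
rewrite [in RHS]fE Phi_lim; last 2 first.
- by move=> n; split; [exact/measurable_EFinP|move=> x; rewrite lee_fin].
- by move=> x a b ab; rewrite lee_fin; exact/lefP/nd_nnsfun_approx.
rewrite fE monotone_convergence//; last 3 first.
- by move=> n; exact/measurable_EFinP.
- by move=> n x _; rewrite lee_fin.
- by move=> x _ a b ab; rewrite lee_fin; exact/lefP/nd_nnsfun_approx.
by congr (limn _); apply/funext => n; rewrite -Phi_nn.
Qed.

End integral_functional.

Section density_measure.
Local Open Scope ereal_scope.
Context d (T : measurableType d) (R : realType).
Variables (m : {measure set T -> \bar R}) (g : T -> R).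
Hypotheses (mg : measurable_fun setT g) (g0 : forall x, (0 <= g x)%R).

(** The hypotheses on the density are arguments so that the measure
    structure, which depends on them, can be attached to the function. *)
Definition mdensity of measurable_fun setT g & (forall x, (0 <= g x)%R) :=
  fun A : set T => \int[m]_(x in A) (g x)%:E.

Local Notation mden := (mdensity mg g0).

Let mden0 : mden set0 = 0. Proof. exact: integral_set0. Qed.

Let mden_ge0 A : 0 <= mden A.
Proof. by apply: integral_ge0 => x _; rewrite lee_fin. Qed.

Let mden_sigma_additive : semi_sigma_additive mden.
Proof.
move=> F mF tF mUF; rewrite /mdensity ge0_integral_bigcup//.
- by apply: is_cvg_nneseries => n _ _; exact: mden_ge0.
- by apply/measurable_EFinP; exact: measurable_funTS.
- by move=> x _; rewrite lee_fin.
Qed.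

HB.instance Definition _ := isMeasure.Build _ _ _ mden
  mden0 mden_ge0 mden_sigma_additive.

Lemma integral_mdensity f : measurable_fun setT f -> (forall x, 0 <= f x) ->
  \int[mden]_x f x = \int[m]_x (f x * (g x)%:E).
Proof.
move=> mf f0; have gE0 x : 0 <= (g x)%:E by rewrite lee_fin.
have mgE : measurable_fun setT (EFin \o g) by exact/measurable_EFinP.
apply: (@integral_functionalE _ _ _ _
  (fun f => \int[m]_x (f x * (g x)%:E))) => //.
- move=> A mA; rewrite /= /mdensity [RHS]integral_mkcond; apply: eq_integral => x _.
  by rewrite patchE indicE; case: ifPn => _; rewrite (mul1e, mul0e).
- move=> r h r0 [mh h0]; under eq_integral do rewrite -muleA.
  rewrite ge0_integralZl//; first exact: emeasurable_funM.
  by move=> x _; rewrite mule_ge0.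
- move=> h k [mh h0] [mk k0]; under eq_integral do rewrite ge0_muleDl//.
  rewrite ge0_integralD//; [|exact: emeasurable_funM| |exact: emeasurable_funM].
  + by move=> x _; rewrite mule_ge0.
  + by move=> x _; rewrite mule_ge0.
- move=> h nh ndh; rewrite -monotone_convergence//; last 3 first.
  + by move=> n; apply: emeasurable_funM => //; exact: (nh n).1.
  + by move=> n x _; rewrite mule_ge0//; exact: (nh n).2.
  + by move=> x _ a b ab; rewrite lee_wpmul2r//; exact: ndh.
  apply: eq_integral => x _; rewrite -limeMr//; last exact: ereal_nondecreasing_is_cvgn.
Qed.

End density_measure.

Section mixture_measure.
Local Open Scope ereal_scope.
Context d d' (T : measurableType d) (Z : measurableType d') (R : realType).
Variables (m : {measure set T -> \bar R}) (K : T -> {measure set Z -> \bar R}).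
Hypothesis mK : forall S, measurable S -> measurable_fun setT (K ^~ S).

Definition mmix of (forall S, measurable S -> measurable_fun setT (K ^~ S)) :=
  fun S : set Z => \int[m]_x K x S.

Local Notation mix := (mmix mK).

Let mix0 : mix set0 = 0.
Proof. by apply: integral0_eq => x _; rewrite measure0. Qed.

Let mix_ge0 A : 0 <= mix A.
Proof. exact: integral_ge0. Qed.

Let mix_sigma_additive : semi_sigma_additive mix.
Proof.
move=> F mF tF mUF; rewrite [X in _ --> X](_ : _ = \sum_(i <oo) mix (F i)).
  by apply: is_cvg_nneseries => n _ _; exact: mix_ge0.
rewrite -integral_nneseries//; last by move=> n; exact: mK.
apply: eq_integral => x _; apply/esym/cvg_lim => //.
exact: measure_semi_sigma_additive.
Qed.

HB.instance Definition _ := isMeasure.Build _ _ _ mix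
  mix0 mix_ge0 mix_sigma_additive.

Lemma integral_mmix f : measurable_fun setT f -> (forall x, 0 <= f x) ->
  \int[mix]_x f x = \int[m]_x \int[K x]_z f z.
Proof.
move=> mf f0.
have mint h : measurable_fun setT h -> (forall x, 0 <= h x) ->
    measurable_fun setT (fun x => \int[K x]_z h z).
  by move=> mh h0; exact: measurable_fun_integral_kernel.
apply: (@integral_functionalE _ _ _ _
  (fun f => \int[m]_x \int[K x]_z f z)) => //.
- move=> A mA; apply: eq_integral => x _.
  by rewrite integral_indic// setIT.
- move=> r h r0 [mh h0].
  under eq_integral do rewrite ge0_integralZl_EFin//.
  rewrite ge0_integralZl_EFin//; last exact: mint.
  by move=> x _; exact: integral_ge0.
- move=> h k [mh h0] [mk k0]; under eq_integral do rewrite ge0_integralD//.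
  by rewrite ge0_integralD//; (try exact: mint);
    move=> x _; exact: integral_ge0.
- move=> h nh ndh; rewrite -monotone_convergence//; last 3 first.
  + by move=> n; apply: mint; [exact: (nh n).1|exact: (nh n).2].
  + by move=> n x _; apply: integral_ge0 => z _; exact: (nh n).2.
  + move=> x _ a b ab; apply: ge0_le_integral => //;
      [by move=> z _; exact: (nh a).2|exact: (nh a).1|exact: (nh b).1|
       by move=> z _; exact: ndh].
  apply: eq_integral => x _; apply: monotone_convergence => //.
  + by move=> n; exact: (nh n).1.
  + by move=> n z _; exact: (nh n).2.
Qed.

End mixture_measure.

Section initial_segments.
Local Open Scope ereal_scope.
Context d (E : measurableType d) (R : realType).
Variables (m : {measure set (Real.sort R * E) -> \bar R}).

(** An initial segment of the half-line may have an end point that it does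
    not contain, and then no single time gives the bound; it is exhausted by
    the times s such that s + 1/(n+1) is still inside. *)
Lemma le_measure_initial_segment (Y : set (Real.sort R * E)) (I : set R)
    (c : \bar R) : measurable Y -> 0 <= c ->
    (forall t, I t -> (0 <= t)%R) ->
    (forall s t, (0 <= s <= t)%R -> I t -> I s) ->
    (forall t, I t -> m (Y `&` [set q | (0 <= q.1 <= t)%R]) <= c) ->
  measurable [set q : Real.sort R * E | I q.1] /\
  m (Y `&` [set q | I q.1]) <= c.
Proof.
move=> mY c0 I0 Idown mI.
have mseg (J : set R) : is_interval J ->
    measurable [set q : Real.sort R * E | J q.1].
  move=> iJ; rewrite -[X in measurable X]setTI.
  exact: (measurable_fst measurableT _ (is_interval_measurable iJ)).
have mI1 : measurable [set q : Real.sort R * E | I q.1].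
  apply: mseg => x y Ix Iy z /andP[xz zy]; apply: Idown Iy.
  by rewrite zy (le_trans (I0 _ Ix)).
have mint t : measurable [set q : Real.sort R * E | (0 <= q.1 <= t)%R].
  apply: (mseg [set s | (0 <= s <= t)%R]) => x y /= /andP[x0 _] /andP[_ yt] z /andP[xz zy].
  by rewrite (le_trans x0 xz) (le_trans zy).
split => //.
have [[t0 [It0 tmax]]|nomax] := pselect (exists t0, I t0 /\ forall t, I t -> (t <= t0)%R).
  apply: le_trans (mI _ It0); apply: le_measure; rewrite ?inE.
  - exact: measurableI.
  - exact: measurableI.
  - by move=> q [Yq Iq]; split => //=; rewrite I0// tmax.
pose J n : set R := [set s | (0 <= s <= n%:R)%R /\ I (s + n.+1%:R^-1)%R].
have mJ n : measurable [set q : Real.sort R * E | J n q.1].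
  apply: mseg => x y [/andP[x0 _] _] [/andP[_ yn] Iy] z /andP[xz zy]; split.
    by rewrite (le_trans x0 xz) (le_trans zy).
  apply: Idown Iy; rewrite lerD2r zy andbT addr_ge0//.
  exact: le_trans xz.
have IJ : [set q : Real.sort R * E | I q.1] =
    \bigcup_n [set q : Real.sort R * E | J n q.1].
  apply/seteqP; split => [[s x]/= Is|[s x]/= [n _ [/andP[s0 _] Is]]]; last first.
    by apply: Idown Is; rewrite s0 lerDl invr_ge0 ler0n.
  have [t It st] : exists2 t, I t & (s < t)%R.
    apply: contrapT => h; apply: nomax; exists s; split=> // t It.
    by rewrite leNgt; apply/negP => st; apply: h; exists t.
  have [N sN] : exists N : nat, (s <= N%:R)%R.
    by exists (Num.trunc s).+1; exact/ltW/truncnS_gt.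
  have [k hk] : exists k : nat, (s + k.+1%:R^-1 <= t)%R.
    exists (Num.trunc (t - s)^-1); rewrite -lerBrDl.
    rewrite -[leRHS]invrK lef_pV2 ?posrE ?invr_gt0 ?subr_gt0//.
    exact/ltW/truncnS_gt.
  exists (maxn N k) => //; split => /=.
    by rewrite (I0 _ Is)/= (le_trans sN)// ler_nat leq_maxl.
  apply: Idown It; rewrite addr_ge0 ?(I0 _ Is)//=.
  apply: le_trans hk; rewrite lerD2l lef_pV2 ?posrE//.
  by rewrite ler_nat ltnS leq_maxr.
have ndJ : nondecreasing_seq (fun n => Y `&` [set q : Real.sort R * E | J n q.1]).
  move=> a b ab; apply/subsetPset => -[s x] [Yq [/= /andP[s0 sa] Is]]; split => //=.
  split; first by rewrite s0 (le_trans sa)// ler_nat.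
  apply: Idown Is; rewrite addr_ge0//= lerD2l lef_pV2 ?posrE//.
  by rewrite ler_nat ltnS.
rewrite IJ setI_bigcupr.
have := nondecreasing_cvg_mu (mu := m) (fun n => measurableI _ _ mY (mJ n))
  (bigcup_measurable (fun n _ => measurableI _ _ mY (mJ n))) ndJ.
move=> cJ; rewrite -(cvg_lim _ cJ)//; apply: lime_le; first by apply/cvg_ex; eexists; exact: cJ.
apply: nearW => n /=.
have [J0|/set0P[s0 Js0]] := eqVneq (J n) set0.
  rewrite [X in m X](_ : _ = set0) ?measure0//.
  by rewrite -subset0 => q [_ /=]; rewrite J0.
have hs : has_sup (J n).
  by split; [exists s0|exists n%:R => z [/andP[]]].
have [s Js ss] : exists2 s, J n s & (sup (J n) - n.+1%:R^-1 < s)%R.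
  by apply: sup_adherent => //; rewrite invr_gt0.
apply: le_trans (mI _ Js.2); apply: le_measure; rewrite ?inE.
- exact: measurableI.
- exact: measurableI.
- move=> [z x] [Yq /= Jz]; split => //=.
  rewrite (andP Jz.1).1/= ltW// -ltrBlDr (le_lt_trans _ ss)// lerB//.
  by apply: ub_le_sup => //; exact: hs.2.
Qed.
End initial_segments.

Section radon_nikodym_real.
Local Open Scope ereal_scope.
Context d (T : measurableType d) (R : realType).

(** The general theorem yields an extended real density defined up to null
    sets; for finite measures there is a version with finite nonnegative
    values everywhere, which is what the inequalities 1 + U >= 0 and A_- + W'
    >= 0 require. *)
Lemma radon_nikodym_real (mu nu : {measure set T -> \bar R}) :
  mu setT < +oo -> nu setT < +oo ->
  (forall A, measurable A -> mu A = 0 -> nu A = 0) ->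
  exists k : T -> R, [/\ measurable_fun setT k, forall x, (0 <= k x)%R &
    forall A, measurable A -> nu A = \int[mu]_(x in A) (k x)%:E].
Proof.
have fin (m : {measure set T -> \bar R}) : m setT < +oo -> fin_num_fun m.
  move=> moo A mA; rewrite ge0_fin_numE//; apply: le_lt_trans moo.
  by apply: le_measure; rewrite ?inE.
move=> muoo nuoo munu.
have pack (m : {measure set T -> \bar R}) : m setT < +oo ->
    exists fm : {finite_measure set T -> \bar R}, forall A, fm A = m A.
  move=> moo.
  have sf : sigma_finite setT m.
    by apply: fin_num_fun_sigma_finite; [rewrite measure0|exact: fin].
  pose H1 := isFinite.Build _ _ _ _ (fin _ moo).
  pose H2 := isSFinite.Build _ _ _ _ (sfinite_measure_sigma_finite sf).
  pose H3 := isSigmaFinite.Build _ _ _ _ sf.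
  by exists (HB.pack_for (FiniteMeasure.type T R) (Measure.sort m) H1 H2 H3).
have [fmu fmuE] := pack _ muoo.
have [fnu fnuE] := pack _ nuoo.
have {}fmuE : fmu = mu :> {measure set T -> \bar R}.
  by apply: eq_measure; apply/funext.
have dom : fnu `<< fmu.
  apply/null_content_dominatesP => A mA; rewrite fnuE => muA.
  by apply: munu => //; rewrite -fmuE.
pose f := Radon_Nikodym_SigmaFinite.f fnu fmu.
have f0 := Radon_Nikodym_SigmaFinite.f_ge0 dom.
have ff := Radon_Nikodym_SigmaFinite.f_fin_num dom.
have fi := Radon_Nikodym_SigmaFinite.f_integrable dom.
exists (fine \o f); split.
- by apply: measurableT_comp => //; exact: measurable_int fi.
- by move=> x; exact: fine_ge0.
- move=> A mA; rewrite -fmuE -fnuE (Radon_Nikodym_SigmaFinite.f_integral dom mA).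
  by apply: eq_integral => x _; rewrite /= fineK.
Qed.

End radon_nikodym_real.

(** * The predictable sigma-algebra and its generators *)

Section sigma_algebra_ops.
Context {T : Type} (S : set (set T)).
Hypothesis sS : sigma_algebra setT S.

Lemma salgT : S setT.
Proof. by case: sS => S0 SC _; have := SC _ S0; rewrite setD0. Qed.

Lemma salg0 : S set0. Proof. by case: sS. Qed.

Lemma salgC A : S A -> S (~` A).
Proof. by case: sS => _ SC _ /SC; rewrite setTD. Qed.

Lemma salg_bigcup (A : nat -> set T) : (forall n, S (A n)) -> S (\bigcup_n A n).
Proof. by case: sS => _ _; exact. Qed.

Lemma salgU A B : S A -> S B -> S (A `|` B).
Proof.
move=> SA SB; rewrite -bigcup2E; apply: salg_bigcup => -[|[|n]] //=.
exact: salg0.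
Qed.

Lemma salgI A B : S A -> S B -> S (A `&` B).
Proof.
move=> SA SB; rewrite -[A `&` B]setCK setCI; apply: salgC.
by apply: salgU; exact: salgC.
Qed.

End sigma_algebra_ops.

Lemma sigma_algebra_preim {T U : Type} (S : set (set T)) (f : T -> U) :
  sigma_algebra setT S -> sigma_algebra setT [set B | S (f @^-1` B)].
Proof.
move=> sS; split=> /=; first by rewrite preimage_set0; exact: salg0.
- by move=> A; rewrite setTD preimage_setC; exact: salgC.
- by move=> A SA; rewrite preimage_bigcup; exact: salg_bigcup.
Qed.

Lemma sigma_algebra_on {T : Type} (S : set (set T)) (D : set T) :
  sigma_algebra setT S -> S D -> sigma_algebra setT [set B | S (B `&` D)].
Proof.
move=> sS SD; split=> /=; first by rewrite set0I; exact: salg0.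
- move=> A SA; rewrite setTD setIC -setDE.
  have -> : D `\` A = D `&` ~` (A `&` D).
    apply/seteqP; split; [move=> x [Dx nA]|move=> x [Dx nA]]; split => //.
      by case.
    by move=> Ax; apply: nA.
  by apply: salgI => //; exact: salgC.
- by move=> A SA; rewrite setI_bigcupl; exact: salg_bigcup.
Qed.

Section predictable_type.
Context {R : realType} {dO : measure_display} {Omega : measurableType dO}.
Implicit Types F G : R -> set (set Omega).

(** Generators of the predictable sigma-algebra that are easier to compute
    with than left-continuous adapted processes. No generator meets the
    negative times, where processes have no meaning. *)
Definition predictable_rectangles F : set (set (Omega * R)) :=
  [set S | exists a B, [/\ 0 <= a, F a B & S = [set p | a < p.2 /\ B p.1]]] `|`
  [set S | exists2 B, F 0 B & S = [set p | 0 <= p.2 /\ B p.1]].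

(** Omega x R with the predictable sigma-algebra of F. Making it a measurable
    type lets product sigma-algebras, sections and Radon-Nikodym densities be
    used for predictable functions. *)
Definition Pred F := g_sigma_algebraType (predictable_rectangles F).

Definition Past F t := g_sigma_algebraType (F t).

Lemma measurable_Past F t (A : set (Past F t)) : filtration F -> 0 <= t ->
  measurable A = F t A.
Proof.
by move=> [sF _ _] t0; rewrite /measurable/= sigma_algebra_id//; exact: sF.
Qed.

Lemma Pred_rect F a B : 0 <= a -> F a B ->
  measurable ([set p | a < p.2 /\ B p.1] : set (Pred F)).
Proof. by move=> a0 FB; apply: sub_sigma_algebra; left; exists a, B. Qed.

Lemma Pred_rect0 F B : F 0 B ->
  measurable ([set p | 0 <= p.2 /\ B p.1] : set (Pred F)).
Proof. by move=> FB; apply: sub_sigma_algebra; right; exists B. Qed.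

Lemma Pred_after F a : filtration F -> 0 <= a ->
  measurable ([set p | a < p.2] : set (Pred F)).
Proof.
move=> fF a0; have [sF _ _] := fF.
rewrite (_ : [set p | a < p.2] = [set p | a < p.2 /\ [set: Omega] p.1]).
  by apply: Pred_rect => //; exact: salgT (sF _ a0).
by apply/seteqP; split => p /=; tauto.
Qed.

Lemma Pred_time_space F : filtration F -> measurable (time_space : set (Pred F)).
Proof.
move=> fF; have [sF _ _] := fF.
rewrite (_ : time_space = [set p | 0 <= p.2 /\ [set: Omega] p.1]).
  by apply: Pred_rect0 => //; exact: salgT (sF _ _).
by apply/seteqP; split => p; rewrite /time_space/= in_itv/= andbT; tauto.
Qed.

Lemma time_spaceE (p : Omega * R) : time_space p = (0 <= p.2) :> Prop.
Proof.
by apply/propext; rewrite /time_space/= in_itv/= andbT; split => [[]|].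
Qed.

(** The left neighbour of x > 0 in the grid of the integers, strictly below
    x: sampling a process there only uses its past. *)
Lemma grid_index (x : R) : {k : nat | 0 < x -> k%:R < x <= k.+1%:R}.
Proof.
apply: cid; case: (ltP 0 x) => // x0; last by exists 0%N.
have := truncn_itv (ltW x0); move: (Num.trunc x) => k /andP[lx xl].
have [xE|xE] := eqVneq k%:R x.
  exists k.-1 => _; rewrite prednK; last first.
    by rewrite -(ltr0n R) xE.
  rewrite -xE lexx andbT ltr_nat.
  by rewrite prednK// -(ltr0n R) xE.
by exists k => _; rewrite (ltW xl) andbT lt_neqAle xE.
Qed.

(** A process of left limits is the pointwise limit of the processes that
    freeze Y at the last point of the grid of mesh 1/(n+1) strictly before t,
    and those are countable unions of predictable rectangles. *)
Lemma Pred_left_limits F (Y Z : R -> Omega -> R) : filtration F -> adapted F Y ->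
  (forall w t, 0 < t -> Y s w @[s --> t^'-] --> Z t w) ->
  (forall w, Z 0 w = Y 0 w) ->
  @measurable_fun _ _ (Pred F) R time_space (fun p => Z p.2 p.1).
Proof.
move=> fF aY lY Z0; have [sF _ mF] := fF.
pose g n (t : R) : R := if t <= 0 then 0 else
  (sval (grid_index (t * n.+1%:R)))%:R / n.+1%:R.
have gP n t : 0 < t -> g n t < t <= g n t + n.+1%:R^-1.
  move=> t0; rewrite /g leNgt t0/=; case: grid_index => k /= kP.
  have /kP/andP[h1 h2] : 0 < t * n.+1%:R by rewrite mulr_gt0.
  rewrite ltr_pdivrMr// h1/= -[X in _ + X]mul1r -mulrDl.
  by rewrite ler_pdivlMr// -[in X in _ <= X]natr1 in h2 *.
have g0 n t : 0 <= g n t.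
  by rewrite /g; case: ifP => // _; rewrite divr_ge0.
apply: (@measurable_fun_cvg _ (Pred F) R time_space
  (fun n p => Y (g n p.2) p.1)).
- move=> n _ B mB.
  pose q k : R := k%:R / n.+1%:R.
  have q0 k : 0 <= q k by rewrite divr_ge0.
  have -> : time_space `&` (fun p : Pred F => Y (g n p.2) p.1) @^-1` B =
      ([set p | 0 <= p.2 /\ (Y 0 @^-1` B) p.1] `\` [set p | 0 < p.2]) `|`
      \bigcup_k ([set p | q k < p.2 /\ (Y (q k) @^-1` B) p.1] `\`
                 [set p | q k.+1 < p.2]).
    apply/seteqP; split => [[w t]|[w t]].
      rewrite /setI/= time_spaceE/= => -[t0]; rewrite /g.
      have [t00|t00] := leP t 0.
        by move=> YB; left; split=> //=; apply/negP; rewrite -leNgt.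
      case: grid_index => k /= kP YB; right; exists k => //=.
      have /kP/andP[h1 h2] : 0 < t * n.+1%:R by rewrite mulr_gt0.
      split; first by split=> //; rewrite /q ltr_pdivrMr.
      by apply/negP; rewrite -leNgt /q ler_pdivlMr.
    rewrite /setI/= time_spaceE/=; case=> [[[t0 YB] /negP]|[k _] /= [[kt YB] /negP tk]].
      by rewrite -leNgt => t00; rewrite /g t00.
    have t0 : 0 < t by rewrite (le_lt_trans _ kt).
    split; first exact: ltW.
    rewrite /g leNgt t0/=; case: grid_index => j /= jP.
    have /jP/andP[h1 h2] : 0 < t * n.+1%:R by rewrite mulr_gt0.
    suff -> : j = k by [].
    move: kt tk; rewrite -leNgt /q ltr_pdivrMr// ler_pdivlMr// => kt tk.
    apply/eqP; rewrite eqn_leq -ltnS -[X in _ && X]ltnS.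
    by rewrite -!(ltr_nat R) (lt_le_trans h1 tk) (lt_le_trans kt h2).
  have mY t : 0 <= t -> F t (Y t @^-1` B).
    by move=> t0; have := aY t t0 B mB; rewrite setTI.
  apply: measurableU.
    by apply: measurableD; [apply: Pred_rect0; exact: mY|exact: Pred_after].
  apply: bigcupT_measurable => k; apply: measurableD; last exact: Pred_after.
  by apply: Pred_rect => //; exact: mY.
- move=> [w t]; rewrite time_spaceE/= le_eqVlt => /predU1P[<-|t0].
    by rewrite /g lexx Z0; exact: cvg_cst.
  have /cvgrPdist_lt lYt := lY w t t0.
  apply/cvgrPdist_lt => e e0.
  have [/= r r0 rY] := lYt e e0.
  have [N _ NP] : \forall n \near \oo, n.+1%:R^-1 < r :> R.
    exact: near_infty_natSinv_lt (PosNum r0).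
  exists N => // n /= Nn; have /andP[h1 h2] := gP n t t0.
  apply: rY => //=; rewrite gtr0_norm ?subr_gt0//.
  by rewrite (le_lt_trans _ (NP n Nn))// lerBlDl.
Qed.

Lemma Pred_left_continuous F (Y : R -> Omega -> R) : filtration F ->
  adapted F Y -> (forall w, left_continuous_path (Y ^~ w)) ->
  @measurable_fun _ _ (Pred F) R time_space (fun p => Y p.2 p.1).
Proof. by move=> fF aY lY; exact: (Pred_left_limits fF aY lY). Qed.

(** Left-continuous adapted processes are limits of step processes on
    predictable rectangles, and conversely the indicator of a predictable
    rectangle is adapted and left-continuous. *)
Lemma predictableP F (C : set (Omega * R)) : filtration F ->
  predictable F C <-> C `<=` time_space /\ measurable (C : set (Pred F)).
Proof.
move=> fF; have [sF _ mF] := fF; split.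
  apply: (smallest_sub (X := [set C | C `<=` time_space /\
    measurable (C : set (Pred F))])).
    split => /=; first by split.
    - move=> A [AD mA]; split; first by move=> ? [].
      by apply: measurableD => //; exact: Pred_time_space.
    - move=> A mA; split; first by move=> p [n _]; exact: (mA n).1.
      by apply: bigcupT_measurable => n; exact: (mA n).2.
  move=> _ [Y [aY lY [B mB ->]]]; split; first by move=> ? [].
  exact: (Pred_left_continuous fF aY lY (Pred_time_space fF) mB).
move=> [CD mC].
have sP : sigma_algebra time_space (predictable F).
  exact: smallest_sigma_algebra.
suff : predictable_rectangles F `<=` [set S | predictable F (time_space `&` S)].
  move=> rectP; rewrite -(setIidr CD); apply: (smallest_sub _ rectP mC).
  split => /=.
  - by rewrite setI0; case: sP.
  - move=> A PA; rewrite setTD -setDE.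
    have -> : time_space `\` A = time_space `\` (time_space `&` A).
      by apply/seteqP; split => p [Dp nA]; split => // Ap; apply: nA => //; case: Ap.
    by case: sP => _ + _; exact.
  - by move=> A PA; rewrite setI_bigcupr; case: sP => _ _; exact.
have gen Y : adapted F Y -> (forall w, left_continuous_path (Y ^~ w)) ->
    forall S, S = [set p | Y p.2 p.1 = 1] -> predictable F (time_space `&` S).
  move=> aY lY S ->; apply: sub_sigma_algebra; exists Y; split => //.
  by exists [set 1].
have aind (b : bool) t (B : set Omega) : 0 <= t -> (b -> F t B) ->
    measurable_wrt (F t) setT (fun w => if b then \1_B w else 0 : R).
  move=> t0 FB Z mZ; rewrite -(measurable_Past _ fF t0).
  have [bt|bf] := boolP b; last by apply: (measurable_cst _ measurableT).
  apply: (measurable_indic _ measurableT) => //.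
  by rewrite measurable_Past//; exact: FB.
move=> _ [[a [B [a0 FB ->]]]|[B FB ->]].
  apply: (gen (fun t w => if a < t then \1_B w else 0)).
  - by move=> t t0; apply: aind => // /ltW at_; exact: mF FB.
  - move=> w t t0; have [at_|ta] := ltP a t.
      apply: cvg_near_cst; apply: filterS (nbhs_left_gt at_) => s as_.
      by rewrite as_.
    apply: cvg_near_cst; apply: filterS (nbhs_left_lt t) => s st.
    by rewrite ltNge (le_trans (ltW st) ta).
  - apply/seteqP; split => p /=.
      by case=> -> Bp; rewrite indicE mem_set.
    case: ltP => _; last by move=> /esym/eqP; rewrite oner_eq0.
    rewrite indicE; case: (boolP (_ \in _)); first by rewrite inE.
    by move=> _ /esym/eqP; rewrite oner_eq0.
rewrite /= (_ : time_space `&` _ = time_space `&` [set p | B p.1]); last first.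
  apply/seteqP; split => p [/=].
    by move=> Dp [].
  by move=> Dp Bp; split => //; split => //; rewrite -time_spaceE.
apply: (gen (fun t w => \1_B w)).
- by move=> t t0; apply: (aind true) => // _; exact: mF FB.
- by move=> w t t0; exact: cvg_cst.
- apply/seteqP; split => p /=.
    by move=> Bp; rewrite indicE mem_set.
  rewrite indicE; case: (boolP (_ \in _)); first by rewrite inE.
  by move=> _ /esym/eqP; rewrite oner_eq0.
Qed.

Lemma predictable_functionP d F (W : Omega * R * borel_rV R d -> R) :
  filtration F ->
  predictable_function F W <->
  @measurable_fun _ _ (Pred F * borel_rV R d)%type R (time_space `*` setT) W.
Proof.
move=> fF.
have mD : measurable (time_space `*` setT : set (Pred F * borel_rV R d)%type).
  by apply: measurableX => //; exact: Pred_time_space.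
set gens := [set S | exists C (B : set (borel_rV R d)),
         [/\ predictable F C, measurable B & S = C `*` B]].
have sE S : <<s time_space `*` setT, gens >> S <->
    S `<=` time_space `*` setT /\ measurable (S : set (Pred F * borel_rV R d)%type).
  split.
    apply: (smallest_sub (X := [set S | S `<=` time_space `*` setT /\
      measurable (S : set (Pred F * borel_rV R d)%type)])).
      split => /=; first by split.
      - move=> A [AD mA]; split; first by move=> ? [].
        exact: measurableD.
      - move=> A mA; split; first by move=> p [n _]; exact: (mA n).1.
        by apply: bigcupT_measurable => n; exact: (mA n).2.
    move=> _ [C [B [/(predictableP _ fF)[CD mC] mB ->]]]; split.
      by move=> p [Cp _]; split => //; exact: CD.
    exact: measurableX.
  move=> [SD]; rewrite measurable_prod_measurableType => mS.
  have sP : sigma_algebra (time_space `*` setT) <<s time_space `*` setT, gens >>.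
    exact: smallest_sigma_algebra.
  rewrite -(setIidr SD); move: mS {SD}; move: S.
  apply: smallest_sub.
    split => /=.
    - by rewrite setI0; case: sP.
    - move=> A PA; rewrite setTD -setDE.
      rewrite (_ : _ `\` A = (time_space `*` setT) `\` ((time_space `*` setT) `&` A)).
        by case: sP => _ + _; exact.
      by apply/seteqP; split => p [Dp nA]; split => // Ap; apply: nA => //; case: Ap.
    - by move=> A PA; rewrite setI_bigcupr; case: sP => _ _; exact.
  move=> _ [A mA [B mB <-]] /=; apply: sub_sigma_algebra.
  exists (time_space `&` A), B; split => //.
    apply/(predictableP _ fF); split; first by move=> ? [].
    by apply: measurableI => //; exact: Pred_time_space.
  by apply/seteqP; split => p [/=]; [move=> [? ?] [? ?]|move=> [? ?] ?].
split=> [pW _ B mB|mW B mB].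
  by have /sE[] := pW B mB.
by apply/sE; split; [move=> ? []|exact: mW].
Qed.

Lemma Pred_sub F G : (forall t, 0 <= t -> F t `<=` G t) ->
  forall C, measurable (C : set (Pred F)) -> measurable (C : set (Pred G)).
Proof.
move=> FG; apply: smallest_sub; first exact: sigma_algebra_measurable.
move=> _ [[a [B [a0 FB ->]]]|[B FB ->]].
  by apply: Pred_rect => //; exact: FG.
by apply: Pred_rect0 => //; exact: FG.
Qed.

Lemma PredX_sub d F G : (forall t, 0 <= t -> F t `<=` G t) ->
  forall C, measurable (C : set (Pred F * borel_rV R d)%type) ->
  measurable (C : set (Pred G * borel_rV R d)%type).
Proof.
move=> FG C; rewrite measurable_prod_measurableType; move: C.
apply: smallest_sub; first exact: sigma_algebra_measurable.
move=> _ [A mA [B mB <-]]; apply: measurableX => //.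
exact: Pred_sub mA.
Qed.

Lemma Pred_section F w : @measurable_fun _ _ (Real.sort R) (Pred F) setT
  (fun t => (w, t)).
Proof.
move=> _ C mC; rewrite setTI; move: C mC.
apply: smallest_sub.
  exact: (@sigma_algebra_preim _ _ (@measurable _ (Real.sort R)))
    (sigma_algebra_measurable _).
have mX (I : interval R) (B : set Omega) :
    measurable ([set t | t \in I /\ B w] : set (Real.sort R)).
  have [Bw|nBw] := pselect (B w).
    rewrite (_ : mkset _ = [set` I]); first exact: measurable_itv.
    by apply/seteqP; split => p // [].
  rewrite (_ : mkset _ = set0); first exact: measurable0.
  by apply/seteqP; split => p // [].
move=> _ [[a [B [a0 FB ->]]]|[B FB ->]] /=.
  have := mX `]a, +oo[ B.
  by congr measurable; apply/seteqP; split => p /=; rewrite in_itv/= andbT.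
have := mX `[0, +oo[ B.
by congr measurable; apply/seteqP; split => p /=; rewrite in_itv/= andbT.
Qed.

Lemma PredX_section d F w :
  @measurable_fun _ _ (Real.sort R * borel_rV R d)%type
    (Pred F * borel_rV R d)%type setT (fun q => ((w, q.1), q.2)).
Proof.
have m1 : @measurable_fun _ _ (Real.sort R * borel_rV R d)%type (Pred F)
    setT ((fun t => (w, t)) \o fst).
  by apply: measurableT_comp; [exact: Pred_section|exact: measurable_fst].
exact: (measurable_fun_pair m1 measurable_snd).
Qed.

(** A predictable set evaluated at a stopping time only involves what is
    known at that time; this is checked on rectangles and the sets having the
    property form a sigma-algebra. *)
Lemma Pred_at_time F (T : Omega -> \bar R) K C : filtration F -> 0 <= K ->
  stopping_time F T -> measurable (C : set (Pred F)) ->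
  F K ([set w | (T w <= K%:E)%E] `&` [set w | C (w, fine (T w))]).
Proof.
move=> [sF Fm mF] K0 [T0 sT].
rewrite setIC; move: C.
apply: smallest_sub => /=.
  have := sigma_algebra_on (sF _ K0) (sT _ K0).
  exact: (@sigma_algebra_preim _ _ _ (fun w => (w, fine (T w)))).
have finT w : (T w <= K%:E)%E -> T w \is a fin_num.
  by move=> TK; rewrite ge0_fin_numE// (le_lt_trans TK)// ltry.
move=> _ [[a [B [a0 FB ->]]]|[B FB ->]].
  have [aK|Ka] := leP a K.
    rewrite [X in F K X](_ : _ = (B `&` ~` [set w | (T w <= a%:E)%E]) `&`
        [set w | (T w <= K%:E)%E]).
      apply: (salgI (sF _ K0)); last exact: sT.
      apply: (salgI (sF _ K0)); first exact: mF FB.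
      by apply: (salgC (sF _ K0)); apply: mF (sT _ a0).
    apply/seteqP; split => w [/=].
      move=> [aT Bw] TK; split => //; split => // ; apply/negP; rewrite -ltNge.
      by rewrite -(fineK (finT _ TK)) lte_fin.
    move=> [Bw /negP]; rewrite -ltNge => aT TK; split => //; split => //.
    by rewrite -lte_fin (fineK (finT _ TK)).
  rewrite [X in F K X](_ : _ = set0); first exact: salg0 (sF _ K0).
  rewrite -subset0 => w [/= [aT _] TK].
  have := lt_trans Ka aT; rewrite ltNge => /negP; apply.
  by rewrite -lee_fin (fineK (finT _ TK)).
rewrite [X in F K X](_ : _ = B `&` [set w | (T w <= K%:E)%E]).
  apply: (salgI (sF _ K0)); last exact: sT.
  exact: mF FB.
apply/seteqP; split => w [/=]; first by case.
by move=> Bw TK; split => //; split => //; exact: fine_ge0.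
Qed.

Lemma PredX_at_time d F (T : Omega -> \bar R) (xi : Omega -> borel_rV R d) K C :
  filtration F -> 0 <= K -> stopping_time F T ->
  measurable_wrt (stopped_sigma_algebra F T) setT xi ->
  measurable (C : set (Pred F * borel_rV R d)%type) ->
  F K ([set w | (T w <= K%:E)%E] `&` [set w | C ((w, fine (T w)), xi w)]).
Proof.
move=> fF K0 sT mxi; have [sF Fm mF] := fF.
rewrite measurable_prod_measurableType setIC; move: C.
apply: smallest_sub => /=.
  have := sigma_algebra_on (sF _ K0) (sT.2 _ K0).
  exact: (@sigma_algebra_preim _ _ _ (fun w => ((w, fine (T w)), xi w))).
move=> _ [A mA [B mB <-]] /=.
have := Pred_at_time fF K0 sT mA.
have [_ /(_ _ K0)] := mxi _ mB; rewrite setTI => h1 h2.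
have := salgI (sF _ K0) h1 h2; congr (F K _).
by apply/seteqP; split => w /=; tauto.
Qed.

Lemma Pred_section_time F t C : filtration F -> 0 <= t ->
  measurable (C : set (Pred F)) -> F t [set w | C (w, t)].
Proof.
move=> fF t0 mC; have [sF Fm mF] := fF.
have sT : stopping_time F (fun=> t%:E).
  split => [w|s s0]; first by rewrite lee_fin.
  have [ts|st] := leP t s.
    rewrite (_ : mkset _ = setT); first exact: salgT (sF _ s0).
    by apply/seteqP; split => // w _ /=; rewrite lee_fin.
  rewrite (_ : mkset _ = set0); first exact: salg0 (sF _ s0).
  by rewrite -subset0 => w /=; rewrite lee_fin leNgt st.
have := Pred_at_time fF t0 sT mC; congr (F t _).
by apply/seteqP; split => w /=; [case|move=> ?; split => //; rewrite lexx].
Qed.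

End predictable_type.

(** * Kernels with predictable mass *)

Section lift.
Context {R : realType} {dO : measure_display} {Omega : measurableType dO} (d : nat).
Variable F : R -> set (set Omega).
Local Notation E := (borel_rV R d).
Local Notation PX := (Pred F * E)%type.

(** The copy of m carried by the slice over w, so that functions of (w, t, x)
    can be integrated against a measure that depends on w. *)
Definition lift (w : Omega) (m : {measure set (R * E) -> \bar R}) : set PX -> \bar R :=
  fun S => m [set q | S ((w, q.1), q.2)].

Section lift_measure.
Variables (w : Omega) (m : {measure set (R * E) -> \bar R}).

Lemma measurable_slice (S : set PX) : measurable S ->
  measurable [set q : R * E | S ((w, q.1), q.2)].
Proof.
move=> mS; rewrite -[X in measurable X]setTI.
exact: (@PredX_section _ _ _ d F w measurableT _ mS).
Qed.

Let lift0 : lift w m set0 = 0%E. Proof. exact: measure0. Qed.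

Let lift_ge0 S : (0 <= lift w m S)%E. Proof. exact: measure_ge0. Qed.

Let lift_sigma_additive : semi_sigma_additive (lift w m).
Proof.
move=> S mS tS mUS; rewrite /lift.
rewrite [X in m X](_ : _ = \bigcup_n [set q | S n ((w, q.1), q.2)]); last first.
  by apply/seteqP; split => q [n _ Snq]; exists n.
apply: measure_semi_sigma_additive.
- by move=> n; exact: measurable_slice.
- move=> i j _ _ [q [/= Si Sj]]; apply: (tS i j) => //.
  by exists ((w, q.1), q.2).
- by apply: bigcupT_measurable => n; exact: measurable_slice.
Qed.

HB.instance Definition _ := isMeasure.Build _ _ _ (lift w m)
  lift0 lift_ge0 lift_sigma_additive.

Lemma integral_lift (f : PX -> \bar R) : measurable_fun setT f ->
  (forall x, 0 <= f x)%E ->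
  (\int[lift w m]_x f x = \int[m]_q f ((w, q.1), q.2))%E.
Proof.
move=> mf f0.
have := @ge0_integral_pushforward _ _ _ _ R _ (@PredX_section _ _ _ d F w) m setT f
  measurableT mf (fun x _ => f0 x).
by rewrite preimage_setT.
Qed.

End lift_measure.
End lift.

Section predictable_mass.
Context {R : realType} {dO : measure_display} {Omega : measurableType dO} {d : nat}.
Variable F : R -> set (set Omega).
Local Notation E := (borel_rV R d).
Local Notation PX := (Pred F * E)%type.
Hypothesis fF : filtration F.
Variable m : Omega -> {measure set (R * E) -> \bar R}.
Hypothesis mfin : forall w, (m w setT < +oo)%E.
Hypothesis m_rect : forall a B, 0 <= a -> measurable B ->
  @measurable_fun _ _ (Pred F) _ setT
    (fun p => m p.1 [set q | a < q.1 <= p.2 /\ B q.2]).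
Hypothesis m_rect0 : forall B, measurable B ->
  @measurable_fun _ _ (Pred F) _ setT
    (fun p => m p.1 [set q | 0 <= q.1 <= p.2 /\ B q.2]).

Let seg (t : R) : set PX := [set x | 0 <= x.1.2 <= t].

Let mseg t : measurable (seg t).
Proof.
have h : measurable ([set p | 0 <= p.2 <= t] : set (Pred F)).
  have [t0|t0] := leP 0 t.
    rewrite (_ : mkset _ = time_space `\` [set p | t < p.2]).
      by apply: measurableD; [exact: Pred_time_space|exact: Pred_after].
    apply/seteqP; split => p; rewrite /setD/= time_spaceE.
      by move=> /andP[p0 pt]; split=> //; apply/negP; rewrite -leNgt.
    by move=> [-> /negP]; rewrite -leNgt.
  rewrite (_ : mkset _ = set0)//; rewrite -subset0 => p /= /andP[p0 pt].
  by have := le_lt_trans (le_trans p0 pt) t0; rewrite ltxx.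
have := @measurable_fst _ _ (Pred F) E measurableT _ h.
by rewrite setTI.
Qed.

Let Pm (S : set PX) := @measurable_fun _ _ (Pred F) _ setT
  (fun p => lift p.1 (m p.1) (S `&` seg p.2)).

Let lfin w S : measurable S -> (lift (F := F) w (m w) S < +oo)%E.
Proof.
move=> mS; apply: le_lt_trans (mfin w); rewrite /lift.
by apply: le_measure; rewrite ?inE//; exact: measurable_slice.
Qed.

Let PmD S S' : measurable S -> measurable S' -> S `<=` S' ->
  Pm S -> Pm S' -> Pm (S' `\` S).
Proof.
move=> mS mS' SS' PS PS'; rewrite /Pm.
rewrite (_ : (fun p => _) = (fun p : Pred F => lift p.1 (m p.1) (S' `&` seg p.2)
    - lift p.1 (m p.1) (S `&` seg p.2))%E); first exact: emeasurable_funB.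
apply/funext => p.
rewrite [X in lift _ _ X](_ : _ = (S' `&` seg p.2) `\` (S `&` seg p.2)).
  rewrite measureD; [|exact: measurableI|exact: measurableI|].
    congr (_ - lift _ _ _)%E; apply/seteqP; split => x; first by case.
    by move=> [Sx xs]; split; split => //; exact: SS'.
  by apply: lfin; exact: measurableI.
apply/seteqP; split => x.
  by move=> [[S'x nSx] sx]; split => // -[].
by move=> [[S'x sx] nSx]; split => //; split => // Sx; exact: nSx.
Qed.

Let PmU (S : nat -> set PX) : (forall n, measurable (S n)) -> trivIset setT S ->
  (forall n, Pm (S n)) -> Pm (\bigcup_n S n).
Proof.
move=> mS tS PS; rewrite /Pm.
rewrite (_ : (fun p => _) = (fun p : Pred F =>
    \sum_(n <oo) lift p.1 (m p.1) (S n `&` seg p.2))%E).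
  by apply: ge0_emeasurable_sum => [n p _ _|n _]; [exact: measure_ge0|exact: PS].
apply/funext => p; rewrite setI_bigcupl measure_semi_bigcup//.
- by move=> n; exact: measurableI.
- by move=> i j _ _ [x [[Si _] [Sj _]]]; apply: (tS i j) => //; exists x.
- by rewrite -setI_bigcupl; apply: measurableI => //; exact: bigcupT_measurable.
Qed.

Let Pm_rect A B : predictable_rectangles F A -> measurable B -> Pm (A `*` B).
Proof.
move=> + mB.
have key (J : set R) (A' : set Omega) :
    (forall s t, J s -> s <= t -> J t) ->
    measurable ([set p | J p.2 /\ A' p.1] : set (Pred F)) ->
    @measurable_fun _ _ (Pred F) _ setT
      (fun p => m p.1 [set q | (J q.1 /\ 0 <= q.1 <= p.2) /\ B q.2]) ->
    Pm ([set p | J p.2 /\ A' p.1] `*` B).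
  move=> Jup mJ mm; rewrite /Pm.
  rewrite (_ : (fun p => _) = (fun p : Pred F =>
     (\1_[set p | J p.2 /\ A' p.1] p)%:E *
     m p.1 [set q | (J q.1 /\ (0 <= q.1 <= p.2)%R) /\ B q.2])%E).
    apply: emeasurable_funM => //; apply/measurable_EFinP.
    exact: measurable_indic.
  apply/funext => -[w t] /=; rewrite indicE.
  have [[/= Jt Aw]|nA] := pselect ([set p | J p.2 /\ A' p.1] (w, t)).
    rewrite mem_set// mul1e /lift; congr (m w _).
    by apply/seteqP; split => q /=; tauto.
  rewrite memNset// mul0e /lift.
  rewrite [X in m w X](_ : _ = set0) ?measure0// -subset0.
  move=> q /= [[[Jq Aw] _] /andP[_ qt]]; apply: nA; split => //=.
  exact: Jup qt.
case=> [[a [A' [a0 FA ->]]]|[A' FA ->]].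
  apply: (key [set t | a < t]).
  - by move=> s t /= as_ st; exact: lt_le_trans st.
  - exact: Pred_rect.
  - have := m_rect a0 mB; congr measurable_fun; apply/funext => p.
    congr (m p.1 _); apply/seteqP; split => q /=.
      by move=> [/andP[aq qt] Bq]; rewrite aq qt (le_trans a0 (ltW aq)).
    by move=> [[-> /andP[_ ->]]].
apply: (key [set t | 0 <= t]).
- by move=> s t /= as_ st; exact: le_trans st.
- exact: Pred_rect0.
- have := m_rect0 mB; congr measurable_fun; apply/funext => p.
  congr (m p.1 _); apply/seteqP; split => q /=.
    by move=> [/andP[-> ->]].
  by move=> [[_ ->]].
Qed.

Let predictable_rectanglesI : setI_closed (predictable_rectangles F).
Proof.
have [sF _ mF] := fF.
have meet a b (A B : set Omega) : 0 <= a -> 0 <= b -> F a A -> F b B ->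
    F (Num.max a b) (A `&` B).
  move=> a0 b0 FA FB; have ab0 : 0 <= Num.max a b by rewrite le_max a0.
  apply: (salgI (sF _ ab0)); [apply: mF FA|apply: mF FB] => //.
    by rewrite le_max lexx.
  by rewrite le_max lexx orbT.
move=> _ _ [[a [A [a0 FA ->]]]|[A FA ->]] [[b [B [b0 FB ->]]]|[B FB ->]].
- left; exists (Num.max a b), (A `&` B); split; [by rewrite le_max a0|exact: meet|].
  apply/seteqP; split => p /=; rewrite gt_max.
    by move=> [[-> ?] [->]].
  by move=> [/andP[-> ->] []].
- left; exists a, (A `&` B); split => //; first by rewrite -(max_idPl a0); exact: meet.
  apply/seteqP; split => p /=; first by move=> [[-> ?] []].
  by move=> [ap [Ap Bp]]; split => //; split => //; rewrite (le_trans a0 (ltW ap)).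
- left; exists b, (A `&` B); split => //; first by rewrite -(max_idPr b0); exact: meet.
  apply/seteqP; split => p /=; first by move=> [[_ ?] [->]].
  by move=> [ap [Ap Bp]]; split => //; split => //; rewrite (le_trans b0 (ltW ap)).
- right; exists (A `&` B); first exact: (salgI (sF _ _)).
  by apply/seteqP; split => p /=; tauto.
Qed.

Let Pm_setT B : measurable B -> Pm (setT `*` B).
Proof.
move=> mB; have [sF _ _] := fF.
have := Pm_rect (or_intror (ex_intro2 _ _ setT (salgT (sF _ (lexx _))) erefl)) mB.
congr measurable_fun; apply/funext => p; rewrite /lift; congr (m p.1 _).
apply/seteqP; split => q /=; first by tauto.
by move=> [[_ Bq] h]; split => //; split => //; split => //; case/andP: h.
Qed.

Let Pm_X A B : measurable A -> measurable B -> Pm (A `*` B).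
Proof.
move=> mA mB; move: A mA.
have h : @measurable _ (Pred F) = <<s predictable_rectangles F >> by [].
apply: (dynkin_induction h predictable_rectanglesI) => //.
- exact: Pm_setT.
- by move=> A pA; exact: Pm_rect.
- move=> A mA PA; rewrite (_ : ~` A `*` B = (setT `*` B) `\` (A `*` B)).
    apply: PmD => //; [exact: measurableX|exact: measurableX| |exact: Pm_setT].
    by move=> x [].
  apply/seteqP; split => x /=; first by move=> [nA Bx]; split => // -[].
  by move=> [[_ Bx] nA]; split => // Ax; apply: nA.
- move=> A mA tA PA; rewrite (_ : _ `*` B = \bigcup_n (A n `*` B)).
    apply: PmU => //; first by move=> n; exact: measurableX.
    move=> i j _ _ [x [[Ai _] [Aj _]]]; apply: (tA i j) => //.
    by exists x.1.
  apply/seteqP; split => x /=; first by move=> [[n _ An] Bx]; exists n.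
  by move=> [n _ [An Bx]]; split => //; exists n.
Qed.

(** Products of a predictable rectangle and a Borel set are stable under
    intersection, so that the predictability of the mass up to time t spreads
    from them to the whole product sigma-algebra by the monotone class
    theorem; complements require the mass to be finite. *)
Lemma Pred_measurable_mass (S : set PX) : measurable S ->
  @measurable_fun _ _ (Pred F) _ setT
  (fun p => m p.1 [set q | 0 <= q.1 <= p.2 /\ S ((p.1, q.1), q.2)]).
Proof.
suff PX_ : forall S : set PX, measurable S -> Pm S.
  move=> mS; have := PX_ _ mS; congr measurable_fun; apply/funext => p.
  by rewrite /lift; congr (m p.1 _); apply/seteqP; split => q /=; tauto.
have h := @measurable_prod_measurableType _ _ (Pred F) E.
move=> {}S mS; rewrite h in mS; move: S mS.
apply: (dynkin_induction h).
- move=> _ _ [A mA [B mB <-]] [A' mA' [B' mB' <-]].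
  exists (A `&` A'); first exact: measurableI.
  exists (B `&` B'); first exact: measurableI.
  by rewrite setXI.
- by rewrite -setXTT; exact: Pm_setT.
- by move=> _ [A mA [B mB <-]]; exact: Pm_X.
- move=> S mS PS; rewrite -setTD; apply: PmD => //.
  by rewrite -setXTT; exact: Pm_setT.
- by move=> S mS tS PS; exact: PmU.
Qed.

Lemma Pred_measurable_integral (f : PX -> \bar R) : measurable_fun setT f ->
  (forall x, 0 <= f x)%E -> @measurable_fun _ _ (Pred F) _ setT
  (fun p => \int[m p.1]_(q in [set q | (0 <= q.1 <= p.2)%R]) f ((p.1, q.1), q.2))%E.
Proof.
move=> mf f0.
have mh t : @measurable_fun _ _ PX _ setT (\1_(seg t) : _ -> R).
  exact: measurable_indic.
have h0 t x : 0 <= \1_(seg t) x :> R by [].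
pose l (p : Pred F) : {measure set PX -> \bar R} :=
  mdensity (lift p.1 (m p.1)) (mh p.2) (h0 p.2).
have ml U : measurable U -> measurable_fun setT (l ^~ U).
  move=> mU; have := Pred_measurable_mass mU; congr measurable_fun.
  apply/funext => p; rewrite /l /= /mdensity integral_indic//.
have := measurable_fun_integral_kernel ml f0 mf.
congr measurable_fun; apply/funext => p.
rewrite /l integral_mdensity// integral_lift//; last 2 first.
- by apply: emeasurable_funM => //; exact/measurable_EFinP.
- by move=> x; rewrite mule_ge0// lee_fin.
rewrite [RHS]integral_mkcond; apply: eq_integral => q _.
rewrite patchE indicE.
have -> : (((p.1, q.1), q.2) \in seg p.2) = (q \in [set q : R * E | 0 <= q.1 <= p.2]).
  by apply/idP/idP; rewrite !inE.
by case: ifPn => _; rewrite (mule1, mule0).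
Qed.

End predictable_mass.

(** * Traces of the enlarged filtration *)

(** To identify a sigma-algebra on D it is enough to do so for its
    generators: the sets that coincide on D with the inverse image of some
    member of M form a sigma-algebra. *)
Lemma sigma_algebra_trace {T U : Type} (M : set (set U)) (D : set T) (f : T -> U) :
  sigma_algebra setT M ->
  sigma_algebra setT [set S | exists2 S', M S' & forall x, D x -> (S x <-> S' (f x))].
Proof.
move=> sM; split=> /=.
- by exists set0; [exact: salg0 sM|].
- move=> A [A' MA' AA']; exists (~` A'); first exact: salgC sM _ MA'.
  by move=> x Dx; split=> [[_ nA] /(AA' _ Dx)|nA'] //; split=> // /(AA' _ Dx).
- move=> A MA.
  have /choice[A' A'P] : forall n, exists S', M S' /\
      forall x, D x -> (A n x <-> S' (f x)).
    by move=> n; have [S' ? ?] := MA n; exists S'.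
  exists (\bigcup_n A' n); first by apply: (salg_bigcup sM) => n; exact: (A'P n).1.
  move=> x Dx; split=> [[n _ An]|[n _ An]]; exists n => //.
    exact/((A'P n).2 x Dx).
  exact/((A'P n).2 x Dx).
Qed.

Section hat.
Context {R : realType} {dO : measure_display} {Omega : measurableType dO}.
Implicit Types F : R -> set (set Omega).

(** F_t together with a coordinate u that stands for the value of the random
    time. On {tau < +oo}, the events generated by F_t and the events {tau <=
    r} for r <= t are obtained from such sets by putting u = tau. *)
Definition hatF F (t : R) : set (set (Omega * R)) :=
  [set S | measurable (S : set (Past F t * R)%type)].

Lemma sub_salg_measurable (S : set (set Omega)) (S' : set (set Omega)) :
  S `<=` S' ->
  forall C, measurable (C : set (g_sigma_algebraType S * R)%type) ->
  measurable (C : set (g_sigma_algebraType S' * R)%type).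
Proof.
move=> SS C; rewrite measurable_prod_measurableType; move: C.
apply: smallest_sub; first exact: sigma_algebra_measurable.
move=> _ [A mA [B mB <-]]; apply: measurableX => //.
exact: sub_sigma_algebra2 SS _ mA.
Qed.

Lemma hat_filtration F : filtration F -> filtration (hatF F).
Proof.
move=> [sF Fm mF]; split.
- by move=> t t0; exact: sigma_algebra_measurable.
- move=> t t0 S; rewrite /hatF/= measurable_prod_measurableType; move: S.
  apply: smallest_sub; first exact: sigma_algebra_measurable.
  move=> _ [A mA [B mB <-]]; apply: measurableX => //.
  by apply: (Fm _ t0); move: mA; rewrite measurable_Past.
- by move=> s t s0 st; apply: sub_salg_measurable; exact: mF.
Qed.

Lemma hat_fst F t A : 0 <= t -> filtration F -> F t A -> hatF F t (fst @^-1` A).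
Proof.
move=> t0 fF FA; have := @measurable_fst _ _ (Past F t) R measurableT A.
by rewrite setTI; apply; rewrite measurable_Past.
Qed.

Lemma hat_section F t u A : 0 <= t -> filtration F -> hatF F t A ->
  F t [set w | A (w, u)].
Proof.
move=> t0 fF mA; rewrite -(measurable_Past _ fF t0).
have := measurable_ysection u mA; congr measurable.
by apply/seteqP; split => w; rewrite /ysection/= inE.
Qed.

Lemma hat_stopping_time F (T : Omega -> \bar R) : filtration F ->
  stopping_time F T -> stopping_time (hatF F) (T \o fst).
Proof.
move=> fF [T0 sT]; split=> [w|t t0]; first exact: T0.
exact: (hat_fst t0 fF (sT _ t0)).
Qed.

Lemma hat_stopped d F (T : Omega -> \bar R) (xi : Omega -> borel_rV R d) :
  filtration F -> measurable_wrt (stopped_sigma_algebra F T) setT xi ->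
  measurable_wrt (stopped_sigma_algebra (hatF F) (T \o fst)) setT (xi \o fst).
Proof.
move=> fF mxi B mB; have [mC FC] := mxi B mB; rewrite !setTI in mC FC *; split.
  have := @measurable_fst _ _ Omega R measurableT _ mC.
  by rewrite setTI.
by move=> t t0; exact: (hat_fst t0 fF (FC _ t0)).
Qed.

Lemma hat_Pred_proj F : filtration F ->
  @measurable_fun _ _ (Pred (hatF F)) (Pred F) setT (fun p => (p.1.1, p.2)).
Proof.
move=> fF _ C mC; rewrite setTI; move: C mC; apply: smallest_sub.
  exact: (sigma_algebra_preim _ (sigma_algebra_measurable (Pred (hatF F)))).
move=> _ [[a [B [a0 FB ->]]]|[B FB ->]] /=.
  exact: (Pred_rect a0 (hat_fst a0 fF FB)).
exact: (Pred_rect0 (hat_fst (lexx _) fF FB)).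
Qed.

Lemma hat_Pred_section F u : filtration F ->
  @measurable_fun _ _ (Pred F) (Pred (hatF F)) setT (fun p => ((p.1, u), p.2)).
Proof.
move=> fF _ C mC; rewrite setTI; move: C mC; apply: smallest_sub.
  exact: (sigma_algebra_preim _ (sigma_algebra_measurable (Pred F))).
move=> _ [[a [B [a0 FB ->]]]|[B FB ->]] /=.
  exact: (Pred_rect a0 (hat_section u a0 fF FB)).
exact: (Pred_rect0 (hat_section u (lexx _) fF FB)).
Qed.

Lemma hat_PredX_section d F u (S : set (Pred (hatF F) * borel_rV R d)%type) :
  filtration F -> measurable S ->
  measurable ([set p | S (((p.1.1, u), p.1.2), p.2)] : set (Pred F * borel_rV R d)%type).
Proof.
move=> fF mS.
have m1 : @measurable_fun _ _ (Pred F * borel_rV R d)%type (Pred (hatF F)) setT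
    ((fun p => ((p.1, u), p.2)) \o fst).
  by apply: (measurableT_comp (hat_Pred_section u fF)); exact: measurable_fst.
have := measurable_fun_pair m1 (@measurable_snd _ _ (Pred F) (borel_rV R d)).
by move=> /(_ measurableT S mS); rewrite setTI.
Qed.

End hat.

Lemma natSinv_lt {R : realType} (r : R) : 0 < r -> exists n : nat, n.+1%:R^-1 < r.
Proof.
move=> r0; have [n _ /(_ n (leqnn n))] := near_infty_natSinv_lt (PosNum r0).
by exists n.
Qed.

(** One member of the class is needed to see that the intersection consists
    of measurable sets. *)
Lemma filtration_smallest {R : realType} {dO : measure_display}
    {Omega : measurableType dO} (C : (R -> set (set Omega)) -> Prop)
    (H0 : R -> set (set Omega)) :
  right_continuous_filtration H0 -> C H0 -> filtration (smallest_filtration C).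
Proof.
move=> rH0 CH0; split.
- move=> t t0; split.
  + by move=> H [[sH _ _] _] _; exact: salg0 (sH _ t0).
  + move=> A GA H rH CH; have [[sH _ _] _] := rH; rewrite setTD.
    by apply: (salgC (sH _ t0)); exact: GA.
  + move=> A GA H rH CH; have [[sH _ _] _] := rH.
    by apply: (salg_bigcup (sH _ t0)) => n; exact: GA.
- move=> t t0 A /(_ H0 rH0 CH0) GA.
  by have [[_ Hm _] _] := rH0; exact: (Hm _ t0).
- move=> s t s0 st A GA H rH CH; have [[_ _ mH] _] := rH.
  by apply: (mH _ _ s0 st); exact: GA.
Qed.

Section enlargement.
Context {R : realType} {dO : measure_display} {Omega : measurableType dO}.
Variables (F : R -> set (set Omega)) (tau : Omega -> \bar R).
Hypotheses (fF : filtration F) (mtau : measurable_fun setT tau).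
Hypothesis tau0 : forall w, (0 < tau w)%E.
Local Notation G := (progressive_enlargement F tau).

(** The smallest filtration that contains F and for which tau is a stopping
    time; the progressive enlargement lies in its right-continuous version. *)
Definition raw_enlargement (t : R) : set (set Omega) :=
  <<s F t `|` [set A | exists2 r, 0 <= r <= t & A = [set w | (tau w <= r%:E)%E]] >>.

Let G' (t : R) : set (set Omega) := [set A | forall s, t < s -> raw_enlargement s A].

Let fG' : right_continuous_filtration G'.
Proof.
have sR s : sigma_algebra setT (raw_enlargement s) by exact: smallest_sigma_algebra.
split.
  split.
  - move=> t t0; split.
    + by move=> s _; exact: salg0.
    + by move=> A GA s ts; rewrite setTD; apply: (salgC (sR _)); exact: GA.
    + by move=> A GA s ts; apply: (salg_bigcup (sR _)) => n; exact: GA.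
  - move=> t t0 A /(_ (t + 1)); rewrite ltrDl ltr01 => /(_ isT); move: A.
    apply: smallest_sub; first exact: sigma_algebra_measurable.
    have [_ Fm _] := fF.
    move=> A [FA|[r _ ->]]; first by apply: Fm FA; rewrite addr_ge0.
    have := emeasurable_fun_infty_c measurableT mtau r%:E.
    by rewrite setTI.
  - by move=> s t s0 st A GA u tu; apply: GA; exact: le_lt_trans tu.
move=> t t0 A GA s ts; apply: (GA ((t + s) / 2)) => /=; last by rewrite midf_lt.
by rewrite midf_lt.
Qed.

Let FG' t : 0 <= t -> F t `<=` G' t.
Proof.
move=> t0 A FA s ts; apply: sub_sigma_algebra; left.
by case: fF => _ _ + ; apply; [exact: t0|exact: ltW|].
Qed.

Let stG' : stopping_time G' tau.
Proof.
split=> [w|t t0]; first exact: ltW.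
move=> s ts; apply: sub_sigma_algebra; right; exists t => //.
by rewrite t0 ltW.
Qed.

Lemma sub_enlargement t : 0 <= t -> F t `<=` G t.
Proof. by move=> t0 A FA H _ [FH _]; exact: FH. Qed.

Lemma stopping_time_enlargement : stopping_time G tau.
Proof.
split=> [w|t t0]; first exact: ltW.
by move=> H _ [_ [_ sH]]; exact: sH.
Qed.

Lemma filtration_enlargement : filtration G.
Proof. exact: (filtration_smallest fG' (conj FG' stG')). Qed.

Lemma enlargement_sub s t : s < t -> G s `<=` raw_enlargement t.
Proof. by move=> st A /(_ G' fG' (conj FG' stG')); exact. Qed.

(** The right limit in the definition of G disappears in predictable sets: a
    set (a, +oo[ x B with B in G_a is the union over n of the sets (a +
    1/(n+1), +oo[ x B, for which B belongs to the raw enlargement. Hence only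
    rectangles over raw events have to be examined. *)
Lemma Pred_enlargement_trace (U : Type) (M : set (set U)) (D : set (Omega * R))
    (f : Omega * R -> U) : sigma_algebra setT M ->
  (forall p, D p -> 0 < p.2) ->
  (forall a B, 0 <= a -> raw_enlargement a B ->
    exists2 S', M S' & forall p, D p -> (a < p.2 /\ B p.1) <-> S' (f p)) ->
  forall S, measurable (S : set (Pred G)) ->
    exists2 S', M S' & forall p, D p -> (S p <-> S' (f p)).
Proof.
move=> sM D0 h; apply: smallest_sub; first exact: sigma_algebra_trace.
have hr a B : 0 <= a -> G a B -> exists2 S', M S' &
    forall p, D p -> (a < p.2 /\ B p.1) <-> S' (f p).
  move=> a0 GB.
  have := sigma_algebra_trace D f sM => /salg_bigcup.
  move=> /(_ (fun n => [set p | a + n.+1%:R^-1 < p.2 /\ B p.1])) [].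
    move=> n; apply: h; first by rewrite addr_ge0.
    by apply: (enlargement_sub _ GB); rewrite ltrDl.
  move=> S' MS' S'P; exists S' => // p Dp; rewrite -(S'P _ Dp); split; last first.
    by move=> [n _ /= [ap Bp]]; split=> //; apply: lt_trans ap; rewrite ltrDl.
  move=> [ap Bp]; have pa : 0 < p.2 - a by rewrite subr_gt0.
  have [n hn] := natSinv_lt pa.
  by exists n => //=; rewrite -ltrBrDl.
move=> _ [[a [B [a0 GB ->]]]|[B GB ->]].
  exact: hr.
have [S' MS' S'P] := hr 0 B (lexx _) GB.
exists S' => // p Dp; rewrite -(S'P _ Dp) /=.
by split=> -[p0 Bp]; split => //; [exact: D0|exact: ltW].
Qed.

Lemma PredX_enlargement_trace d dU (U : measurableType dU) (D : set (Omega * R))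
    (f : Omega * R -> U) :
  (forall p, D p -> 0 < p.2) ->
  (forall a B, 0 <= a -> raw_enlargement a B ->
    exists2 S', measurable S' & forall p, D p -> (a < p.2 /\ B p.1) <-> S' (f p)) ->
  forall S, measurable (S : set (Pred G * borel_rV R d)%type) ->
    exists2 S', measurable (S' : set (U * borel_rV R d)%type) &
      forall p x, D p -> (S (p, x) <-> S' (f p, x)).
Proof.
move=> D0 h S; rewrite measurable_prod_measurableType => mS.
have : [set S | exists2 S', measurable (S' : set (U * borel_rV R d)%type) &
    forall y, (D `*` setT) y -> (S y <-> S' (f y.1, y.2))] S.
  move: S mS; apply: smallest_sub.
    by apply: sigma_algebra_trace; exact: sigma_algebra_measurable.
  move=> _ [A mA [B mB <-]].
  have [A' mA' AA'] := Pred_enlargement_trace (sigma_algebra_measurable U) D0 h mA.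
  exists (A' `*` B); first exact: measurableX.
  by move=> y [/AA' DA _]; split=> -[/DA ? ?].
by move=> [S' mS' SS']; exists S' => // p x Dp; exact: (SS' (p, x)).
Qed.

(** At a time t <= tau the events {tau <= r} with r < t have not happened, so
    that the past of G just before t reduces to that of F. *)
Lemma PredX_enlargement_before d (S : set (Pred G * borel_rV R d)%type) :
  measurable S ->
  exists2 S' : set (Pred F * borel_rV R d)%type, measurable S' &
    forall w t x, 0 < t -> (t%:E <= tau w)%E -> (S ((w, t), x) <-> S' ((w, t), x)).
Proof.
move=> mS; have [sF _ mF] := fF.
have [] := @PredX_enlargement_trace d _ (Pred F)
  [set p | 0 < p.2 /\ (p.2%:E <= tau p.1)%E] id _ _ S mS.
- by move=> p [].
- move=> a B a0 rB.
  have : [set B | exists2 B', F a B' & forall w, [set w | (a%:E < tau w)%E] w ->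
      (B w <-> B' w)] B.
    move: B rB; apply: smallest_sub; first exact: (sigma_algebra_trace _ id (sF _ a0)).
    move=> B [FB|[r /andP[r0 ra] ->]]; first by exists B.
    exists set0; first exact: salg0 (sF _ a0).
    move=> w /= aw; split=> // /(lt_le_trans aw).
    by rewrite lte_fin ltNge ra.
  move=> [B' FB' BB']; exists [set p | a < p.2 /\ B' p.1]; first exact: Pred_rect.
  move=> [w t] /= [t0 tw]; split=> -[at_ Bw]; split=> //; apply/(BB' w) => //=.
    by rewrite (lt_le_trans _ tw).
  by rewrite (lt_le_trans _ tw).
- by move=> S' mS' SS'; exists S' => // w t x t0 tw; exact: (SS' (w, t)).
Qed.

(** Once tau is finite, the events {tau <= r} are read off the extra
    coordinate u = tau. *)
Lemma PredX_enlargement_hat d (S : set (Pred G * borel_rV R d)%type) :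
  measurable S ->
  exists2 S' : set (Pred (hatF F) * borel_rV R d)%type, measurable S' &
    forall w t x, 0 < t -> (tau w < +oo)%E ->
      (S ((w, t), x) <-> S' (((w, fine (tau w)), t), x)).
Proof.
move=> mS; have [shF _ mhF] := hat_filtration fF.
have [] := @PredX_enlargement_trace d _ (Pred (hatF F))
  [set p | 0 < p.2 /\ (tau p.1 < +oo)%E] (fun p => ((p.1, fine (tau p.1)), p.2)) _ _ S mS.
- by move=> p [].
- move=> a B a0 rB.
  have : [set B | exists2 B', hatF F a B' & forall w, [set w | (tau w < +oo)%E] w ->
      (B w <-> B' (w, fine (tau w)))] B.
    move: B rB; apply: smallest_sub.
      exact: (sigma_algebra_trace _ (fun w => (w, fine (tau w))) (shF _ a0)).
    move=> B [FB|[r /andP[r0 ra] ->]].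
      by exists (fst @^-1` B) => //; exact: hat_fst.
    exists (snd @^-1` [set` `]-oo, r]]).
      have := @measurable_snd _ _ (Past F a) R measurableT _ (measurable_itv `]-oo, r]).
      by rewrite setTI.
    move=> w /= wfin; rewrite in_itv/= -lee_fin fineK//.
    by rewrite ge0_fin_numE// ltW.
  move=> [B' FB' BB']; exists [set p | a < p.2 /\ B' p.1]; first exact: Pred_rect.
  by move=> [w t] /= [t0 tw]; split=> -[at_ Bw]; split=> //; apply/(BB' w).
- by move=> S' mS' SS'; exists S' => // w t x t0 tw; exact: (SS' (w, t)).
Qed.

End enlargement.

(** * Paths and jump measures of step processes *)

Section step_path.
Context {R : realType} {d : nat}.
Variables (T : nat -> \bar R) (xi : nat -> 'rV[R]_d) (x : R -> 'rV[R]_d).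
Hypothesis T0 : forall n, (0 <= T n)%E.
Hypothesis Tnd : nondecreasing_seq T.
Hypothesis Toy : T @ \oo --> +oo%E.
Hypothesis Tlt : forall n, (T n < +oo)%E -> (T n < T n.+1)%E.
Hypothesis xi0 : forall n, xi n != 0 <-> (T n < +oo)%E.
Hypothesis xE : forall t, 0 <= t -> x t = \sum_(n \in [set n | (T n <= t%:E)%E]) xi n.

Lemma step_times_bounded t : exists N, forall n, (T n <= t%:E)%E -> (n < N)%N.
Proof.
have /cvgeyPgt/(_ t)[N _ NP] := Toy.
exists N => n Tn; rewrite ltnNge; apply/negP => /NP /=.
by rewrite ltNge Tn.
Qed.

Lemma step_times_finite t : finite_set [set n | (T n <= t%:E)%E].
Proof.
have [N NP] := step_times_bounded t.
by apply: (sub_finite_set _ (finite_II N)) => n /NP.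
Qed.

Lemma step_times_inj m n : T m = T n -> (T m < +oo)%E -> m = n.
Proof.
have lt_T i j : (i < j)%N -> (T i < +oo)%E -> (T i < T j)%E.
  by move=> ij Ti; apply: (lt_le_trans (Tlt Ti)); exact: Tnd.
move=> Tmn Tm; have [mn|nm|//] := ltngtP m n.
- by have := lt_T _ _ mn Tm; rewrite Tmn ltxx.
- by have := lt_T _ _ nm; rewrite Tmn -Tmn => /(_ Tm); rewrite ltxx.
Qed.

(** Below any s > 0 there is a whole interval without jump times, since only
    finitely many of them are at most s. *)
Lemma step_times_gap s : 0 < s ->
  exists2 r, 0 <= r < s & forall n, (T n < s%:E)%E -> (T n <= r%:E)%E.
Proof.
move=> s0; have [N NP] := step_times_bounded s.
suff [r r0s rP] : exists2 r, 0 <= r < s &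
    forall n, (n < N)%N -> (T n < s%:E)%E -> (T n <= r%:E)%E.
  by exists r => // n Tn; apply: rP => //; apply: NP; exact: ltW.
elim: N {NP} => [|N [r /andP[r0 rs] rP]]; first by exists 0; rewrite ?lexx.
have [TN|TN] := ltP (T N) s%:E; last first.
  exists r; first by rewrite r0.
  move=> n; rewrite ltnS leq_eqVlt => /predU1P[->|/rP//].
  by rewrite ltNge TN.
have TNf : T N \is a fin_num by rewrite ge0_fin_numE// (lt_trans TN)// ltry.
exists (Num.max r (fine (T N))).
  rewrite le_max r0/= gt_max rs -lte_fin fineK//.
move=> n; rewrite ltnS leq_eqVlt => /predU1P[-> _|nN Tn].
  by rewrite -[leLHS]fineK// lee_fin le_max lexx orbT.
by apply: (le_trans (rP _ nN Tn)); rewrite lee_fin le_max lexx.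
Qed.

(** Just before s the path is constant, because no jump time lies in a small
    interval to the left of s. *)
Lemma step_left_lim s : 0 < s ->
  left_lim x s = \sum_(n \in [set n | (T n < s%:E)%E]) xi n.
Proof.
move=> s0; rewrite /left_lim gt_eqF//.
have [r /andP[r0 rs] rP] := step_times_gap s0.
apply: lim_near_cst; first exact: norm_hausdorff.
apply: filterS2 (nbhs_left_gt rs) (nbhs_left_lt s) => u ru us.
rewrite xE; last exact: (le_trans r0 (ltW ru)).
apply: eq_fsbigl; apply/seteqP; split => n /= Tn.
  by apply: (le_lt_trans Tn); rewrite lte_fin.
by apply: (le_trans (rP _ Tn)); rewrite lee_fin ltW.
Qed.

Lemma step_jump_at n : (0 < T n)%E -> (T n < +oo)%E -> jump x (fine (T n)) = xi n.
Proof.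
move=> Tn0 Tny; have Tnf : T n \is a fin_num by rewrite ge0_fin_numE.
have s0 : 0 < fine (T n) by rewrite -lte_fin fineK.
rewrite /jump step_left_lim// xE ?ltW// fineK//.
have fin : finite_set [set k | (T k <= T n)%E].
  by have := step_times_finite (fine (T n)); rewrite fineK.
rewrite (fsbigD1 n)//=.
rewrite [X in _ + X - _](_ : _ = \sum_(k \in [set k | (T k < T n)%E]) xi k) ?addrK//.
apply: eq_fsbigl; apply/seteqP; split => k /=.
  move=> [Tk kn]; rewrite lt_neqAle Tk andbT; apply/eqP => Tkn; apply: kn.
  by apply: step_times_inj => //; rewrite Tkn.
move=> Tk; split; first exact: ltW.
by move=> kn; move: Tk; rewrite kn ltxx.
Qed.

Lemma step_jump_off s : 0 < s -> (forall n, T n != s%:E) -> jump x s = 0.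
Proof.
move=> s0 Ts; rewrite /jump step_left_lim// xE ?ltW//; apply/eqP.
rewrite subr_eq0; apply/eqP; apply: eq_fsbigl; apply/seteqP; split => k /=.
  by move=> Tk; rewrite lt_neqAle Ts.
exact: ltW.
Qed.

Lemma step_jump_set : [set s | 0 < s /\ jump x s != 0] =
  [set fine (T n) | n in [set n | (0 < T n)%E /\ (T n < +oo)%E]].
Proof.
apply/seteqP; split => [s [s0 js]|_ [n [Tn0 Tny] <-]].
  have [[n Tn]|nT] := pselect (exists n, T n = s%:E).
    by exists n; rewrite /= Tn// lte_fin ltry.
  exfalso; move: js; rewrite step_jump_off ?eqxx// => n.
  by apply/eqP => Tn; apply: nT; exists n.
split; first by rewrite -lte_fin fineK// ge0_fin_numE.
by rewrite step_jump_at//; exact/xi0.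
Qed.

End step_path.

Section jump_measure_series.
Context {R : realType} {dO : measure_display} {Omega : measurableType dO} {d : nat}.
Local Notation E := (borel_rV R d).
Variables (X : R -> Omega -> 'rV[R]_d).
Variables (T : nat -> Omega -> \bar R) (xi : nat -> Omega -> 'rV[R]_d).
Hypothesis T0 : forall n w, (0 <= T n w)%E.
Hypothesis Tcv : forall w, nondecreasing_seq (T ^~ w) /\ T ^~ w @ \oo --> +oo%E.
Hypothesis Tlt : forall n w, (T n w < +oo)%E -> (T n w < T n.+1 w)%E.
Hypothesis xi0 : forall n w, xi n w != 0 <-> (T n w < +oo)%E.
Hypothesis XE : forall t w, 0 <= t ->
  X t w = \sum_(n \in [set n | (T n w <= t%:E)%E]) xi n w.

(** A jump time equal to 0 contributes to the initial value and not to the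
    jump measure, since the left limit at 0 is the value at 0. *)
Definition active n : set Omega := [set w | (0 < T n w)%E /\ (T n w < +oo)%E].

Definition atom (n : nat) (w : Omega) : {measure set (R * E) -> \bar R} :=
  if w \in active n then (\d_((fine (T n w), xi n w) : R * E) : {measure set _ -> \bar R})
  else mzero.

(** The jump measure is a countable sum of unit masses at the points (T_n,
    xi_n); this form shows that it is a measure and makes it integrable term
    by term. *)
Lemma jump_measureE w B : jump_measure X w B = mseries (atom ^~ w) 0 B.
Proof.
have [Tnd Toy] := Tcv w.
have xE t : 0 <= t -> (X ^~ w) t = \sum_(n \in [set n | (T n w <= t%:E)%E]) xi n w.
  exact: XE.
have jn n : active n w -> jump (X ^~ w) (fine (T n w)) = xi n w.
  move=> [Tn0 Tny]; exact: (step_jump_at (fun n => T0 n w) Tnd Toy (Tlt ^~ w) xE).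
rewrite /jump_measure.
rewrite (step_jump_set (fun n => T0 n w) Tnd Toy (Tlt ^~ w) (xi0 ^~ w) xE).
rewrite (@esum_set_image _ _ _ (fun n => fine (T n w)))//; last first.
  move=> m n; rewrite !inE => -[Tm0 Tmy] [Tn0 Tny] Tmn.
  apply: (step_times_inj Tnd (Tlt ^~ w)) => //.
  by rewrite -[LHS]fineK ?Tmn ?fineK// ge0_fin_numE.
rewrite /mseries eseries_mkcond; apply: eq_eseriesr => n _.
rewrite /atom; case: ifPn => nact.
  by rewrite jn; [rewrite mem_set//; exact/set_mem|exact/set_mem].
by rewrite memNset// => nA; move/negP: nact; apply; exact/mem_set.
Qed.

Lemma integral_jump_measure w (D : set (R * E)) (f : R * E -> \bar R) :
  measurable D -> measurable_fun D f -> (forall q, D q -> 0 <= f q)%E ->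
  (\int[jump_measure X w]_(q in D) f q =
   \sum_(n <oo) if w \in active n then (f \_ D) (fine (T n w), xi n w) else 0)%E.
Proof.
move=> mD mf f0; have -> : jump_measure X w = mseries (atom ^~ w) 0.
  by apply/funext => B; exact: jump_measureE.
rewrite ge0_integral_measure_series//; apply: eq_eseriesr => n _.
rewrite /atom; case: ifPn => _; last by rewrite integral_measure_zero.
rewrite integral_dirac// patchE diracE; case: ifPn => _; first by rewrite mul1e.
by rewrite mul0e.
Qed.

Variable F : R -> set (set Omega).
Local Notation PX := (Pred F * E)%type.
Hypothesis fF : filtration F.
Hypothesis sT : forall n, stopping_time F (T n).
Hypothesis mxi : forall n, measurable_wrt (stopped_sigma_algebra F (T n)) setT
  (xi n : Omega -> E).

(** The n-th jump as a point of Omega x R x R^d, at which predictable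
    functions can be evaluated. *)
Definition marked_atom n w : PX := ((w, fine (T n w)), xi n w).

(** Evaluation of a predictable set at the n-th jump, restricted to jumps
    before K, so that the result is an event of F_K; the bound K makes a
    conditional law at the fixed time K applicable. *)
Lemma active_le n K (S : set PX) : 0 <= K -> measurable S ->
  F K [set w | [/\ active n w, (T n w <= K%:E)%E & S (marked_atom n w)]].
Proof.
move=> K0 mS.
have mS' : measurable (S `&` [set p | 0 < p.1.2]).
  apply: measurableI => //.
  have := @measurable_fst _ _ (Pred F) E measurableT _ (Pred_after fF (lexx 0)).
  by rewrite setTI.
have := PredX_at_time fF K0 (sT n) (mxi n) mS'; congr (F K _).
apply/seteqP; split => w /=.
  move=> [TK [STw Tw0]]; split => //; split.
    by rewrite -(fineK (_ : T n w \is a fin_num)) ?lte_fin// ge0_fin_numE// (le_lt_trans TK)// ltry.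
  by rewrite (le_lt_trans TK)// ltry.
move=> [[Tw0 Twy] TK STw]; split => //; split => //.
by rewrite -lte_fin fineK// ge0_fin_numE.
Qed.

Lemma measurable_active_atom n (S : set PX) : measurable S ->
  measurable [set w | active n w /\ S (marked_atom n w)].
Proof.
move=> mS; have [_ Fm _] := fF.
rewrite (_ : mkset _ = \bigcup_K
    [set w | [/\ active n w, (T n w <= K%:R%:E)%E & S (marked_atom n w)]]).
  by apply: bigcupT_measurable => K; apply: (Fm K%:R) => //; exact: active_le.
apply/seteqP; split => w /=; last by move=> [K _ []].
move=> [[Tw0 Twy] Sw]; exists (Num.trunc (fine (T n w))).+1 => //; split => //.
rewrite -[leLHS]fineK ?ge0_fin_numE// lee_fin; exact/ltW/truncnS_gt.
Qed.

Lemma measurable_active n : measurable (active n).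
Proof.
have := measurable_active_atom n measurableT; congr measurable.
by apply/seteqP; split => w /=; tauto.
Qed.

Lemma measurable_at_atom n (f : PX -> \bar R) : measurable_fun setT f ->
  measurable_fun setT ((fun w => f (marked_atom n w)) \_ (active n)).
Proof.
move=> mf; apply/(measurable_restrictT _ (measurable_active n)) => _ B mB.
have := mf measurableT B mB; rewrite setTI => /(measurable_active_atom n).
by congr measurable; apply/seteqP; split.
Qed.

Lemma expect_jump_integral (P : {measure set Omega -> \bar R}) (f : PX -> \bar R) :
  measurable_fun setT f -> (forall x, 0 <= f x)%E ->
  (\int[P]_w \int[jump_measure X w]_(q in `[0%R, +oo[ `*` setT) f ((w, q.1), q.2) =
   \sum_(n <oo) \int[P]_w ((fun w => f (marked_atom n w)) \_ (active n)) w)%E.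
Proof.
move=> mf f0; rewrite -integral_nneseries//; last 2 first.
- by move=> n; exact: measurable_at_atom.
- by move=> n w _; rewrite patchE; case: ifP.
apply: eq_integral => w _; rewrite integral_jump_measure//.
- apply: eq_eseriesr => n _; rewrite !patchE; case: ifPn => // /set_mem[Tn0 Tny].
  rewrite mem_set//; split => //=; rewrite in_itv/= andbT.
  exact: fine_ge0.
- by apply: measurableX.
- by apply/measurable_funTS; apply: (measurableT_comp mf); exact: PredX_section.
Qed.

End jump_measure_series.

(** * The compensator of the jumps *)

Section predictable_random_measure_facts.
Context {R : realType} {dO : measure_display} {Omega : measurableType dO} {d : nat}.
Local Notation E := (borel_rV R d).
Variables (F : R -> set (set Omega)).
Local Notation PX := (Pred F * E)%type.
Hypothesis fF : filtration F.

Lemma measurable_seg (t : R) : measurable [set q : R * E | 0 <= q.1 <= t].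
Proof.
rewrite (_ : mkset _ = `[0, t] `*` setT); first exact: measurableX.
by apply/seteqP; split => q /=; rewrite in_itv/= => // -[].
Qed.

Lemma measurable_pos : measurable [set q : R * E | 0 <= q.1].
Proof.
rewrite (_ : mkset _ = `[0, +oo[ `*` setT); first exact: measurableX.
by apply/seteqP; split => q /=; rewrite in_itv/= andbT => // -[].
Qed.

Lemma measurable_neg : measurable [set q : R * E | q.1 < 0].
Proof.
rewrite (_ : mkset _ = `]-oo, 0[ `*` setT); first exact: measurableX.
by apply/seteqP; split => q /=; rewrite in_itv/=; [|case].
Qed.

Lemma measurable_instant (t : R) : measurable [set q : R * E | q.1 = t].
Proof.
rewrite (_ : mkset _ = [set t] `*` setT); first exact: measurableX.
by apply/seteqP; split => q /=; [|case].
Qed.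

Lemma predictable_function_measurable (f : PX -> R) :
  measurable_fun setT f -> predictable_function F f.
Proof.
by move=> mf; apply/(predictable_functionP _ fF); exact: measurable_funTS.
Qed.

Lemma Pred_of_predictable (g : Omega * R -> \bar R) :
  measurable_wrt (predictable F) time_space g -> (forall p, p.2 < 0 -> g p = 0%E) ->
  @measurable_fun _ _ (Pred F) _ setT g.
Proof.
move=> mg g0.
have -> : g = (g : Pred F -> \bar R) \_ time_space.
  apply/funext => p; rewrite patchE; case: ifPn => // /negP np; apply: g0.
  by rewrite ltNge; apply/negP => p0; apply: np; rewrite inE time_spaceE.
apply/(measurable_restrictT _ (Pred_time_space fF)) => _ B mB.
by have /(predictableP _ fF)[] := mg B mB.
Qed.

Lemma predictable_integral_seg (nu : Omega -> {measure set (R * E) -> \bar R})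
    (f : PX -> R) : predictable_random_measure F (fun w => nu w) ->
  measurable_fun setT f -> (forall x, 0 <= f x) ->
  @measurable_fun _ _ (Pred F) _ setT (fun p =>
    \int[nu p.1]_(q in [set q | (0 <= q.1 <= p.2)%R]) (f ((p.1, q.1), q.2))%:E)%E.
Proof.
move=> pnu mf f0.
have := pnu f (predictable_function_measurable mf) f0.
move=> /Pred_of_predictable h.
rewrite [X in measurable_fun _ X](_ : _ = (fun p : Pred F =>
    (\int[nu p.1]_(q in `[0%R, p.2] `*` setT) (f (p.1, q.1, q.2))%:E)%E)).
  apply: h => p p0; rewrite (_ : _ `*` _ = set0) ?integral_set0//.
  rewrite -subset0 => q [/=]; rewrite in_itv/= => /andP[q0 qp].
  by have := le_lt_trans (le_trans q0 qp) p0; rewrite ltxx.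
apply/funext => p; congr (integral _ _ _).
by apply/seteqP; split => q /=; rewrite in_itv/= => // -[].
Qed.

Lemma measurable_Pred_at (K : R) : 0 <= K ->
  @measurable_fun _ _ Omega (Pred F) setT (fun w => (w, K)).
Proof.
move=> K0 _ C mC; rewrite setTI; have [_ Fm _] := fF.
by apply: (Fm _ K0); exact: (Pred_section_time fF K0 mC).
Qed.

Lemma measurable_integral_pos (nu : Omega -> {measure set (R * E) -> \bar R})
    (f : PX -> \bar R) : measurable_fun setT f -> (forall x, 0 <= f x)%E ->
  @measurable_fun _ _ (Pred F) _ setT (fun p =>
    \int[nu p.1]_(q in [set q | (0 <= q.1 <= p.2)%R]) f ((p.1, q.1), q.2))%E ->
  measurable_fun setT
    (fun w => \int[nu w]_(q in [set q | (0 <= q.1)%R]) f ((w, q.1), q.2))%E.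
Proof.
move=> mf f0 mseg.
apply: (@emeasurable_fun_cvg _ _ _ _ (fun (n : nat) w =>
  \int[nu w]_(q in [set q | (0 <= q.1 <= n%:R)%R]) f ((w, q.1), q.2))%E).
  move=> n; have := measurableT_comp mseg (measurable_Pred_at (ler0n R n)).
  exact.
move=> w _.
rewrite (_ : [set q : R * E | 0 <= q.1] =
    \bigcup_n [set q : R * E | 0 <= q.1 <= n%:R]); last first.
  apply/seteqP; split => q /=; last by move=> [n _ /andP[]].
  move=> q0; exists (Num.trunc q.1).+1 => //=; rewrite q0/=.
  exact/ltW/truncnS_gt.
apply: ge0_nondecreasing_set_cvg_integral.
- move=> m n mn; apply/subsetPset => q /= /andP[-> qm].
  by rewrite (le_trans qm)// ler_nat.
- by move=> n; exact: measurable_seg.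
- by move=> n; apply: measurable_funTS; apply: (measurableT_comp mf); exact: PredX_section.
- by move=> n q _; exact: f0.
Qed.

(** If sigma < t then some rational q separates them, and {sigma <= q} is
    known at q. *)
Lemma Pred_after_stopping (sigma : Omega -> \bar R) : stopping_time F sigma ->
  measurable ([set p | (sigma p.1 < p.2%:E)%E] : set (Pred F)).
Proof.
move=> [s0 ss].
rewrite (_ : mkset _ = \bigcup_(q : rat) (if 0 <= ratr q :> R then
    [set p | ratr q < p.2 /\ [set w | (sigma w <= (ratr q)%:E)%E] p.1] else set0)).
  apply: bigcupT_measurable_rat => q; case: ifPn => // q0.
  by apply: Pred_rect => //; exact: ss.
apply/seteqP; split => [[w t]|[w t]] /=.
  move=> st; have sf : sigma w \is a fin_num.
    by rewrite ge0_fin_numE// (lt_trans st)// ltry.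
  have [q] : exists q, ratr q \in `]fine (sigma w), t[.
    by apply: rat_in_itvoo; rewrite -lte_fin fineK.
  rewrite in_itv/= => /andP[sq qt]; exists q => //.
  rewrite ifT; last by rewrite (le_trans _ (ltW sq))// fine_ge0.
  by split => //=; rewrite -[leLHS]fineK// lee_fin ltW.
move=> [q _]; case: ifPn => // q0 [/= qt sq].
by apply: (le_lt_trans sq); rewrite lte_fin.
Qed.

End predictable_random_measure_facts.

Section compensator.
Context {R : realType} {dO : measure_display} {Omega : measurableType dO}
  (P : probability Omega R) {d : nat}.
Local Notation E := (borel_rV R d).
Variables (F : R -> set (set Omega)) (X : R -> Omega -> 'rV[R]_d).
Variables (T : nat -> Omega -> \bar R) (xi : nat -> Omega -> 'rV[R]_d).
Local Notation PX := (Pred F * E)%type.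
Hypothesis fF : filtration F.

(** The second half of the definition of a step process, with the jump times
    and the jumps made explicit. *)
Definition step_data (F : R -> set (set Omega)) : Prop :=
    [/\ forall n, stopping_time F (T n),
        forall w, nondecreasing_seq (T ^~ w) /\ T ^~ w @ \oo --> +oo%E,
        forall n w, (T n w < +oo)%E -> (T n w < T n.+1 w)%E,
        forall n, measurable_wrt (stopped_sigma_algebra F (T n)) setT
                    (xi n : Omega -> borel_rV R d) /\
                  (forall w, xi n w != 0 <-> (T n w < +oo)%E)
      & forall t w, 0 <= t ->
          X t w = \sum_(n \in [set n | (T n w <= t%:E)%E]) xi n w].

Hypothesis steps : step_data F.

Let T0 n w : (0 <= T n w)%E. Proof. by case: steps => + _ _ _ _ => /(_ n)[]. Qed.

Lemma step_measurable_active_atom n (S : set PX) : measurable S ->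
  measurable [set w | active T n w /\ S (marked_atom T xi F n w)].
Proof.
case: steps => sT Tcv Tlt xiP XE.
exact: (measurable_active_atom T0 fF sT (fun n => (xiP n).1)).
Qed.

Lemma step_measurable_at_atom n (f : PX -> \bar R) : measurable_fun setT f ->
  measurable_fun setT ((fun w => f (marked_atom T xi F n w)) \_ (active T n)).
Proof.
case: steps => sT Tcv Tlt xiP XE.
exact: (measurable_at_atom T0 fF sT (fun n => (xiP n).1)).
Qed.

Lemma step_expect_jump (f : PX -> \bar R) :
  measurable_fun setT f -> (forall x, 0 <= f x)%E ->
  (\int[P]_w \int[jump_measure X w]_(q in `[0%R, +oo[ `*` setT) f ((w, q.1), q.2) =
   \sum_(n <oo) \int[P]_w ((fun w => f (marked_atom T xi F n w)) \_ (active T n)) w)%E.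
Proof.
case: steps => sT Tcv Tlt xiP XE.
exact: (expect_jump_integral T0 Tcv Tlt (fun n => (xiP n).2) XE fF sT (fun n => (xiP n).1) P).
Qed.

Variable nu : Omega -> {measure set (R * E) -> \bar R}.
Hypothesis dualF : dual_predictable_projection P F (jump_measure X) (fun w => nu w).

Lemma dual_expect (f : PX -> R) : measurable_fun setT f -> (forall x, 0 <= f x) ->
  (\int[P]_w \int[nu w]_(q in [set q | 0 <= q.1]%R) (f ((w, q.1), q.2))%:E =
   \sum_(n <oo) \int[P]_w ((fun w => (f (marked_atom T xi F n w))%:E) \_ (active T n)) w)%E.
Proof.
move=> mf f0; rewrite -(step_expect_jump (f := EFin \o f)); last 2 first.
- exact/measurable_EFinP.
- by move=> x; rewrite lee_fin.
rewrite -(dualF.2 f (predictable_function_measurable fF mf) f0).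
apply: eq_integral => w _; congr (integral _ _ _).
by apply/seteqP; split => q /=; rewrite in_itv/= andbT => // -[].
Qed.

Definition mass_upto (p : Omega * R) : \bar R := nu p.1 [set q | 0 <= q.1 <= p.2].

Lemma mass_upto_measurable : @measurable_fun _ _ (Pred F) _ setT mass_upto.
Proof.
have := predictable_integral_seg fF dualF.1 (f := cst 1) (measurable_cst _) (fun _ => ler01).
congr measurable_fun; apply/funext => p.
by rewrite /= integral_cst ?mul1e//; exact: measurable_seg.
Qed.

Lemma mass_upto_mono w s t : s <= t -> (mass_upto (w, s) <= mass_upto (w, t))%E.
Proof.
move=> st; apply: le_measure; rewrite ?inE; try exact: measurable_seg.
by move=> q /= /andP[-> qs]; rewrite (le_trans qs).
Qed.

(** The set {t <= T_n} is predictable and contains at most n + 1 jumps, hence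
    by the defining property of the compensator its expected mass is at most
    n + 1. *)
Lemma mass_upto_time_ae n :
  {ae P, forall w, (nu w [set q | (0 <= q.1)%R /\ (q.1%:E <= T n w)%E] < +oo)%E}.
Proof.
case: steps => sT Tcv Tlt xiP XE.
set S : set PX := [set x | 0 <= x.1.2 /\ (x.1.2%:E <= T n x.1.1)%E].
have mS : measurable S.
  have h : measurable (time_space `\` [set p | (T n p.1 < p.2%:E)%E] : set (Pred F)).
    by apply: measurableD; [exact: Pred_time_space|exact: Pred_after_stopping].
  have := @measurable_fst _ _ (Pred F) E measurableT _ h.
  rewrite setTI; congr measurable; apply/seteqP; split => x /=; rewrite time_spaceE.
    by move=> [x0 /negP]; rewrite -leNgt.
  by move=> [x0 xT]; split => //; apply/negP; rewrite -leNgt.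
have nuS w : nu w [set q | (0 <= q.1)%R /\ (q.1%:E <= T n w)%E] =
    (\int[nu w]_(q in [set q | 0 <= q.1]%R) (\1_S ((w, q.1), q.2))%:E)%E.
  rewrite [RHS](_ : _ = (\int[nu w]_(q in [set q | 0 <= q.1]%R)
      (\1_[set q : R * E | S ((w, q.1), q.2)] q)%:E)%E).
    rewrite integral_indic//; last exact: measurable_slice.
      by congr (nu w _); apply/seteqP; rewrite /S/=; split => q /=; tauto.
    exact: measurable_pos.
  by apply: eq_integral => q _; rewrite !indicE.
have E1 := dual_expect (measurable_indic mS : measurable_fun setT (\1_S : PX -> R))
  (fun x => ltac:(by [])).
have fin : (\int[P]_w nu w [set q | (0 <= q.1)%R /\ (q.1%:E <= T n w)%E] < +oo)%E.
  under eq_integral do rewrite nuS.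
  rewrite E1; apply: (@le_lt_trans _ _ (\sum_(k <oo) if (k <= n)%N then 1 else 0)%E).
    apply: lee_nneseries => [k _ _|k _].
      by apply: integral_ge0 => w _; rewrite patchE; case: ifP => // _; rewrite lee_fin.
    case: ifPn => kn.
      rewrite -(probability_setT P) -[leRHS]mul1e -integral_cst//.
      apply: ge0_le_integral => //.
      - by move=> w _; rewrite patchE; case: ifP => // _; rewrite lee_fin.
      - apply: (step_measurable_at_atom k (f := fun x => (\1_S x)%:E)).
        by apply/measurable_EFinP; exact: measurable_indic.
      - by move=> w _; rewrite patchE; case: ifP => // _; rewrite lee_fin indicE lern1 leq_b1.
    rewrite integral0_eq// => w _; rewrite patchE; case: ifPn => // /set_mem[Tk0 Tky].
    rewrite indicE memNset// => -[/= _]; rewrite fineK ?ge0_fin_numE//.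
    apply/negP; rewrite -ltNge.
    have Tn : (T n w < +oo)%E.
      by apply: le_lt_trans Tky; apply: (Tcv w).1; rewrite ltnW// ltnNge.
    by apply: (lt_le_trans (Tlt _ _ Tn)); apply: (Tcv w).1; rewrite ltnNge.
  rewrite (nneseries_split _ n.+1)//; last by move=> k _; case: ifP.
  rewrite [X in (_ + X)%E]eseries0 ?adde0; last first.
    by move=> k nk _; rewrite leqNgt; move: nk; rewrite add0n => ->.
  by apply/lte_sum_pinfty => k _; case: ifP => // _; rewrite ltry.
have mnu : measurable_fun setT
    (fun w => nu w [set q | (0 <= q.1)%R /\ (q.1%:E <= T n w)%E]).
  rewrite [X in measurable_fun _ X](funext nuS).
  apply: (measurable_integral_pos fF (f := fun x => (\1_S x)%:E)).
  - by apply/measurable_EFinP; exact: measurable_indic.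
  - by move=> x; rewrite lee_fin.
  - exact: (predictable_integral_seg fF dualF.1
      (measurable_indic mS : measurable_fun setT (\1_S : PX -> R))
      (fun x => ltac:(by []))).
have /integrable_ae : P.-integrable setT (fun w => nu w [set q | (0 <= q.1)%R /\ (q.1%:E <= T n w)%E]).
  apply/integrableP; split => //.
  by under eq_integral do rewrite gee0_abs//.
move=> /(_ measurableT); apply: filterS => w /(_ I).
by rewrite ge0_fin_numE.
Qed.

Lemma mass_upto_fin_ae : {ae P, forall w, forall t, (mass_upto (w, t) < +oo)%E}.
Proof.
case: steps => sT Tcv Tlt xiP XE.
apply: filterS (ae_foralln mass_upto_time_ae) => w h t.
have /cvgeyPgt/(_ t)[N _ /(_ N (leqnn N)) /= tN] := (Tcv w).2.
apply: le_lt_trans (h N); apply: le_measure; rewrite ?inE.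
- exact: measurable_seg.
- have [TN|TN] := eqVneq (T N w) +oo%E.
    rewrite TN (_ : mkset _ = [set q | 0 <= q.1]); first exact: measurable_pos.
    by apply/seteqP; split => q /=; [case|move=> ->; rewrite leey].
  have TNf : T N w \is a fin_num by rewrite ge0_fin_numE// ltey.
  rewrite (_ : mkset _ = [set q | 0 <= q.1 <= fine (T N w)]); first exact: measurable_seg.
  by apply/seteqP; split => q /=; rewrite -[in X in (_ <= X)%E](fineK TNf) lee_fin;
    [move=> [-> ->]|move=> /andP[]].
- move=> q /= /andP[q0 qt]; split => //.
  by apply: le_trans (ltW tN); rewrite lee_fin.
Qed.

(* With these coefficients the series of the c_n is at most 1 and so is the
   series of the n c_n. *)
Let c (n : nat) : R := (n.+1%:R * 2 ^+ n.+1)^-1.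

Let A (n : nat) : set (Omega * R) := [set p | 0 <= p.2 /\ (mass_upto p <= n%:R%:E)%E].

Let mA n : measurable (A n : set (Pred F)).
Proof.
have := mass_upto_measurable measurableT (emeasurable_itv `]-oo, (n%:R)%:E]).
rewrite setTI => h; have := measurableI _ _ (Pred_time_space fF) h.
congr measurable; apply/seteqP; split => p; rewrite /setI/= time_spaceE in_itv//=.
Qed.

Let cge0 n : 0 <= c n. Proof. by rewrite invr_ge0 mulr_ge0. Qed.

Let half_sum : (\sum_(n <oo) ((2 ^+ n.+1)^-1)%:E = 1 :> \bar R)%E.
Proof.
have := @cvg_geometric_eseries_half R 1 0; rewrite expr0 divr1 => /cvg_lim <-//.
congr (limn _); apply/funext => n; apply: eq_bigr => k _.
by rewrite div1r addn1 natrX.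
Qed.

(** The n-th term lives on the times at which the cumulated mass is at most
    n, so that it contributes at most n c_n to the total weighted mass. *)
Definition eweight (p : Omega * R) : \bar R := (\sum_(n <oo) (c n * \1_(A n) p)%:E)%E.

Let eweight_ge0 p : (0 <= eweight p)%E.
Proof. by apply: nneseries_ge0 => n _ _; rewrite lee_fin mulr_ge0. Qed.

Let eweight_le1 p : (eweight p <= 1)%E.
Proof.
rewrite -half_sum; apply: lee_nneseries => [n _ _|n _].
  by rewrite lee_fin mulr_ge0.
rewrite lee_fin -[leRHS]mulr1; apply: ler_pM => //.
  by rewrite lef_pV2 ?posrE ?mulr_gt0 ?exprn_gt0// ler_peMl// ?exprn_ge0// ler1n.
Qed.

Let eweight_fin p : eweight p \is a fin_num.
Proof. by rewrite ge0_fin_numE// (le_lt_trans (eweight_le1 p))// ltry. Qed.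

Definition weight (p : Omega * R) : R := fine (eweight p).

Lemma weight_ge0 p : 0 <= weight p. Proof. exact: fine_ge0. Qed.

Lemma weight_measurable : @measurable_fun _ _ (Pred F) _ setT weight.
Proof.
apply: measurableT_comp => //; apply: ge0_emeasurable_sum => [n p _ _|n _].
  by rewrite lee_fin mulr_ge0.
apply/measurable_EFinP; apply: measurable_funM => //.
Qed.

Lemma weight_neg p : p.2 < 0 -> weight p = 0.
Proof.
move=> p0; rewrite /weight /eweight eseries0// => n _ _.
by rewrite indicE memNset ?mulr0// => -[]; rewrite leNgt p0.
Qed.

Lemma weight_gt0 p : 0 <= p.2 -> (mass_upto p < +oo)%E -> 0 < weight p.
Proof.
move=> p0 cp; rewrite -lte_fin fineK//.
have cf : mass_upto p \is a fin_num by rewrite ge0_fin_numE.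
pose N := (Num.trunc (fine (mass_upto p))).+1.
apply: lt_le_trans (nneseries_lim_ge N.+1 _); last first.
  by move=> n _ _; rewrite lee_fin mulr_ge0.
rewrite big_nat_recr//=; apply: (@lt_le_trans _ _ (c N * \1_(A N) p)%:E).
  rewrite indicE mem_set; last first.
    split => //=; rewrite -[leLHS]fineK// lee_fin.
    by apply/ltW; exact: truncnS_gt.
  by rewrite mulr1 lte_fin invr_gt0 mulr_gt0// exprn_gt0.
by rewrite leeDr// sume_ge0// => n _; rewrite lee_fin mulr_ge0.
Qed.

Lemma weight_gt0_ae : {ae P, forall w, forall t, 0 <= t -> 0 < weight (w, t)}.
Proof. by apply: filterS mass_upto_fin_ae => w h t t0; exact: weight_gt0. Qed.

Lemma weight_slice_measurable w : measurable_fun setT (fun q : R * E => weight (w, q.1)).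
Proof.
have := measurableT_comp (measurableT_comp weight_measurable measurable_fst)
  (@PredX_section _ _ _ d F w).
exact.
Qed.

Lemma weight_slice_ge0 w (q : R * E) : 0 <= weight (w, q.1). Proof. exact: weight_ge0. Qed.

(** The compensator need not be finite, and not even sigma-finite in an
    exceptional set of paths. Multiplied by this predictable weight it has
    total mass at most 1 for every w, and no information is lost because the
    weight is almost surely positive everywhere. *)
Definition wnu (w : Omega) : {measure set (R * E) -> \bar R} :=
  mdensity (nu w) (weight_slice_measurable w) (weight_slice_ge0 w).

Lemma wnuE w S : measurable S ->
  wnu w S = (\int[nu w]_(q in S) (weight (w, q.1))%:E)%E.
Proof. by []. Qed.

Lemma integral_wnu w (f : PX -> \bar R) : measurable_fun setT f ->
  (forall x, 0 <= f x)%E ->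
  (\int[wnu w]_q f ((w, q.1), q.2) =
   \int[nu w]_(q in [set q | (0 <= q.1)%R]) (f ((w, q.1), q.2) * (weight (w, q.1))%:E))%E.
Proof.
move=> mf f0; rewrite integral_mdensity//; last first.
  by apply: (measurableT_comp mf); exact: PredX_section.
rewrite [RHS]integral_mkcond; apply: eq_integral => q _; rewrite patchE.
case: ifPn => // /negP q0; rewrite weight_neg ?mule0// ltNge.
by apply/negP => q0'; apply: q0; rewrite inE.
Qed.

Lemma wnu_le1 w : (wnu w setT <= 1)%E.
Proof.
have mAs n : measurable [set q : R * E | A n (w, q.1)].
  suff -> : [set q : R * E | A n (w, q.1)] =
      [set q | (A n `*` setT : set PX) ((w, q.1), q.2)].
    by apply: measurable_slice; apply: measurableX.
  by apply/seteqP; split => q //=; case.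
rewrite wnuE//.
rewrite (_ : (\int[nu w]_(q in setT) _)%E = (\int[nu w]_(q in setT)
    (\sum_(n <oo) (c n * \1_[set q : R * E | A n (w, q.1)] q)%:E))%E); last first.
  by apply: eq_integral => q _; rewrite fineK.
rewrite integral_nneseries//; last 2 first.
- by move=> n; apply/measurable_EFinP; apply: measurable_funM.
- by move=> n q _; rewrite lee_fin mulr_ge0.
rewrite -half_sum; apply: lee_nneseries => [n _ _|n _].
  by apply: integral_ge0 => q _; rewrite lee_fin mulr_ge0.
under eq_integral do rewrite EFinM.
rewrite ge0_integralZl_EFin//; last exact/measurable_EFinP.
rewrite integral_indic// setIT.
apply: (@le_trans _ _ ((c n)%:E * n%:R%:E)%E).
  rewrite lee_wpmul2l ?lee_fin// -[X in nu w X]setTI.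
  apply: (proj2 (@le_measure_initial_segment _ E R (nu w) setT
    [set t | A n (w, t)] n%:R%:E measurableT _ _ _ _)).
  - by rewrite lee_fin.
  - by move=> t [].
  - move=> s t /andP[s0 st] [t0 ct]; split => //=.
    by apply: le_trans ct; exact: mass_upto_mono.
  - by move=> t [t0 ct]; rewrite setTI.
rewrite -EFinM lee_fin /c invfM mulrAC -[leRHS]mul1r.
apply: ler_pM; rewrite ?invr_ge0 ?exprn_ge0//.
by rewrite mulrC ler_pdivrMr// mul1r ler_nat.
Qed.

Lemma wnu_fin w : (wnu w setT < +oo)%E.
Proof. by apply: le_lt_trans (wnu_le1 w) _; rewrite ltry. Qed.

Lemma wnu_seg_measurable (f : PX -> R) : measurable_fun setT f ->
  (forall x, 0 <= f x) ->
  @measurable_fun _ _ (Pred F) _ setT (fun p =>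
    \int[nu p.1]_(q in [set q | (0 <= q.1 <= p.2)%R])
      (f ((p.1, q.1), q.2) * weight (p.1, q.1))%:E)%E.
Proof.
move=> mf f0.
have := predictable_integral_seg fF dualF.1 (f := fun x : PX => f x * weight x.1).
apply.
- apply: measurable_funM => //; apply: (measurableT_comp weight_measurable).
  exact: measurable_fst.
- by move=> x; rewrite mulr_ge0// weight_ge0.
Qed.

Lemma wnu_rect (a : R) B : 0 <= a -> measurable B ->
  @measurable_fun _ _ (Pred F) _ setT
    (fun p => wnu p.1 [set q | a < q.1 <= p.2 /\ B q.2]).
Proof.
move=> a0 mB; set S : set PX := [set p | a < p.2] `*` B.
have mS : measurable S by apply: measurableX => //; exact: Pred_after.
have := wnu_seg_measurable
  (measurable_indic mS : measurable_fun setT (\1_S : PX -> R))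
  (fun x => ltac:(by [])).
congr measurable_fun; apply/funext => p.
rewrite wnuE; last first.
  rewrite (_ : mkset _ = `]a, p.2] `*` B); first exact: measurableX.
  by apply/seteqP; split => q /=; rewrite in_itv.
rewrite [LHS]integral_mkcond [RHS]integral_mkcond; apply: eq_integral => q _.
rewrite !patchE; case: ifPn => [/set_mem|/negP] q1; case: ifPn => [/set_mem|/negP] q2 //=.
- rewrite indicE mem_set ?mul1r//; split=> /=; last by case: q2.
  by case: q2 => /andP[].
- rewrite indicE memNset ?mul0r// => -[/= aq Bq]; apply: q2; apply/mem_set; split => //.
  by rewrite /= aq; case/andP: q1.
- exfalso; apply: q1; apply/mem_set => /=; case: q2 => /andP[aq ->] _.
  by rewrite (le_trans a0 (ltW aq)).
Qed.

Lemma wnu_rect0 B : measurable B ->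
  @measurable_fun _ _ (Pred F) _ setT
    (fun p => wnu p.1 [set q | 0 <= q.1 <= p.2 /\ B q.2]).
Proof.
move=> mB; set S : set PX := setT `*` B.
have mS : measurable S by exact: measurableX.
have := wnu_seg_measurable
  (measurable_indic mS : measurable_fun setT (\1_S : PX -> R))
  (fun x => ltac:(by [])).
congr measurable_fun; apply/funext => p.
rewrite wnuE; last first.
  rewrite (_ : mkset _ = `[0, p.2] `*` B); first exact: measurableX.
  by apply/seteqP; split => q /=; rewrite in_itv.
rewrite [LHS]integral_mkcond [RHS]integral_mkcond; apply: eq_integral => q _.
rewrite !patchE; case: ifPn => [/set_mem|/negP] q1; case: ifPn => [/set_mem|/negP] q2 //=.
- by rewrite indicE mem_set ?mul1r//; split=> //=; case: q2.
- rewrite indicE memNset ?mul0r// => -[/= _ Bq]; apply: q2; apply/mem_set; split => //.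
- by exfalso; apply: q1; apply/mem_set => /=; case: q2.
Qed.

(** The expected weighted number of jumps in a predictable set is its
    expected weighted mass; the weight is positive at the jumps, so if the
    mass vanishes there are no jumps. *)
Lemma wnu_null_no_jump (S : set PX) n : measurable S ->
  (forall w, wnu w [set q | S ((w, q.1), q.2)] = 0%E) ->
  P [set w | active T n w /\ S (marked_atom T xi F n w)] = 0%E.
Proof.
move=> mS S0.
pose f (x : PX) : R := \1_S x * weight x.1.
have mf : measurable_fun setT f.
  apply: measurable_funM; first exact: measurable_indic.
  by apply: (measurableT_comp weight_measurable); exact: measurable_fst.
have f0 x : 0 <= f x by rewrite mulr_ge0// weight_ge0.
have Ef := dual_expect mf f0.
rewrite integral0_eq in Ef; last first.
  move=> w _; transitivity (\int[wnu w]_q (\1_S ((w, q.1), q.2))%:E)%E.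
    rewrite (integral_wnu w (f := fun x : PX => (\1_S x)%:E))//.
    by apply/measurable_EFinP; exact: measurable_indic.
  rewrite -[RHS](S0 w) -[in RHS](setIT (mkset _)) -integral_indic//.
  exact: measurable_slice.
set g := (fun w => (f (marked_atom T xi F n w))%:E) \_ (active T n).
have g0 w : (0 <= g w)%E by rewrite /g patchE; case: ifP => // _; rewrite lee_fin.
have mg : measurable_fun setT g.
  apply: (step_measurable_at_atom n (f := EFin \o f)).
  exact/measurable_EFinP.
have /(ae_eq_integral_abs P measurableT mg) gae :
    (\int[P]_w `|g w| = 0)%E.
  under eq_integral do rewrite gee0_abs//.
  apply/eqP; rewrite eq_le integral_ge0// andbT [leRHS]Ef.
  apply: le_trans (nneseries_lim_ge n.+1 _); last first.
    move=> k _ _; apply: integral_ge0 => w _; rewrite patchE; case: ifP => // _.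
    by rewrite lee_fin.
  rewrite big_nat_recr//= leeDr// sume_ge0// => k _.
  apply: integral_ge0 => w _; rewrite patchE; case: ifP => // _.
  by rewrite lee_fin.
apply/negligibleP; first exact: step_measurable_active_atom.
suff : {ae P, forall w, ~ (active T n w /\ S (marked_atom T xi F n w))}.
  by apply: negligibleS => w /= h; apply: contrapT => nh; apply: nh.
apply: filterS2 gae weight_gt0_ae => w /(_ I) gw wpos [aw Sw].
move: gw; rewrite /g patchE mem_set// /f indicE mem_set// mul1r => -[].
move/eqP; rewrite gt_eqF// wpos// fine_ge0//.
Qed.

End compensator.

(** * The conditional law of the random time *)

Section law_transfer.
Context {R : realType} {dO : measure_display} {Omega : measurableType dO}
  (P : probability Omega R).
Variables (F : R -> set (set Omega)) (tau : Omega -> \bar R) (t : R).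
Variable kappa : Omega -> probability (measurableTypeR R) R.
Hypothesis fF : filtration F.
Hypothesis t0 : 0 <= t.
Hypothesis mtau : measurable_fun setT tau.
Hypothesis tau0 : forall w, (0 < tau w)%E.
Hypothesis law1 : law P tau setT = 1%E.
Hypothesis rcd : regular_conditional_distribution P F t tau kappa.

Let finite_tau : set Omega := [set w | (tau w < +oo)%E].

Lemma measurable_finite_time : measurable finite_tau.
Proof.
have := emeasurable_fun_infty_o measurableT mtau +oo%E.
by rewrite setTI.
Qed.

Let tau_preimage (B : set R) :
  tau @^-1` (EFin @` B) = [set w | (tau w < +oo)%E /\ B (fine (tau w))].
Proof.
apply/seteqP; split => w /=; first by move=> [r Br <-]; rewrite ltry.
move=> [tw Bw]; exists (fine (tau w)) => //; rewrite fineK// ge0_fin_numE//.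
exact: ltW.
Qed.

Lemma finite_tau1 : P finite_tau = 1%E.
Proof.
rewrite -law1 /law tau_preimage; congr (P _).
by apply/seteqP; split => w //= -[].
Qed.

Lemma measurable_joint (S : set (Omega * R)) : measurable S ->
  measurable [set w | (tau w < +oo)%E /\ S (w, fine (tau w))].
Proof.
move=> mS; apply: measurableI; first exact: measurable_finite_time.
have mj : measurable_fun setT (fun w => (w, fine (tau w))).
  apply: measurable_fun_pair => //.
  by apply: (measurableT_comp _ mtau); exact: fine_measurable.
by have := mj measurableT _ mS; rewrite setTI.
Qed.

Let xsecE (S : set (Omega * R)) w : xsection S w = [set u | S (w, u)].
Proof. by apply/seteqP; split => u; rewrite /xsection/= inE. Qed.

Let hat_ambient (S : set (Omega * R)) : hatF F t S -> measurable S.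
Proof. by have [_ + _] := hat_filtration fF; exact. Qed.

Let mxsec (S : set (Omega * R)) w : hatF F t S -> measurable (xsection S w).
Proof. by move=> /hat_ambient; exact: measurable_xsection. Qed.

(** The identity holds for rectangles by the definition of the conditional
    law, and both sides are finite measures in S. *)
Lemma rcd_disintegration (S : set (Omega * R)) : hatF F t S ->
  measurable_fun setT (fun w => kappa w (xsection S w)) /\
  (\int[P]_w kappa w (xsection S w) =
    P [set w | (tau w < +oo)%E /\ S (w, fine (tau w))])%E.
Proof.
have h := @measurable_prod_measurableType _ _ (Past F t) R.
rewrite {1}/hatF/= => mS; rewrite h in mS; move: S mS.
have rect A B : F t A -> measurable B ->
    measurable_fun setT (fun w => kappa w (xsection (A `*` B) w)) /\
    (\int[P]_w kappa w (xsection (A `*` B) w) =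
      P [set w | (tau w < +oo)%E /\ (A `*` B) (w, fine (tau w))])%E.
  move=> FA mB; have [mk ik] := rcd mB.
  have mA : measurable A by case: fF => _ + _ => /(_ _ t0); exact.
  have kE : (fun w => kappa w (xsection (A `*` B) w)) =
      (fun w => kappa w B) \_ A.
    apply/funext => w; rewrite patchE; case: ifPn => [/set_mem Aw|/negP nAw].
      by congr (kappa w _); rewrite xsecE; apply/seteqP; split => u //= -[].
    rewrite xsecE (_ : mkset _ = set0) ?measure0// -subset0 => u [/= Aw _].
    by apply: nAw; exact/mem_set.
  rewrite kE; split.
    apply/(measurable_restrictT _ mA); apply: measurable_funTS => _ C mC.
    case: fF => _ + _ => /(_ _ t0); apply; exact: mk.
  rewrite -integral_mkcond ik// tau_preimage; congr (P _).
  by apply/seteqP; split => w /=; tauto.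
have sF : sigma_algebra setT (F t) by case: fF => + _ _; exact.
apply: (dynkin_induction h).
- move=> _ _ [A mA [B mB <-]] [A' mA' [B' mB' <-]].
  exists (A `&` A'); first exact: measurableI.
  exists (B `&` B'); first exact: measurableI.
  by rewrite setXI.
- by rewrite -setXTT; apply: rect => //; exact: salgT.
- move=> _ [A mA [B mB <-]]; apply: rect => //.
  by rewrite -(measurable_Past _ fF t0).
- move=> S mS [mk ik].
  have kE w : kappa w (xsection (~` S) w) = (1 - kappa w (xsection S w))%E.
    have -> : xsection (~` S) w = ~` xsection S w by rewrite !xsecE.
    by rewrite probability_setC//; exact: mxsec.
  have mk' : measurable_fun setT (fun w => kappa w (xsection (~` S) w)).
    by rewrite (funext kE); exact: emeasurable_funB.
  split => //; set q := P _; set A := (\int[P]_w _)%E.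
  have qfin : P [set w | (tau w < +oo)%E /\ S (w, fine (tau w))] \is a fin_num.
    by apply: fin_num_measure; apply: measurable_joint; exact: hat_ambient.
  have A1 : (A + P [set w | (tau w < +oo)%E /\ S (w, fine (tau w))] = 1)%E.
    rewrite -ik -ge0_integralD//.
    transitivity (\int[P]_w cst 1 w)%E.
      apply: eq_integral => w _; rewrite kE subeK//.
      by apply: fin_num_measure; exact: mxsec.
    by rewrite integral_cst// mul1e; exact: probability_setT.
  have q1 : (q + P [set w | (tau w < +oo)%E /\ S (w, fine (tau w))] = 1)%E.
    rewrite -measureU//.
    - rewrite -finite_tau1; congr (P _); apply/seteqP; split => w /=.
        by move=> [[]|[]].
      by move=> tw; have [Sw|nSw] := pselect (S (w, fine (tau w))); [right|left].
    - by apply: measurable_joint; apply: measurableC; exact: hat_ambient.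
    - by apply: measurable_joint; exact: hat_ambient.
    - by rewrite -subset0 => w [[_ +] [_]].
  by rewrite -[LHS](addeK _ qfin) A1 -q1 addeK.
- move=> S mS tS PS.
  have kE w : kappa w (xsection (\bigcup_n S n) w) =
      (\sum_(n <oo) kappa w (xsection (S n) w))%E.
    rewrite (_ : xsection _ w = \bigcup_n xsection (S n) w); last first.
      rewrite xsecE; apply/seteqP; split => u /= [n _ Sn]; exists n => //.
        by rewrite xsecE.
      by move: Sn; rewrite xsecE.
    rewrite measure_semi_bigcup//.
    - by move=> n; exact: (mxsec w (mS n)).
    - move=> i j _ _ [u []]; rewrite !xsecE => Si Sj; apply: (tS i j) => //.
      by exists (w, u).
    - by apply: bigcupT_measurable => n; exact: (mxsec w (mS n)).
  rewrite (funext kE); split.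
    by apply: ge0_emeasurable_sum => [n w _ _|n _]; [exact: measure_ge0|exact: (PS n).1].
  rewrite integral_nneseries//; last by move=> n; exact: (PS n).1.
  rewrite (_ : mkset _ = \bigcup_n
      [set w | (tau w < +oo)%E /\ S n (w, fine (tau w))]); last first.
    apply/seteqP; split => w /=; first by move=> [tw [n _ Sn]]; exists n.
    by move=> [n _ [tw Sn]]; split => //; exists n.
  rewrite measure_semi_bigcup//.
  - by apply: eq_eseriesr => n _; exact: (PS n).2.
  - by move=> n; apply: measurable_joint; exact: (hat_ambient (mS n)).
  - move=> i j _ _ [w [[_ Si] [_ Sj]]]; apply: (tS i j) => //.
    by exists (w, fine (tau w)).
  - by apply: bigcupT_measurable => n; apply: measurable_joint; exact: (hat_ambient (mS n)).
Qed.

Lemma finite_tau_ae : {ae P, forall w, (tau w < +oo)%E}.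
Proof.
exists (~` finite_tau); split => //.
- by apply: measurableC; exact: measurable_finite_time.
- rewrite probability_setC; last exact: measurable_finite_time.
  by rewrite finite_tau1 subee.
Qed.

Hypothesis ac : {ae P, forall w, kappa w `<< law P tau}.

(** Under the product of P and the law of tau the set S is null by Fubini, so
    that almost every w has a section that is null for the law of tau, hence
    by absolute continuity null for the conditional law; then the
    disintegration applies. *)
Lemma law_transfer (S : set (Omega * R)) : hatF F t S ->
  (forall u, P [set w | S (w, u)] = 0%E) ->
  P [set w | (tau w < +oo)%E /\ S (w, fine (tau w))] = 0%E.
Proof.
move=> hS S0; have mS := hat_ambient hS.
have [mk <-] := rcd_disintegration hS.
have mtau' : measurable_fun setT (fine \o tau).
  by apply: (measurableT_comp _ mtau); exact: fine_measurable.
pose tau_mix := isMeasurableFun.Build _ _ _ _ _ mtau'.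
pose Y : {mfun Omega >-> R} := HB.pack (fine \o tau) tau_mix.
pose eta := distribution P Y.
have law_eta (B : set R) : measurable B -> (law P tau B <= eta B)%E.
  move=> mB; rewrite /law tau_preimage; apply: le_measure; rewrite ?inE.
  - apply: measurableI; first exact: measurable_finite_time.
    by have := mtau' measurableT B mB; rewrite setTI.
  - by have := mtau' measurableT B mB; rewrite setTI.
  - by move=> w [].
have eta0 : (\int[P]_w eta (xsection S w) = 0)%E.
  have := @indic_fubini_tonelli _ _ _ _ _ P eta S mS.
  rewrite indic_fubini_tonelli_FE// indic_fubini_tonelli_GE// => ->.
  apply: integral0_eq => u _; rewrite /= -[RHS](S0 u); congr (P _).
  by apply/seteqP; split => w; rewrite /ysection/= inE.
have mx : measurable_fun setT (fun w => eta (xsection S w)).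
  exact: measurable_fun_xsection.
have xae : {ae P, forall w, eta (xsection S w) = 0%E}.
  have /(ae_eq_integral_abs P measurableT mx) : (\int[P]_w `|eta (xsection S w)| = 0)%E.
    by under eq_integral do rewrite gee0_abs//.
  by apply: filterS => w /(_ I).
transitivity (\int[P]_(w in setT) cst 0 w)%E; last exact: integral0.
apply: ae_eq_integral => //.
apply: filterS2 ac xae => w ac_w e0 _.
apply: (ac_w (xsection S w)) => //; last exact: mxsec.
move=> B mB BS; apply/eqP; rewrite eq_le; apply/andP; split; last exact: measure_ge0.
rewrite -e0; apply: (le_trans (law_eta _ mB)); apply: le_measure; rewrite ?inE//.
exact: mxsec.
Qed.

End law_transfer.

(** * Absolute continuity of the jumps in the enlarged filtration *)

Lemma stopping_time_mono {R : realType} {dO : measure_display}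
    {Omega : measurableType dO} (F G : R -> set (set Omega)) (sigma : Omega -> \bar R) :
  (forall t, 0 <= t -> F t `<=` G t) -> stopping_time F sigma -> stopping_time G sigma.
Proof. by move=> FG [s0 ss]; split=> // t t0; apply: (FG _ t0); exact: ss. Qed.

Lemma step_data_mono {R : realType} {dO : measure_display}
    {Omega : measurableType dO} {d : nat} (F G : R -> set (set Omega))
    (X : R -> Omega -> 'rV[R]_d) T xi :
  (forall t, 0 <= t -> F t `<=` G t) -> step_data X T xi F -> step_data X T xi G.
Proof.
move=> FG [sT Tcv Tlt xiP XE]; split => //.
- by move=> n; exact: stopping_time_mono (sT n).
- move=> n; split; last exact: (xiP n).2.
  move=> B mB; have [mC FC] := (xiP n).1 B mB; split => // t t0.
  by apply: (FG _ t0); exact: FC.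
Qed.

Section larger_filtration.
Context {R : realType} {dO : measure_display} {Omega : measurableType dO}
  (P : probability Omega R) {d : nat}.
Local Notation E := (borel_rV R d).
Variables (F G : R -> set (set Omega)) (X : R -> Omega -> 'rV[R]_d).
Hypotheses (fF : filtration F) (fG : filtration G).
Hypothesis FG : forall t, 0 <= t -> F t `<=` G t.
Variable nu : Omega -> {measure set (R * E) -> \bar R}.
Hypothesis dualF : dual_predictable_projection P F (jump_measure X) (fun w => nu w).
Local Notation PXG := (Pred G * E)%type.
Local Notation m := (wnu fF dualF).

Lemma Pred_id_measurable : @measurable_fun _ _ (Pred G) (Pred F) setT id.
Proof. by move=> _ C mC; rewrite setTI; exact: Pred_sub mC. Qed.

Let m_rect a B : 0 <= a -> measurable B -> @measurable_fun _ _ (Pred G) _ setT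
  (fun p => m p.1 [set q | a < q.1 <= p.2 /\ B q.2]).
Proof.
by move=> a0 mB; exact: (measurableT_comp (wnu_rect fF dualF a0 mB) Pred_id_measurable).
Qed.

Let m_rect0 B : measurable B -> @measurable_fun _ _ (Pred G) _ setT
  (fun p => m p.1 [set q | 0 <= q.1 <= p.2 /\ B q.2]).
Proof.
by move=> mB; exact: (measurableT_comp (wnu_rect0 fF dualF mB) Pred_id_measurable).
Qed.

Lemma wnu_seg_enlarged (f : PXG -> \bar R) : measurable_fun setT f ->
  (forall x, 0 <= f x)%E -> @measurable_fun _ _ (Pred G) _ setT (fun p =>
    \int[m p.1]_(q in [set q | (0 <= q.1 <= p.2)%R]) f ((p.1, q.1), q.2))%E.
Proof. exact: (Pred_measurable_integral fG (wnu_fin fF dualF) m_rect m_rect0). Qed.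

Lemma wnu_neg w : m w [set q | q.1 < 0] = 0%E.
Proof.
apply: integral0_eq => q /= q0; rewrite weight_neg//.
Qed.

Lemma wnu_pos (f : R * E -> \bar R) w : measurable_fun setT f -> (forall x, 0 <= f x)%E ->
  (\int[m w]_q f q = \int[m w]_(q in [set q | (0 <= q.1)%R]) f q)%E.
Proof.
move=> mf f0; rewrite [RHS]integral_mkcond.
have mf' : measurable_fun setT (f \_ [set q : R * E | 0 <= q.1]).
  by apply/(measurable_restrictT f measurable_pos); exact: measurable_funTS.
apply: (@ae_eq_integral _ _ _ (m w) setT _ _ measurableT mf mf').
exists [set q : R * E | q.1 < 0]; split; [exact: measurable_neg|exact: wnu_neg|].
move=> q /= h; rewrite ltNge; apply/negP => q0; apply: h => _.
by rewrite patchE mem_set.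
Qed.

Lemma wnu_measurable (f : PXG -> \bar R) : measurable_fun setT f ->
  (forall x, 0 <= f x)%E ->
  measurable_fun setT (fun w => \int[m w]_q f ((w, q.1), q.2))%E.
Proof.
move=> mf f0; have := measurable_integral_pos fG mf f0 (wnu_seg_enlarged mf f0).
congr measurable_fun; apply/funext => w; rewrite -wnu_pos//.
by apply: (measurableT_comp mf); exact: PredX_section.
Qed.

Lemma wnu_slice_measurable (S : set PXG) : measurable S ->
  measurable_fun setT (fun w => m w [set q | S ((w, q.1), q.2)]).
Proof.
move=> mS; have := wnu_measurable (f := fun x => (\1_S x)%:E) _ _.
rewrite (_ : (fun w => m w _) = (fun w => \int[m w]_q (\1_S ((w, q.1), q.2))%:E)%E).
  apply.
    by apply/measurable_EFinP; exact: measurable_indic.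
  by move=> x; rewrite lee_fin.
apply/funext => w; rewrite -[X in m w X]setIT -integral_indic//.
exact: measurable_slice.
Qed.

End larger_filtration.

Section enlargement_absolute_continuity.
Context {R : realType} {dO : measure_display} {Omega : measurableType dO}
  (P : probability Omega R) {d : nat}.
Local Notation E := (borel_rV R d).
Variables (F : R -> set (set Omega)) (X : R -> Omega -> 'rV[R]_d).
Variables (T : nat -> Omega -> \bar R) (xi : nat -> Omega -> 'rV[R]_d).
Hypothesis fF : filtration F.
Hypothesis steps : step_data X T xi F.
Variable nu : Omega -> {measure set (R * E) -> \bar R}.
Hypothesis dualF : dual_predictable_projection P F (jump_measure X) (fun w => nu w).
Variables (tau : Omega -> \bar R) (kappa : R -> Omega -> probability (measurableTypeR R) R).
Hypothesis mtau : measurable_fun setT tau.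
Hypothesis tau0 : forall w, (0 < tau w)%E.
Hypothesis law1 : law P tau setT = 1%E.
Hypothesis rcd : forall t, 0 <= t -> regular_conditional_distribution P F t tau (kappa t).
Hypothesis ac : forall t, 0 <= t -> {ae P, forall w, kappa t w `<< law P tau}.
Local Notation G := (progressive_enlargement F tau).
Local Notation m := (wnu fF dualF).
Local Notation hF := (hatF F).
Local Notation PXH := (Pred hF * E)%type.

Let fH : filtration hF. Proof. exact: hat_filtration. Qed.
Let fG : filtration G. Proof. exact: filtration_enlargement. Qed.
Let FG t : 0 <= t -> F t `<=` G t. Proof. exact: sub_enlargement. Qed.

Let m_rect a B : 0 <= a -> measurable B -> @measurable_fun _ _ (Pred hF) _ setT
  (fun p => m p.1.1 [set q | a < q.1 <= p.2 /\ B q.2]).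
Proof.
move=> a0 mB.
exact: (measurableT_comp (wnu_rect fF dualF a0 mB) (hat_Pred_proj fF)).
Qed.

Let m_rect0 B : measurable B -> @measurable_fun _ _ (Pred hF) _ setT
  (fun p => m p.1.1 [set q | 0 <= q.1 <= p.2 /\ B q.2]).
Proof.
move=> mB.
exact: (measurableT_comp (wnu_rect0 fF dualF mB) (hat_Pred_proj fF)).
Qed.

Let hatmass (S : set PXH) (p : (Omega * R) * R) : \bar R :=
  m p.1.1 [set q | 0 <= q.1 <= p.2 /\ S ((p.1, q.1), q.2)].

Let mhatmass (S : set PXH) : measurable S ->
  @measurable_fun _ _ (Pred hF) _ setT (hatmass S).
Proof.
move=> mS; exact: (Pred_measurable_mass fH (m := fun w => m w.1)
  (fun w => wnu_fin fF dualF w.1) m_rect m_rect0 mS).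
Qed.

Let mseg_slice (S : set PXH) w u t : measurable S ->
  measurable [set q : R * E | 0 <= q.1 <= t /\ S (((w, u), q.1), q.2)].
Proof.
by move=> mS; apply: measurableI; [exact: measurable_seg|exact: measurable_slice].
Qed.

(* The part of S that lies before the compensator charges S. Whatever S is,
   this part is a null set of the compensator for every w and u, and it is
   all of S if the compensator does not charge S. *)
Let start (S : set PXH) : set PXH := S `&` [set x | hatmass S x.1 = 0%E].

Let mstart (S : set PXH) : measurable S -> measurable (start S).
Proof.
move=> mS; apply: measurableI => //.
have h : measurable (hatmass S @^-1` [set 0%E] : set (Pred hF)).
  by have := mhatmass mS measurableT (emeasurable_set1 0%E); rewrite setTI.
by have := @measurable_fst _ _ (Pred hF) E measurableT _ h; rewrite setTI.
Qed.

Let start_null (S : set PXH) w u : measurable S -> S `<=` [set x | 0 < x.1.2] ->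
  m w [set q | start S (((w, u), q.1), q.2)] = 0%E.
Proof.
move=> mS Spos; apply/eqP; rewrite -measure_le0.
set I := [set t | 0 <= t /\ hatmass S ((w, u), t) = 0%E].
set Y := [set q : R * E | S (((w, u), q.1), q.2)].
rewrite (_ : mkset _ = Y `&` [set q | I q.1]); last first.
  apply/seteqP; split => q /= [Sq Iq]; split => //; last by case: Iq.
  by split => //; apply: ltW; exact: (Spos _ Sq).
apply: (proj2 (@le_measure_initial_segment _ E R (m w) Y I 0%E _ _ _ _ _)) => //.
- exact: measurable_slice.
- by move=> t [].
- move=> s t /andP[s0 st] [t0 It]; split => //; apply/eqP; rewrite -measure_le0 -It.
  apply: le_measure; rewrite ?inE; try exact: mseg_slice.
  by move=> q /= [/andP[-> qs] Sq]; rewrite (le_trans qs).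
- move=> t [t0 <-]; rewrite le_eqVlt; apply/orP; left; apply/eqP.
  by congr (m w _); apply/seteqP; split => q /=; tauto.
Qed.

(** A G-predictable set S becomes, after the substitution u = tau, a set
    predictable for the filtration with the extra coordinate. For each fixed
    u the section is F-predictable; cut down to the part not yet charged, it
    is null for the compensator, hence contains no jump. By absolute
    continuity of the conditional laws this remains so for u = tau. But at u
    = tau the cut removes nothing, because S is not charged. The argument
    replaces the usual construction of a density process of the conditional
    laws, measurable in (t, u). *)
Lemma enlargement_null_no_jump (S : set (Pred G * E)%type) n : measurable S ->
  (\int[P]_w m w [set q | S ((w, q.1), q.2)] = 0)%E ->
  P [set w | active T n w /\ S (marked_atom T xi G n w)] = 0%E.
Proof.
move=> mS S0; have [sT Tcv Tlt xiP XE] := steps.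
have [sF Fm mF] := fF.
have [S' mS' SS'] := PredX_enlargement_hat fF mtau tau0 mS.
(* A jump at time 0 is no jump of the path, so only positive times matter. *)
pose S1 : set PXH := S' `&` [set x | 0 < x.1.2].
have mS1 : measurable S1.
  apply: measurableI => //.
  by have := @measurable_fst _ _ (Pred hF) E measurableT _ (Pred_after fH (lexx 0));
    rewrite setTI.
have S1pos : S1 `<=` [set x | 0 < x.1.2] by move=> x [].
pose V := start S1.
have mV : measurable V by exact: mstart.
have nullV u : P [set w | active T n w /\ V (((w, u), fine (T n w)), xi n w)] = 0%E.
  have := wnu_null_no_jump (fF := fF) steps (dualF := dualF) n
    (hat_PredX_section u fF mV).
  by apply => w; exact: start_null.
(* The jump times and jumps, read on the space with the extra coordinate. *)
pose hT k (v : Omega * R) := T k v.1.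
pose hxi k (v : Omega * R) := xi k v.1.
have hsT k : stopping_time hF (hT k) by exact: (hat_stopping_time fF (sT k)).
have hmxi k : measurable_wrt (stopped_sigma_algebra hF (hT k)) setT
    (hxi k : _ -> E) by exact: (hat_stopped fF (xiP k).1).
have hT0 k v : (0 <= hT k v)%E by case: (hsT k).
pose Gam K := [set v | [/\ active hT n v, (hT n v <= K%:E)%E & V (marked_atom hT hxi hF n v)]].
have hGam K : 0 <= K -> hatF F K (Gam K).
  by move=> K0; exact: (active_le hT0 fH hsT hmxi n K0 mV).
have nullGam (K : nat) : P [set w | (tau w < +oo)%E /\ Gam K%:R (w, fine (tau w))] = 0%E.
  have K0 : 0 <= K%:R :> R by [].
  apply: (law_transfer fF K0 mtau tau0 law1 (rcd K0) (ac K0) (hGam _ K0)) => u.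
  apply/eqP; rewrite -measure_le0 -(nullV u).
  apply: le_measure; rewrite ?inE.
  - exact: (Fm _ K0 _ (hat_section u K0 fF (hGam _ K0))).
  - exact: (step_measurable_active_atom fF steps n (hat_PredX_section u fF mV)).
  - by move=> w [].
(* At u = tau, the compensator does not charge S1, so start S1 is all of S1. *)
have ae1 : {ae P, forall w, m w [set q | S ((w, q.1), q.2)] = 0%E}.
  have /(ae_eq_integral_abs P measurableT (wnu_slice_measurable fF fG FG dualF mS)) :
      (\int[P]_w `|m w [set q | S ((w, q.1), q.2)]| = 0)%E.
    by under eq_integral do rewrite gee0_abs//.
  by apply: filterS => w /(_ I).
have ae2 : {ae P, forall w, forall K : nat,
    ~ ((tau w < +oo)%E /\ Gam K%:R (w, fine (tau w)))}.
  apply: ae_foralln => K.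
  exists [set w | (tau w < +oo)%E /\ Gam K%:R (w, fine (tau w))]; split => //.
    apply: measurable_joint => //.
    by have [_ hm _] := fH; exact: (hm _ (ler0n R K) _ (hGam _ (ler0n R K))).
    exact: nullGam.
  by move=> w /= h; apply: contrapT => nh; apply: h.
have ae3 := finite_tau_ae mtau tau0 law1.
apply/negligibleP.
  exact: (step_measurable_active_atom fG (step_data_mono FG steps)).
suff : {ae P, forall w, ~ (active T n w /\ S (marked_atom T xi G n w))}.
  by apply: negligibleS => w /= h; apply: contrapT => nh; apply: nh.
apply: filterS3 ae1 ae2 ae3 => w mw0 nGam tauw [aw Sw].
have [Tw0 Twy] := aw.
have t0 : 0 < fine (T n w) by rewrite -lte_fin fineK// ge0_fin_numE// ltW.
apply: (nGam (Num.trunc (fine (T n w))).+1); split => //; split => //.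
  rewrite /hT/= -[leLHS]fineK ?ge0_fin_numE ?lee_fin//; last exact: ltW.
  exact/ltW/truncnS_gt.
split; first by split => //; exact/(SS' _ _ _ t0 tauw).
apply/eqP; rewrite -measure_le0 -mw0; apply: le_measure; rewrite ?inE.
- exact: mseg_slice.
- exact: measurable_slice.
- by move=> q /= [/andP[q0 qt] [Sq qpos]]; apply/(SS' _ _ _ qpos tauw).
Qed.

End enlargement_absolute_continuity.

(** * The Azema supermartingale *)

Section azema.
Context {R : realType} {dO : measure_display} {Omega : measurableType dO}
  (P : probability Omega R).
Variables (F : R -> set (set Omega)) (tau : Omega -> \bar R) (A : R -> Omega -> R).
Hypothesis fF : filtration F.
Hypothesis mtau : measurable_fun setT tau.
Hypothesis tau0 : forall w, (0 < tau w)%E.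
Hypothesis azemaA : azema P F tau A.

(** An optional process is adapted: the sections at time t of optional sets
    lie in F_t. *)
Lemma azema_adapted : adapted F A.
Proof.
have [[mA _] _] := azemaA; have [sF Fm mF] := fF.
move=> t t0 B mB; rewrite setTI.
have := mA B mB.
have : optional F `<=` [set S | F t [set w | S (w, t)]].
  apply: smallest_sub.
    split => /=; first exact: salg0 (sF _ t0).
    - move=> S FS; rewrite (_ : mkset _ = ~` [set w | S (w, t)]).
        exact: (salgC (sF _ t0)).
      apply/seteqP; split => w /=; first by case.
      by move=> nS; split => //; rewrite time_spaceE.
    - move=> S FS; rewrite (_ : mkset _ = \bigcup_n [set w | S n (w, t)]).
        exact: (salg_bigcup (sF _ t0)).
      by apply/seteqP; split => w [n _ Sn]; exists n.
  move=> _ [Y [aY _ [D mD ->]]] /=.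
  have := aY t t0 D mD; rewrite setTI; congr (F t _).
  apply/seteqP; split => w /=; last by case.
  by move=> YD; split => //; rewrite time_spaceE.
move=> /[apply] /=; congr (F t _).
apply/seteqP; split => w /=; first by case.
by move=> YD; split => //; rewrite time_spaceE.
Qed.

Let mafter t : measurable [set w | (t%:E < tau w)%E].
Proof.
have := emeasurable_fun_o_infty measurableT mtau t%:E.
by rewrite setTI.
Qed.

Lemma azema_integral t C : 0 <= t -> F t C ->
  (\int[P]_(w in C) (A t w)%:E = P (C `&` [set w | (t%:E < tau w)%E]))%E.
Proof.
move=> t0 FC; have [[_ iA] _] := azemaA; have [sF Fm mF] := fF.
have mC : measurable C by exact: Fm FC.
have sT : stopping_time F (fun=> t%:E).
  split => [w|s s0]; first by rewrite lee_fin.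
  have [ts|st] := leP t s.
    rewrite (_ : mkset _ = setT); first exact: salgT (sF _ s0).
    by apply/seteqP; split => // w _ /=; rewrite lee_fin.
  rewrite (_ : mkset _ = set0); first exact: salg0 (sF _ s0).
  by rewrite -subset0 => w /=; rewrite lee_fin leNgt st.
have := iA _ C sT; rewrite (_ : C `&` _ = C); last first.
  by apply/seteqP; split => w /=; [case|move=> Cw; split; rewrite ?ltry].
move=> -> /=; last first.
  split => // s s0; have [ts|st] := leP t s.
    rewrite (_ : _ `&` _ = C); first exact: mF FC.
    by apply/seteqP; split => w /=; [case|move=> Cw; split; rewrite ?lee_fin].
  rewrite (_ : _ `&` _ = set0); first exact: salg0 (sF _ s0).
  by rewrite -subset0 => w /= [_]; rewrite lee_fin leNgt st.
rewrite setIC -integral_indic//.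
by apply: eq_integral => w _; rewrite indicE; case: ifP => h; [rewrite mem_set|rewrite memNset//= h].
Qed.

(** Stop at the first time of the family at which A is below c. At that time
    the conditional probability that tau has not yet occurred is A, hence
    less than c. *)
Lemma azema_maximal (u : nat -> R) (c : R) (N : nat) : 0 <= c ->
  (forall k, 0 <= u k) -> nondecreasing_seq u ->
  (P [set w | exists2 k, (k < N)%N & (A (u k) w < c)%R /\ ((u k)%:E < tau w)%E] <=
   c%:E * P [set w | exists2 k, (k < N)%N & (A (u k) w < c)%R])%E.
Proof.
move=> c0 u0 ndu; have [sF Fm mF] := fF.
pose B k := [set w | A (u k) w < c].
have FB k : F (u k) (B k).
  have := azema_adapted (u0 k) (measurable_itv `]-oo, c[); rewrite setTI.
  by congr (F _ _); apply/seteqP; split => w /=; rewrite in_itv.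
have mB k : measurable (B k) by exact: (Fm _ (u0 k)).
pose U N := [set w | exists2 k, (k < N)%N & B k w].
pose V N := [set w | exists2 k, (k < N)%N & B k w /\ ((u k)%:E < tau w)%E].
have US n : U n.+1 = U n `|` B n.
  apply/seteqP; split => w /=.
    move=> [k]; rewrite ltnS leq_eqVlt => /predU1P[->|kn] Bk; [by right|].
    by left; exists k.
  by move=> [[k kn Bk]|Bn]; [exists k => //; exact: ltnW|exists n].
have VS n : V n.+1 = V n `|` (B n `&` [set w | ((u n)%:E < tau w)%E]).
  apply/seteqP; split => w /=.
    move=> [k]; rewrite ltnS leq_eqVlt => /predU1P[->|kn] Bk; [by right|].
    by left; exists k.
  by move=> [[k kn Bk]|Bn]; [exists k => //; exact: ltnW|exists n].
have mU n : measurable (U n).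
  elim: n => [|n ih]; last by rewrite US; exact: measurableU.
  by rewrite (_ : U 0%N = set0)// -subset0 => w [].
have mV n : measurable (V n).
  elim: n => [|n ih]; last by rewrite VS; apply: measurableU => //; exact: measurableI.
  by rewrite (_ : V 0%N = set0)// -subset0 => w [].
have FU n : F (u n) (U n).
  have : forall j, (j <= n)%N -> F (u n) (U j).
    elim=> [_|j ih jn].
      rewrite (_ : U 0%N = set0); first exact: salg0 (sF _ (u0 n)).
      by rewrite -subset0 => w [].
    rewrite US; apply: (salgU (sF _ (u0 n))); first by apply: ih; exact: ltnW.
    by apply: mF (FB j) => //; apply: ndu; exact: ltnW.
  exact.
rewrite -[X in (P X <= _)%E]/(V N) -[X in (_ <= _ * P X)%E]/(U N).
elim: N => [|n ih].
  rewrite (_ : V 0%N = set0) ?measure0; last by rewrite -subset0 => w [].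
  by rewrite mule_ge0.
set C := B n `\` U n.
have mC : measurable C by exact: measurableD.
have FC : F (u n) C.
  rewrite /C setDE; apply: (salgI (sF _ (u0 n))) => //.
  exact: (salgC (sF _ (u0 n))).
have -> : U n.+1 = U n `|` C.
  rewrite US; apply/seteqP; split => w /=; last by move=> [|[]]; [left|right].
  by move=> [Uw|Bw]; [left|have [|] := pselect (U n w); [left|right]].
rewrite measureU//; last by rewrite -subset0 => w [Uw []].
rewrite ge0_muleDr//.
apply: (@le_trans _ _ (P (V n) + P (C `&` [set w | ((u n)%:E < tau w)%E]))%E).
  apply: le_trans (measureU2 _ _ _) => //; last exact: measurableI.
  apply: le_measure; rewrite ?inE//; first by apply: measurableU => //; exact: measurableI.
  rewrite VS => w [Vw|[Bw tw]]; first by left.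
  have [[k kn Bk]|nU] := pselect (U n w); last by right.
  left; exists k => //; split => //; apply: le_lt_trans tw; rewrite lee_fin.
  by apply: ndu; exact: ltnW.
apply: leeD => //; rewrite -azema_integral//.
have mA : measurable_fun C (fun w => (A (u n) w)%:E).
  apply/measurable_EFinP; apply: measurable_funTS => _ D mD.
  exact: (Fm _ (u0 n) _ (azema_adapted (u0 n) mD)).
rewrite integralE; apply: (@le_trans _ _ (\int[P]_(w in C) ((fun w => (A (u n) w)%:E)^\+ w))%E).
  by apply: geeDl; rewrite oppe_le0; exact: integral_ge0.
rewrite -integral_cst//; apply: ge0_le_integral => //.
- by apply: measurable_funepos.
- move=> w [Bw _] /=; rewrite funeposE ge_max !lee_fin c0 andbT.
  exact: ltW.
Qed.

Lemma dyadic_dense (a b : R) : 0 <= a -> a < b ->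
  exists m k : nat, a < k%:R / 2 ^+ m < b.
Proof.
move=> a0 ab; have ba : 0 < b - a by rewrite subr_gt0.
have [m hm] := natSinv_lt ba.
exists m, (Num.trunc (a * 2 ^+ m)).+1.
have p0 : 0 < 2 ^+ m :> R by rewrite exprn_gt0.
have a20 : 0 <= a * 2 ^+ m by rewrite mulr_ge0// ltW.
have /andP[h1 h2] := truncn_itv a20.
rewrite ltr_pdivlMr// h2/= ltr_pdivrMr//.
rewrite -natr1 (le_lt_trans (lerD h1 (lexx 1)))//.
rewrite -ltrBrDl -mulrBl -ltr_pdivrMr// (le_lt_trans _ hm)// div1r.
rewrite lef_pV2 ?posrE// -natrX ler_nat.
exact: ltn_expl.
Qed.

(* A falls below 1/(n+1) strictly before tau, at a point of the dyadic grid
   of order m on [0, m[. The grids increase with m. *)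
Let low (n m : nat) : set Omega :=
  [set w | exists2 k, (k < m * 2 ^ m)%N &
    A (k%:R / 2 ^+ m) w < n.+1%:R^-1 /\ ((k%:R / 2 ^+ m)%:E < tau w)%E].

Let mlow n m : measurable (low n m).
Proof.
have [sF Fm mF] := fF.
rewrite (_ : low n m = \bigcup_(k in `I_(m * 2 ^ m))
    ([set w | A (k%:R / 2 ^+ m) w < n.+1%:R^-1] `&`
     [set w | ((k%:R / 2 ^+ m)%:E < tau w)%E])).
  apply: bigcup_measurable => k _; apply: measurableI => //.
  have k0 : 0 <= k%:R / 2 ^+ m :> R by rewrite divr_ge0// exprn_ge0.
  apply: (Fm _ k0); have := azema_adapted k0 (measurable_itv `]-oo, n.+1%:R^-1[).
  by rewrite setTI; congr (F _ _); apply/seteqP; split => w /=; rewrite in_itv.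
by apply/seteqP; split => w [k kN [h1 h2]]; exists k.
Qed.

Let low_nd n : nondecreasing_seq (low n).
Proof.
apply/nondecreasing_seqP => m; apply/subsetPset => w [k km [h1 h2]].
have e : k%:R / 2 ^+ m = (k * 2)%:R / 2 ^+ m.+1 :> R.
  by rewrite natrM exprSr -mulf_div divff// mulr1.
exists (k * 2)%N; last by rewrite -e.
rewrite expnSr mulnA ltn_pmul2r// (leq_trans km)// leq_pmul2r ?expn_gt0//.
Qed.

Let low_le n : (P (\bigcup_m low n m) <= (n.+1%:R^-1)%:E)%E.
Proof.
have := nondecreasing_cvg_mu (mu := P) (mlow n)
  (bigcup_measurable (fun m _ => mlow n m)) (low_nd n).
move=> cl; rewrite -(cvg_lim _ cl)//; apply: lime_le.
  by apply/cvg_ex; eexists; exact: cl.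
apply: nearW => m /=.
have h0 (k : nat) : 0 <= k%:R / 2 ^+ m :> R by rewrite divr_ge0// exprn_ge0.
apply: (le_trans (azema_maximal (m * 2 ^ m) _ h0 _)).
- by rewrite invr_ge0.
- move=> i j ij; rewrite ler_pM2r ?invr_gt0 ?exprn_gt0// ler_nat//.
rewrite -[leRHS]mule1; apply: lee_wpmul2l; first by rewrite lee_fin.
apply: probability_le1.
rewrite (_ : mkset _ = \bigcup_(k in `I_(m * 2 ^ m))
    [set w | A (k%:R / 2 ^+ m) w < n.+1%:R^-1]).
  apply: bigcup_measurable => k _.
  have [_ Fm _] := fF; apply: (Fm _ (h0 k)).
  have := azema_adapted (h0 k) (measurable_itv `]-oo, n.+1%:R^-1[).
  by rewrite setTI; congr (F _ _); apply/seteqP; split => w /=; rewrite in_itv.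
by apply/seteqP; split => w [k kN h]; exists k.
Qed.

(** A lower bound on the dyadic times before s passes to all times before s
    by right-continuity. *)
Lemma cadlag_ge_dyadic (y : R -> R) (c : R) (s : \bar R) : cadlag y ->
  (forall m k : nat, ((k%:R / 2 ^+ m)%:E < s)%E -> c <= y (k%:R / 2 ^+ m)) ->
  forall t, 0 <= t -> (t%:E < s)%E -> c <= y t.
Proof.
move=> [yr _] hy t t0 ts; rewrite leNgt; apply/negP => ytc.
have /= yrt := yr t t0.
have yc : \forall u \near t^'+, y u < c by exact: (cvgr_lt (y t) yrt).
have us : \forall u \near t^'+, (u%:E < s)%E.
  case: s ts {hy} => [s| |]//; last by move=> _; apply: nearW => u; rewrite ltry.
  by rewrite lte_fin => ts; apply: filterS (nbhs_right_lt ts) => u; rewrite lte_fin.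
have [r /= r0 rP] := filterI yc us.
have [m [k /andP[h1 h2]]] := dyadic_dense t0 (ltr_pwDr r0 (lexx t)).
have [] := rP (k%:R / 2 ^+ m).
- by rewrite /= ltr0_norm ?subr_lt0// opprB ltrBlDl.
- exact: h1.
- by move=> yk ks; have := hy _ _ ks; rewrite leNgt yk.
Qed.

(** By the maximal inequality over finer and finer dyadic grids, the
    probability that A falls below 1/(n+1) strictly before tau is at most
    1/(n+1). So almost surely A stays above some positive constant before
    tau, and its left limits do so up to and including tau. *)
Lemma azema_left_lim_pos_ae :
  {ae P, forall w, forall t, 0 <= t -> (t%:E <= tau w)%E -> 0 < left_lim (A ^~ w) t}.
Proof.
pose N := \bigcap_n \bigcup_m low n m.
have mN : measurable N.
  by apply: bigcapT_measurable => n; apply: bigcupT_measurable => m; exact: mlow.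
exists N; split => //.
  apply/eqP; rewrite -measure_le0; apply/lee_addgt0Pr => e e0; rewrite add0e.
  have [n hn] := natSinv_lt e0.
  apply: (@le_trans _ _ (P (\bigcup_m low n m))).
    apply: le_measure; rewrite ?inE//; last exact: bigcap_inf.
    by apply: bigcupT_measurable => m; exact: mlow.
  by apply: (le_trans (low_le n)); rewrite lee_fin ltW.
move=> w /= nw; apply: contrapT => nNw; apply: nw => t t0 tt.
have [n hn] : exists n, ~ (\bigcup_m low n m) w.
  by apply: contrapT => h; apply: nNw => n _; apply: contrapT => h'; apply: h; exists n.
have Ad m k : ((k%:R / 2 ^+ m)%:E < tau w)%E -> n.+1%:R^-1 <= A (k%:R / 2 ^+ m) w.
  move=> kt; rewrite leNgt; apply/negP => Ak; apply: hn.
  exists (maxn m k.+1) => //; exists (k * 2 ^ (maxn m k.+1 - m))%N.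
    have -> : (maxn m k.+1 * 2 ^ maxn m k.+1 =
        maxn m k.+1 * 2 ^ m * 2 ^ (maxn m k.+1 - m))%N.
      by rewrite -mulnA -expnD subnKC// leq_maxl.
    rewrite ltn_pmul2r ?expn_gt0//.
    apply: (@leq_trans (maxn m k.+1)); first exact: leq_maxr.
    by rewrite leq_pmulr// expn_gt0.
  have -> : (k * 2 ^ (maxn m k.+1 - m))%:R / 2 ^+ maxn m k.+1 = k%:R / 2 ^+ m :> R.
    have {2}-> : maxn m k.+1 = (m + (maxn m k.+1 - m))%N by rewrite subnKC// leq_maxl.
    by rewrite natrM natrX exprD -mulf_div divff ?mulr1// expf_neq0.
  by [].
have [_ cA] := azemaA; have cw := cA w.
have Ac := cadlag_ge_dyadic cw Ad.
have n0 : 0 < n.+1%:R^-1 :> R by rewrite invr_gt0.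
apply: (lt_le_trans n0); rewrite /left_lim; case: eqP => [_|/eqP tn0].
  exact: Ac.
have t00 : 0 < t by rewrite lt_neqAle eq_sym tn0.
apply: limr_ge; first exact: cw.2.
apply: filterS2 (nbhs_left_gt t00) (nbhs_left_lt t) => s s0 st.
by apply: Ac; [exact: ltW|rewrite (lt_le_trans _ tt)// lte_fin].
Qed.

Lemma azema_left_lim_measurable :
  @measurable_fun _ _ (Pred F) R time_space (fun p => left_lim (A ^~ p.1) p.2).
Proof.
apply: (Pred_left_limits fF azema_adapted (Z := fun t w => left_lim (A ^~ w) t)).
- move=> w t t0; rewrite /left_lim gt_eqF//.
  by have [_ cA] := azemaA; exact: (cA w).2.
- by move=> w; rewrite /left_lim eqxx.
Qed.

End azema.

(** * The density of the jumps in the enlarged filtration *)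

Section compensator_no_jump.
Context {R : realType} {dO : measure_display} {Omega : measurableType dO}
  (P : probability Omega R) {d : nat}.
Local Notation E := (borel_rV R d).
Variables (F : R -> set (set Omega)) (X : R -> Omega -> 'rV[R]_d).
Variables (T : nat -> Omega -> \bar R) (xi : nat -> Omega -> 'rV[R]_d).
Hypothesis fF : filtration F.
Hypothesis steps : step_data X T xi F.
Variable nu : Omega -> {measure set (R * E) -> \bar R}.
Hypothesis dualF : dual_predictable_projection P F (jump_measure X) (fun w => nu w).
Local Notation PX := (Pred F * E)%type.
Local Notation m := (wnu fF dualF).

Lemma expect_wnu (f : PX -> R) : measurable_fun setT f -> (forall x, 0 <= f x) ->
  (\int[P]_w \int[m w]_q (f ((w, q.1), q.2))%:E =
   \sum_(n <oo) \int[P]_w ((fun w => (f (marked_atom T xi F n w) *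
     weight nu (w, fine (T n w)))%:E) \_ (active T n)) w)%E.
Proof.
move=> mf f0.
have mg : measurable_fun setT (fun x : PX => f x * weight nu x.1).
  apply: measurable_funM => //.
  by apply: (measurableT_comp (weight_measurable fF dualF)); exact: measurable_fst.
have := dual_expect fF steps dualF mg (fun x => mulr_ge0 (f0 x) (weight_ge0 nu x.1)).
move=> <-; apply: eq_integral => w _.
rewrite (integral_wnu fF dualF w (f := fun x => (f x)%:E)).
- by apply: eq_integral => q _; rewrite EFinM.
- exact/measurable_EFinP.
- by move=> x; rewrite lee_fin.
Qed.

(** The expected weighted mass of a predictable set is the expected weighted
    number of jumps in it; without jumps, the mass is a nonnegative variable
    whose expectation is 0. *)
Lemma wnu_null_of_no_jump (S : set PX) : measurable S ->
  (forall n, P [set w | active T n w /\ S (marked_atom T xi F n w)] = 0%E) ->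
  {ae P, forall w, m w [set q | S ((w, q.1), q.2)] = 0%E}.
Proof.
move=> mS S0.
have E0 := expect_wnu (measurable_indic mS : measurable_fun setT (\1_S : PX -> R))
  (fun x => ltac:(by [])).
rewrite eseries0 in E0; last first.
  move=> n _ _.
  transitivity (\int[P]_w cst 0 w)%E; last exact: integral0.
  apply: ae_eq_integral => //.
    apply: (step_measurable_at_atom fF steps n
      (f := fun x : PX => (\1_S x * weight nu x.1)%:E)).
    apply/measurable_EFinP; apply: measurable_funM; first exact: measurable_indic.
    by apply: (measurableT_comp (weight_measurable fF dualF)); exact: measurable_fst.
  exists [set w | active T n w /\ S (marked_atom T xi F n w)]; split => //.
  - exact: (step_measurable_active_atom fF steps n mS).
  - exact: S0.
  move=> w /= h; apply: contrapT => nS; apply: h => _; rewrite patchE.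
  case: ifPn => // /set_mem aw; rewrite indicE memNset ?mul0r// => Sw.
  by apply: nS.
have sliceE w : (\int[m w]_q (\1_S ((w, q.1), q.2))%:E)%E =
    m w [set q | S ((w, q.1), q.2)].
  by rewrite -[X in m w X]setIT -integral_indic//; exact: measurable_slice.
have mm : measurable_fun setT (fun w => m w [set q | S ((w, q.1), q.2)]).
  exact: (wnu_slice_measurable fF fF (fun t _ => @subset_refl _ (F t)) dualF mS).
have /(ae_eq_integral_abs P measurableT mm) : (\int[P]_w `|m w [set q | S ((w, q.1), q.2)]| = 0)%E.
  rewrite -E0; apply: eq_integral => w _; rewrite sliceE gee0_abs//.
by apply: filterS => w /(_ I).
Qed.

Lemma wnu_time0_ae : {ae P, forall w, m w [set q | q.1 = 0] = 0%E}.
Proof.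
have mz : measurable ((time_space `\` [set p | 0 < p.2]) `*` setT : set PX).
  by apply: measurableX => //; apply: measurableD;
    [exact: Pred_time_space|exact: Pred_after].
have := @wnu_null_of_no_jump _ mz.
case=> [n|].
  rewrite (_ : mkset _ = set0) ?measure0// -subset0 => w [[T0 Ty]] [[_ /= nT] _].
  by apply: nT; rewrite -lte_fin fineK// ge0_fin_numE// ltW.
move=> N [mN N0 NP]; exists N; split => //; apply: subset_trans NP => w /= h h'.
apply: h; rewrite -h'; congr (m w _); apply/seteqP; split => q /=.
  by move=> ->; rewrite time_spaceE/= ltxx.
rewrite time_spaceE/= => -[[q0 /negP]] + _; rewrite -leNgt => q0'.
by apply/eqP; rewrite eq_le q0 q0'.
Qed.

End compensator_no_jump.

Lemma measurable_inv_fun {R : realType} : measurable_fun setT (@GRing.inv R).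
Proof.
have -> : @GRing.inv R = (@GRing.inv R) \_ [set x | x != 0].
  apply/funext => x; rewrite patchE; case: ifPn => // /negP x0.
  by have [->|xn] := eqVneq x 0; [rewrite invr0|exfalso; apply: x0; exact/mem_set].
have o : open [set x : R | x != 0] by exact: open_neq.
apply/(measurable_restrictT _ (open_measurable o)).
apply: open_continuous_measurable_fun => // x; rewrite inE => x0.
exact: inv_continuous.
Qed.

Section before_tau.
Context {R : realType} {dO : measure_display} {Omega : measurableType dO} {d : nat}.
Local Notation E := (borel_rV R d).
Variables (F : R -> set (set Omega)) (tau : Omega -> \bar R).
Hypotheses (fF : filtration F) (mtau : measurable_fun setT tau).
Hypothesis tau0 : forall w, (0 < tau w)%E.
Local Notation G := (progressive_enlargement F tau).

(** The sets where k exceeds a rational agree before tau with F-predictable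
    sets, and a nonnegative function is the supremum of the nonnegative
    rationals that it exceeds. The values outside ]0, tau] are arbitrary, so
    an infinite supremum there may be truncated. *)
Lemma predictable_version_before (k : Pred G * E -> R) :
  measurable_fun setT k -> (forall x, 0 <= k x) ->
  exists kF : Pred F * E -> R, [/\ measurable_fun setT kF, forall x, 0 <= kF x &
    forall w t x, 0 < t -> (t%:E <= tau w)%E -> kF ((w, t), x) = k ((w, t), x)].
Proof.
move=> mk k0.
pose v (j : nat) : R := if unpickle j is Some q then ratr (q : rat) else 0.
have /choice[S SP] : forall j, exists S : set (Pred F * E)%type, measurable S /\
    forall w t x, 0 < t -> (t%:E <= tau w)%E -> (v j < k ((w, t), x) <-> S ((w, t), x)).
  move=> j; have mj : measurable (k @^-1` `]v j, +oo[).
    by have := mk measurableT _ (measurable_itv `]v j, +oo[); rewrite setTI.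
  have [S mS hS] := PredX_enlargement_before fF mtau tau0 mj.
  exists S; split => // w t x t0 tt; rewrite -(hS w t x t0 tt).
  by rewrite /= in_itv/= andbT.
pose f (j : nat) (x : Pred F * E) : \bar R := ((Num.max (v j) 0) * \1_(S j) x)%:E.
have f0 j x : (0 <= f j x)%E by rewrite lee_fin mulr_ge0// le_max lexx orbT.
pose h (x : Pred F * E) : \bar R := esups (f ^~ x) 0.
have fh j x : (f j x <= h x)%E.
  by rewrite /h /esups/= /sdrop; apply: ereal_sup_ubound; exists j.
exists (fine \o h); split.
- apply: measurableT_comp => //; apply: measurable_fun_esups => j.
  apply/measurable_EFinP; apply: measurable_funM => //.
  by apply: measurable_indic; case: (SP j).
- by move=> x; apply: fine_ge0; exact: le_trans (fh 0%N x).
- move=> w t x t0 tt /=; set y := ((w, t), x).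
  suff -> : h y = (k y)%:E by [].
  apply/eqP; rewrite eq_le; apply/andP; split.
    apply: ge_ereal_sup => _ [j _ <-]; rewrite /f lee_fin indicE.
    case: (boolP (y \in S j)) => [/set_mem Sy|_]; last by rewrite mulr0.
    by rewrite mulr1 ge_max k0 andbT ltW//; apply/((SP j).2 w t x t0 tt).
  rewrite leNgt; apply/negP => hk.
  have hf : h y \is a fin_num.
    by rewrite ge0_fin_numE ?(lt_trans hk) ?ltry// (le_trans (f0 0%N y)).
  have [q] : exists q, ratr q \in `]fine (h y), (k y)[.
    by apply: rat_in_itvoo; rewrite -lte_fin fineK.
  rewrite in_itv/= => /andP[hq qk].
  have vq : v (pickle q) = ratr q by rewrite /v pickleK.
  have q0 : 0 <= ratr q :> R.
    by apply: (le_trans _ (ltW hq)); apply: fine_ge0; exact: le_trans (fh 0%N y).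
  have := fh (pickle q) y; rewrite leNgt => /negP; apply.
  rewrite /f indicE mem_set; last first.
    by apply/((SP (pickle q)).2 w t x t0 tt); rewrite vq.
  by rewrite mulr1 vq (max_idPl q0) -(fineK hf) lte_fin.
Qed.

End before_tau.

Section enlarged_density.
Context {R : realType} {dO : measure_display} {Omega : measurableType dO}
  (P : probability Omega R) {d : nat}.
Local Notation E := (borel_rV R d).
Variables (F : R -> set (set Omega)) (X : R -> Omega -> 'rV[R]_d).
Variables (T : nat -> Omega -> \bar R) (xi : nat -> Omega -> 'rV[R]_d).
Hypothesis fF : filtration F.
Hypothesis steps : step_data X T xi F.
Variable nu : Omega -> {measure set (R * E) -> \bar R}.
Hypothesis dualF : dual_predictable_projection P F (jump_measure X) (fun w => nu w).
Variables (tau : Omega -> \bar R) (kappa : R -> Omega -> probability (measurableTypeR R) R).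
Hypothesis mtau : measurable_fun setT tau.
Hypothesis tau0 : forall w, (0 < tau w)%E.
Hypothesis law1 : law P tau setT = 1%E.
Hypothesis rcd : forall t, 0 <= t -> regular_conditional_distribution P F t tau (kappa t).
Hypothesis ac : forall t, 0 <= t -> {ae P, forall w, kappa t w `<< law P tau}.
Local Notation G := (progressive_enlargement F tau).
Local Notation m := (wnu fF dualF).
Local Notation PXG := (Pred G * E)%type.

Let fG : filtration G. Proof. exact: filtration_enlargement. Qed.
Let FG t : 0 <= t -> F t `<=` G t. Proof. exact: sub_enlargement. Qed.
Let stepsG : step_data X T xi G. Proof. exact: step_data_mono steps. Qed.

(** The jump measure with the same weight as the compensator, so that its
    expected mass is finite as well. *)
Definition wjump (w : Omega) : {measure set (R * E) -> \bar R} :=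
  mdensity (mseries (atom T xi ^~ w) 0) (weight_slice_measurable fF dualF w)
    (weight_slice_ge0 nu w).

Lemma weight_measurable_enlarged : @measurable_fun _ _ (Pred G) _ setT (weight nu).
Proof. exact: (measurableT_comp (weight_measurable fF dualF) (Pred_id_measurable FG)). Qed.

Lemma weightX_measurable : @measurable_fun _ _ PXG _ setT (fun x => weight nu x.1).
Proof. by apply: (measurableT_comp weight_measurable_enlarged); exact: measurable_fst. Qed.

Lemma integral_wjump w (f : PXG -> \bar R) : measurable_fun setT f ->
  (forall x, 0 <= f x)%E ->
  (\int[lift (F := G) w (wjump w)]_x f x =
   \sum_(n <oo) ((fun w => f (marked_atom T xi G n w) * (weight nu (w, fine (T n w)))%:E)
      \_ (active T n)) w)%E.
Proof.
move=> mf f0; have [sT Tcv Tlt xiP XE] := steps.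
have T0 n v : (0 <= T n v)%E by case: (sT n).
have mfw : measurable_fun setT (fun q : R * E => f ((w, q.1), q.2)).
  by apply: (measurableT_comp mf); exact: PredX_section.
rewrite integral_lift// integral_mdensity//.
have mg : measurable_fun setT (fun q : R * E => f ((w, q.1), q.2) * (weight nu (w, q.1))%:E)%E.
  apply: emeasurable_funM => //; apply/measurable_EFinP.
  exact: (weight_slice_measurable fF dualF).
have := integral_jump_measure T0 Tcv Tlt (fun n => (xiP n).2) XE w measurableT mg
  (fun q _ => mule_ge0 (f0 _) _).
have -> : jump_measure X w = mseries (atom T xi ^~ w) 0.
  apply/funext => B; exact: (jump_measureE T0 Tcv Tlt (fun n => (xiP n).2) XE).
move=> -> => [|q]; last by rewrite lee_fin weight_ge0.
by apply: eq_eseriesr => n _; rewrite patch_setT patchE.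
Qed.

Let atom_term_measurable n (f : PXG -> \bar R) : measurable_fun setT f ->
  measurable_fun setT ((fun w => f (marked_atom T xi G n w) * (weight nu (w, fine (T n w)))%:E)
      \_ (active T n))%E.
Proof.
move=> mf; apply: (step_measurable_at_atom fG stepsG n
  (f := fun x : PXG => (f x * (weight nu x.1)%:E)%E)).
by apply: emeasurable_funM => //; apply/measurable_EFinP; exact: weightX_measurable.
Qed.

Let atom_term_ge0 n (f : PXG -> \bar R) w : (forall x, 0 <= f x)%E ->
  (0 <= ((fun w => f (marked_atom T xi G n w) * (weight nu (w, fine (T n w)))%:E)
      \_ (active T n)) w)%E.
Proof.
by move=> f0; rewrite patchE; case: ifP => // _; rewrite mule_ge0// lee_fin weight_ge0.
Qed.

(* The two random measures, as kernels from Omega to the product of the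
   G-predictable sigma-algebra with R^d; their mixtures under P are the
   measures to compare. *)
Let K1 w : {measure set PXG -> \bar R} := lift w (m w).
Let K2 w : {measure set PXG -> \bar R} := lift w (wjump w).

Let mK1 S : measurable S -> measurable_fun setT (K1 ^~ S).
Proof. exact: (wnu_slice_measurable fF fG FG dualF). Qed.

Let K2E w S : measurable S -> K2 w S = (\int[K2 w]_x (\1_S x)%:E)%E.
Proof. by move=> mS; rewrite integral_indic// setIT. Qed.

Let mK2 S : measurable S -> measurable_fun setT (K2 ^~ S).
Proof.
move=> mS.
have mi : measurable_fun setT (fun x : PXG => (\1_S x)%:E : \bar R).
  by apply/measurable_EFinP; exact: measurable_indic.
rewrite (_ : K2 ^~ S = fun w => (\sum_(n <oo)
    ((fun w => (\1_S (marked_atom T xi G n w))%:E * (weight nu (w, fine (T n w)))%:E)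
      \_ (active T n)) w)%E); last first.
  by apply/funext => w; rewrite K2E// integral_wjump.
apply: ge0_emeasurable_sum => [n w _ _|n _].
  by apply: (atom_term_ge0 n (f := fun x => (\1_S x)%:E)) => x; rewrite lee_fin.
exact: (atom_term_measurable n mi).
Qed.

Definition mix_wnu : {measure set PXG -> \bar R} := mmix P mK1.
Definition mix_wjump : {measure set PXG -> \bar R} := mmix P mK2.

Lemma integral_mix_wnu (f : PXG -> \bar R) : measurable_fun setT f ->
  (forall x, 0 <= f x)%E ->
  (\int[mix_wnu]_x f x = \int[P]_w \int[m w]_q f ((w, q.1), q.2))%E.
Proof.
move=> mf f0; rewrite integral_mmix//; apply: eq_integral => w _.
by rewrite integral_lift.
Qed.

Lemma integral_mix_wjump (f : PXG -> \bar R) : measurable_fun setT f ->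
  (forall x, 0 <= f x)%E ->
  (\int[mix_wjump]_x f x = \sum_(n <oo) \int[P]_w
    ((fun w => f (marked_atom T xi G n w) * (weight nu (w, fine (T n w)))%:E)
      \_ (active T n)) w)%E.
Proof.
move=> mf f0; rewrite integral_mmix// -integral_nneseries//.
- by apply: eq_integral => w _; rewrite integral_wjump.
- by move=> n; exact: atom_term_measurable.
- by move=> n w _; exact: atom_term_ge0.
Qed.

Let mix_wnu_fin : (mix_wnu setT < +oo)%E.
Proof.
apply: (@le_lt_trans _ _ (\int[P]_w cst 1 w)%E); last first.
  rewrite integral_cst// mul1e.
  by apply: (@le_lt_trans _ _ 1%E); [exact: probability_le1|exact: ltry].
apply: ge0_le_integral => //; first exact: mK1.
by move=> w _; exact: wnu_le1.
Qed.

Let mix_wjump_fin : (mix_wjump setT < +oo)%E.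
Proof.
have -> : mix_wjump setT = mix_wnu setT.
  rewrite -[LHS]mul1e -integral_cst// integral_mix_wjump//.
  have := expect_wnu fF steps dualF (f := cst 1) (measurable_cst _) (fun _ => ler01).
  rewrite (_ : (\int[P]_w _)%E = mix_wnu setT); last first.
    apply: eq_integral => w _.
    transitivity (1 * m w setT)%E; first by rewrite -integral_cst.
    by rewrite mul1e.
  by move=> ->; apply: eq_eseriesr => n _; apply: eq_integral.
exact: mix_wnu_fin.
Qed.

Let mix_ac S : measurable S -> mix_wnu S = 0%E -> mix_wjump S = 0%E.
Proof.
move=> mS S0.
have mi : measurable_fun setT (fun x : PXG => (\1_S x)%:E : \bar R).
  by apply/measurable_EFinP; exact: measurable_indic.
rewrite -[S]setIT -integral_indic// integral_mix_wjump//.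
rewrite eseries0// => n _ _.
transitivity (\int[P]_w cst 0 w)%E; last exact: integral0.
apply: ae_eq_integral => //; first exact: (atom_term_measurable n mi).
exists [set w | active T n w /\ S (marked_atom T xi G n w)]; split.
- exact: (step_measurable_active_atom fG stepsG n mS).
- exact: (enlargement_null_no_jump steps (dualF:=dualF) mtau tau0 law1 rcd ac n mS S0).
- move=> w /= h; apply: contrapT => nS; apply: h => _; rewrite patchE.
  case: ifPn => // /set_mem aw; rewrite indicE memNset ?mul0e// => Sw.
  by apply: nS.
Qed.

(** Radon-Nikodym on the product of the G-predictable sigma-algebra with R^d:
    the expected jump measure is absolutely continuous with respect to the
    expected F-compensator even on this larger sigma-algebra. *)
Lemma enlarged_density : exists k : PXG -> R, [/\ measurable_fun setT k,
  forall x, 0 <= k x &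
  forall f : PXG -> R, measurable_fun setT f -> (forall x, 0 <= f x) ->
   (\sum_(n <oo) \int[P]_w
     ((fun w => (f (marked_atom T xi G n w) * weight nu (w, fine (T n w)))%:E)
      \_ (active T n)) w =
    \int[P]_w \int[m w]_q (f ((w, q.1), q.2) * k ((w, q.1), q.2))%:E)%E].
Proof.
have [k [mk k0 kE]] := radon_nikodym_real mix_wnu_fin mix_wjump_fin mix_ac.
exists k; split => // f mf f0.
have mfE : measurable_fun setT (EFin \o f) by exact/measurable_EFinP.
have f0E x : (0 <= (EFin \o f) x)%E by rewrite lee_fin.
transitivity (\int[mix_wjump]_x (EFin \o f) x)%E.
  by rewrite integral_mix_wjump.
rewrite (eq_measure_integral (mdensity mix_wnu mk k0)); last first.
  by move=> A mA _; exact: kE.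
rewrite integral_mdensity// integral_mix_wnu//.
- by apply: emeasurable_funM => //; exact/measurable_EFinP.
- by move=> x; rewrite mule_ge0// lee_fin.
Qed.

(** * The compensator in the enlarged filtration *)

Let mwX := weightX_measurable.

Section with_density.
Variable g : PXG -> R.
Hypotheses (mg : measurable_fun setT g) (g0 : forall x, 0 <= g x).
Hypothesis gE : forall f : PXG -> R, measurable_fun setT f -> (forall x, 0 <= f x) ->
   (\sum_(n <oo) \int[P]_w
     ((fun w => (f (marked_atom T xi G n w) * weight nu (w, fine (T n w)))%:E)
      \_ (active T n)) w =
    \int[P]_w \int[m w]_q (f ((w, q.1), q.2) * g ((w, q.1), q.2))%:E)%E.

(* The last two factors cancel wherever the weight is positive, and put the
   density to 0 at the times when the compensator has exploded; integrals
   then reduce to integrals against the finite kernel. *)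
Let gg (x : PXG) : R := g x * ((weight nu x.1)^-1 * weight nu x.1).

Let mwV : measurable_fun setT (fun x : PXG => (weight nu x.1)^-1).
Proof. exact: (measurableT_comp measurable_inv_fun mwX). Qed.

Let mgg : measurable_fun setT gg.
Proof. by apply: measurable_funM => //; apply: measurable_funM. Qed.

Let gg0 x : 0 <= gg x.
Proof. by rewrite mulr_ge0// mulr_ge0// ?invr_ge0 weight_ge0. Qed.

Let ggw w : measurable_fun setT (fun q : R * E => gg ((w, q.1), q.2)).
Proof. by apply: (measurableT_comp mgg); exact: PredX_section. Qed.

Definition nu_enlarged w : {measure set (R * E) -> \bar R} :=
  mdensity (nu w) (ggw w) (fun q => gg0 ((w, q.1), q.2)).

Let DD : set PXG := time_space `*` setT.

Let mDD : measurable DD.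
Proof. by apply: measurableX => //; exact: Pred_time_space. Qed.

(* Integrals against the enlarged compensator over nonnegative times,
   expressed by the finite kernel. The function W is only controlled at
   nonnegative times and is cut off elsewhere. *)
Let nu_enlarged_int (W : Omega * R * E -> R) (D : set (R * E)) w :
  @measurable_fun _ _ PXG R DD W -> (forall x, 0 <= W x) -> measurable D ->
  D `<=` [set q | 0 <= q.1] ->
  (\int[nu_enlarged w]_(q in D) (W ((w, q.1), q.2))%:E =
   \int[m w]_(q in D) ((W \_ DD) ((w, q.1), q.2) * g ((w, q.1), q.2) *
     (weight nu (w, q.1))^-1)%:E)%E.
Proof.
move=> mW W0 mD Dpos.
have mW' : measurable_fun setT (W \_ DD : PXG -> R) by exact/(measurable_restrictT _ mDD).
have W'0 x : 0 <= (W \_ DD) x by rewrite patchE; case: ifP.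
have sec (f : PXG -> R) : measurable_fun setT f ->
    measurable_fun setT (fun q : R * E => f ((w, q.1), q.2)).
  by move=> mf; apply: (measurableT_comp mf); exact: PredX_section.
have posE q : D q -> (W \_ DD) ((w, q.1), q.2) = W ((w, q.1), q.2).
  move=> /Dpos q0; rewrite patchE mem_set//; split => //=.
  by rewrite time_spaceE.
transitivity (\int[nu_enlarged w]_(q in D) ((W \_ DD) ((w, q.1), q.2))%:E)%E.
  by apply: eq_integral => q /set_mem Dq; rewrite posE.
rewrite integral_mkcond [RHS]integral_mkcond integral_mdensity; last 2 first.
- apply/(measurable_restrictT _ mD); apply: measurable_funTS.
  by apply/measurable_EFinP; exact: sec.
- by move=> q; apply: erestrict_ge0 => ? _; rewrite lee_fin.
rewrite integral_mdensity; last 2 first.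
- apply/(measurable_restrictT _ mD); apply: measurable_funTS.
  apply/measurable_EFinP.
  apply: (sec (fun x => (W \_ DD) x * g x * (weight nu x.1)^-1)).
  by apply: measurable_funM => //; exact: measurable_funM.
- move=> q; apply: erestrict_ge0 => ? _; rewrite lee_fin.
  by rewrite !mulr_ge0// invr_ge0 weight_ge0.
apply: eq_integral => q _; rewrite !patchE; case: ifPn => _; last by rewrite !mul0e.
by rewrite -!EFinM /gg !mulrA.
Qed.

(** Applied to the test function divided by the weight, the identity for g
    says that the expected jump measure and the expected integral against g
    nu agree; the division is harmless since the weight is almost surely
    positive at the jumps. *)
Lemma nu_enlarged_dual :
  dual_predictable_projection P G (jump_measure X) (fun w => nu_enlarged w).
Proof.
split=> W /(predictable_functionP _ fG) mW W0.
  pose f (x : PXG) := (W \_ DD) x * g x * (weight nu x.1)^-1.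
  have mf : measurable_fun setT f.
    apply: measurable_funM => //; apply: measurable_funM => //.
    exact/(measurable_restrictT _ mDD).
  have f0 x : 0 <= f x.
    rewrite !mulr_ge0// ?invr_ge0 ?weight_ge0//.
    by rewrite patchE; case: ifP.
  have := wnu_seg_enlarged fF fG FG dualF (f := EFin \o f) _ _.
  move=> h.
  have {}h : @measurable_fun _ _ (Pred G) _ setT (fun p =>
      \int[nu_enlarged p.1]_(q in [set q | (0 <= q.1 <= p.2)%R]) (W (p.1, q.1, q.2))%:E)%E.
    have := h (ltac:(exact/measurable_EFinP)) (fun x => ltac:(by rewrite lee_fin)).
    congr measurable_fun; apply/funext => p; rewrite nu_enlarged_int//.
    + exact: measurable_seg.
    + by move=> q /= /andP[].
  move=> B mB; apply/(predictableP _ fG); split; first by move=> p [].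
  apply: measurableI; first exact: Pred_time_space.
  have := h measurableT _ mB; rewrite setTI; congr measurable.
  apply/funext => p; rewrite /preimage/=; congr (B _); congr (integral _ _ _).
  by apply/seteqP; split => q /=; rewrite in_itv/= => // -[].
have mW' : measurable_fun setT (W \_ DD : PXG -> R) by exact/(measurable_restrictT _ mDD).
have W'0 x : 0 <= (W \_ DD) x by rewrite patchE; case: ifP.
pose f (x : PXG) := (W \_ DD) x * (weight nu x.1)^-1.
have mf : measurable_fun setT f by exact: measurable_funM.
have f0 x : 0 <= f x by rewrite mulr_ge0// invr_ge0 weight_ge0.
have posE : `[0, +oo[ `*` setT = [set q : R * E | 0 <= q.1].
  by apply/seteqP; split => q /=; rewrite in_itv/= andbT => // -[].
transitivity (\int[P]_w \int[m w]_q (f (w, q.1, q.2) * g (w, q.1, q.2))%:E)%E.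
  apply: eq_integral => w _; rewrite posE nu_enlarged_int//; last exact: measurable_pos.
  rewrite [RHS]wnu_pos//.
  - by apply: eq_integral => q _; rewrite /f mulrAC.
  - apply/measurable_EFinP; apply: (measurableT_comp (f := fun x : PXG => f x * g x)).
      exact: measurable_funM.
    exact: PredX_section.
  - by move=> q; rewrite lee_fin mulr_ge0.
rewrite -gE//.
transitivity (\int[P]_w \int[jump_measure X w]_(q in `[0%R, +oo[ `*` setT)
    ((EFin \o (W \_ DD)) ((w, q.1), q.2)))%E; last first.
  have [sT Tcv Tlt xiP XE] := steps.
  have T0 n v : (0 <= T n v)%E by case: (sT n).
  apply: eq_integral => w _.
  have -> : jump_measure X w = mseries (atom T xi ^~ w) 0.
    apply/funext => B; exact: (jump_measureE T0 Tcv Tlt (fun n => (xiP n).2) XE).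
  apply: eq_integral => q /set_mem[/=].
  rewrite in_itv/= andbT => q0 _; congr (_%:E); rewrite patchE mem_set//.
  by split => //=; rewrite time_spaceE.
rewrite (step_expect_jump P fG stepsG (f := EFin \o (W \_ DD))); last 2 first.
- exact/measurable_EFinP.
- by move=> x; rewrite lee_fin.
apply: eq_eseriesr => n _; apply: ae_eq_integral => //.
- have := step_measurable_at_atom fG stepsG n (f := fun x : PXG => (f x * weight nu x.1)%:E).
  by apply; apply/measurable_EFinP; exact: measurable_funM.
- by apply: (step_measurable_at_atom fG stepsG n (f := EFin \o (W \_ DD)));
    exact/measurable_EFinP.
apply: filterS (weight_gt0_ae fF steps dualF) => w wpos _.
rewrite !patchE; case: ifPn => // /set_mem[T0 Ty] /=; congr (_%:E).
rewrite /f /= mulfVK// gt_eqF//; apply: wpos; apply: fine_ge0; exact: ltW.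
Qed.

Lemma nu_enlargedE_ae : {ae P, forall w, forall B : set (R * E), measurable B ->
  B `<=` `[0, +oo[ `*` setT ->
  nu_enlarged w B = (\int[nu w]_(q in B) (g ((w, q.1), q.2))%:E)%E}.
Proof.
have := weight_gt0_ae fF steps dualF; apply: filterS => w wpos B mB Bpos.
apply: eq_integral => q /set_mem/Bpos[]; rewrite /= in_itv/= andbT => q0 _.
by rewrite /gg /= mulVf ?mulr1// gt_eqF// wpos.
Qed.

End with_density.
End enlarged_density.

(** * Step processes are semimartingales *)

Section step_semimartingale.
Context {R : realType}.

Lemma bounded_variation_eq (a b : R) (f g : R -> R) : {in `[a, b], f =1 g} ->
  bounded_variation a b g -> bounded_variation a b f.
Proof.
move=> fg [M hM]; exists M => _ [s sab <-].
rewrite (_ : variation a b f s = variation a b g s).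
  by apply: hM; exists s.
have nth_in m : (m < (size s).+1)%N -> nth b (a :: s) m \in `[a, b].
  move=> ms; rewrite in_itv/= (itv_partition_nth_ge ms sab).
  by rewrite (itv_partition_nth_le ms sab).
apply: eq_big_nat => n /andP[_ ns]; rewrite /=.
rewrite (fg _ (nth_in n.+1 _))// (fg _ (nth_in n _))//.
by rewrite ltnS ltnW.
Qed.

(** Each indicator of an interval [T_n, +oo[ is monotone. *)
Lemma bounded_variation_steps (T : nat -> \bar R) (c : nat -> R) (N : nat) (a b : R) :
  a < b -> bounded_variation a b (fun s => \sum_(n < N) if (T n <= s%:E)%E then c n else 0).
Proof.
move=> ab; elim: N => [|N ih].
  apply: nondecreasing_bounded_variation => x y _ _ _.
  by rewrite !big_ord0.
have -> : (fun s => \sum_(n < N.+1) (if (T n <= s%:E)%E then c n else 0)) =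
    (fun s => \sum_(n < N) (if (T n <= s%:E)%E then c n else 0)) \+
    (fun s => if (T N <= s%:E)%E then c N else 0).
  by apply/funext => s; rewrite big_ord_recr.
apply: bounded_variationD => //.
have mono (e : R) : 0 <= e ->
    bounded_variation a b (fun s => if (T N <= s%:E)%E then e else 0).
  move=> e0; apply: nondecreasing_bounded_variation => x y _ _ xy.
  case: ifPn => [Tx|_]; first by rewrite ifT// (le_trans Tx)// lee_fin.
  by case: ifP.
have [c0|c0] := leP 0 (c N); first exact: mono.
have -> : (fun s => if (T N <= s%:E)%E then c N else 0) =
    \- (fun s => if (T N <= s%:E)%E then - c N else 0).
  by apply/funext => s /=; case: ifP => _; rewrite ?opprK ?oppr0.
by apply: bounded_variationN; apply: mono; rewrite oppr_ge0 ltW.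
Qed.

Lemma measurable_coord d (i : 'I_d) :
  measurable_fun setT (fun M : borel_rV R d => M ord0 i).
Proof.
apply: (measurability _ (RGenOpens.measurableE R)).
move=> _ [_ [a [b ->]] <-]; rewrite setTI; apply: sub_sigma_algebra.
apply: open_comp; last exact: interval_open.
by move=> M _; exact: coord_continuous.
Qed.

Context {dO : measure_display} {Omega : measurableType dO} (P : probability Omega R).

Lemma zero_local_martingale (F : R -> set (set Omega)) : filtration F ->
  local_martingale P F (fun _ _ => 0).
Proof.
move=> fF; have [sF Fm mF] := fF; exists (fun _ _ => +oo%E); split.
- move=> n; split => [w|t t0]; first exact: leey.
  rewrite (_ : mkset _ = set0); first exact: salg0 (sF _ t0).
  by rewrite -subset0 => w /=; rewrite leye_eq.
- by move=> w m n _.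
- by apply: aeW => w; exact: cvg_cst.
- move=> n; rewrite /stopped; split.
  + move=> t t0 B mB; rewrite -(measurable_Past _ fF t0).
    exact: (@measurable_cst _ _ (Past F t) R setT 0 measurableT B mB).
  + by move=> w; split => [t _|t _]; [exact: cvg_cst|exact: is_cvg_cst].
  + by move=> t _; exact: integrable0.
  + by [].
Qed.

Variables (d : nat) (G : R -> set (set Omega)) (X : R -> Omega -> 'rV[R]_d).
Variables (T : nat -> Omega -> \bar R) (xi : nat -> Omega -> 'rV[R]_d).
Hypothesis fG : filtration G.
Hypothesis steps : step_data X T xi G.
Hypothesis aX : adapted G (X : R -> Omega -> borel_rV R d).
Hypothesis cX : forall w, cadlag (X ^~ w).

Let coord_sum i w t : 0 <= t -> exists N, forall s, 0 <= s <= t ->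
  X s w ord0 i = \sum_(n < N) if (T n w <= s%:E)%E then xi n w ord0 i else 0.
Proof.
move=> t0; have [sT Tcv Tlt xiP XE] := steps.
have [N NP] := step_times_bounded (Tcv w).2 t.
exists N => s /andP[s0 st]; rewrite XE//.
rewrite (eq_fsbigr (fun n => if (T n w <= s%:E)%E then xi n w else 0)); last first.
  by move=> n /set_mem /= ->.
rewrite (fsbig_widen _ `I_N).
- rewrite -fsbig_ord summxE; apply: eq_bigr => n _.
  by case: ifP => //; rewrite mxE.
- by move=> n /= Tn; apply: NP; rewrite (le_trans Tn)// lee_fin.
- by move=> n [_ /=]; case: ifP.
Qed.

(** A step process has finitely many jumps on bounded intervals, hence
    bounded variation there, and the martingale part may be taken to be 0.
    Only adaptedness depends on the filtration. *)
Lemma step_semimartingale : semimartingale P G X.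
Proof.
move=> i; have acoord t : 0 <= t -> measurable_wrt (G t) setT (fun w => X t w ord0 i).
  move=> t0 B mB; have := measurable_coord i measurableT mB; rewrite setTI.
  by move=> mC; have := aX t0 mC.
split; first exact: acoord.
exists (fun _ _ => 0), (fun t w => X t w ord0 i - X 0 w ord0 i); split.
- by split => //; exact: zero_local_martingale.
- split; last by move=> w; rewrite subrr.
  move=> t t0.
  have mt s : 0 <= s -> s <= t -> @measurable_fun _ _ (Past G t) R setT (fun w => X s w ord0 i).
    move=> s0 st _ B mB; rewrite measurable_Past//.
    by have [_ _ mG] := fG; apply: (mG _ _ s0 st); exact: acoord.
  have := @measurable_funB _ (Past G t) R setT _ _ (mt t t0 (lexx _)) (mt 0 (lexx _) t0).
  by move=> mB B mB'; rewrite -(measurable_Past _ fG t0); exact: (mB measurableT B mB').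
- move=> w; have [rX lX] := cX w; split => [t t0|t t0].
    apply: cvgB; last exact: cvg_cst.
    apply: (cvg_comp (X ^~ w) (fun M : 'rV[R]_d => M ord0 i) (rX t t0)).
    exact: (@coord_continuous _ _ _ ord0 i _).
  have /cvg_ex[l Xl] := lX t t0.
  apply/cvg_ex; exists (l ord0 i - X 0 w ord0 i); apply: cvgB; last exact: cvg_cst.
  apply: (cvg_comp (X ^~ w) (fun M : 'rV[R]_d => M ord0 i) Xl).
  exact: (@coord_continuous _ _ _ ord0 i _).
- move=> w t; rewrite le_eqVlt => /predU1P[<-|t0]; first exact: bounded_variationxx.
  have [N NP] := coord_sum i w (ltW t0).
  apply: (bounded_variation_eq (g := (fun s => \sum_(n < N)
     if (T n w <= s%:E)%E then xi n w ord0 i else 0) \+ (fun=> - X 0 w ord0 i))).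
    by move=> s; rewrite in_itv/= => s0t; rewrite (NP s s0t).
  apply: bounded_variationD; first exact: t0.
    have := @bounded_variation_steps (T ^~ w) (fun n => xi n w ord0 i) N 0 t t0.
    exact.
  by apply: nondecreasing_bounded_variation.
- by move=> w t t0; rewrite addr0 addrC subrK.
Qed.

Lemma step_data_step_process : step_process P G X.
Proof. by split; [exact: step_semimartingale|exists T, xi]. Qed.

End step_semimartingale.

(** * Absence of atoms in time *)

Section no_time_atom.
Context {R : realType} {dO : measure_display} {Omega : measurableType dO}
  (P : probability Omega R) {d : nat}.
Local Notation E := (borel_rV R d).
Variables (F : R -> set (set Omega)) (X : R -> Omega -> 'rV[R]_d).
Variables (T : nat -> Omega -> \bar R) (xi : nat -> Omega -> 'rV[R]_d).
Hypothesis fF : filtration F.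
Hypothesis steps : step_data X T xi F.
Variable nu : Omega -> {measure set (R * E) -> \bar R}.
Hypothesis dualF : dual_predictable_projection P F (jump_measure X) (fun w => nu w).
Hypothesis qlcF : quasi_left_continuous P F X.
Local Notation m := (wnu fF dualF).

(** The graph of sigma is the difference of the two predictable intervals [0,
    sigma] and [0, sigma[. *)
Lemma graph_measurable (H : R -> set (set Omega)) (sigma : Omega -> \bar R) :
  filtration H -> predictable_time H sigma ->
  measurable ([set x | sigma x.1.1 = x.1.2%:E] : set (Pred H * E)%type).
Proof.
move=> fH [sst psig].
have [_ mlt] := (predictableP _ fH).1 psig.
have mgt := Pred_after_stopping sst.
suff -> : [set x : Pred H * E | sigma x.1.1 = x.1.2%:E] =
    ((time_space `\` [set p | (sigma p.1 < p.2%:E)%E])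
     `\` [set p | 0 <= p.2 /\ (p.2%:E < sigma p.1)%E]) `*` setT.
  apply: measurableX => //; apply: measurableD => //; apply: measurableD => //.
  exact: Pred_time_space.
have [s0 _] := sst.
apply/seteqP; split => [[[w t] x]/= st|[[w t] x]/= [[[]]]].
  rewrite time_spaceE/= st ltxx; split=> //; split; last by move=> [].
  by split => //; rewrite -lee_fin -st.
rewrite time_spaceE/= => t0 /negP; rewrite -leNgt => ts h _.
apply/eqP; rewrite eq_le ts andbT leNgt; apply/negP => ts'.
by apply: h.
Qed.

Let C w (t : R) : \bar R := m w [set q | 0 <= q.1 <= t].

Let mseg t : measurable [set q : R * E | 0 <= q.1 <= t].
Proof. exact: measurable_seg. Qed.

Let C_mono w s t : s <= t -> (C w s <= C w t)%E.
Proof.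
move=> st; apply: le_measure; rewrite ?inE// => q /= /andP[-> qs].
exact: le_trans st.
Qed.

Let C_measurable : @measurable_fun _ _ (Pred F) _ setT (fun p => C p.1 p.2).
Proof.
have := wnu_rect0 fF dualF (@measurableT _ E).
congr measurable_fun; apply/funext => p; congr (m _ _).
by apply/seteqP; split => q /=; tauto.
Qed.

Let C_right_continuous w t (a : \bar R) : (forall n : nat, (a <= C w (t + n.+1%:R^-1)%R)%E) ->
  (a <= C w t)%E.
Proof.
move=> h.
have cv : (C w (t + n.+1%:R^-1) @[n --> \oo] --> C w t)%E.
  rewrite {2}/C (_ : mkset _ = \bigcap_n [set q : R * E | 0 <= q.1 <= t + n.+1%:R^-1]).
    apply: nonincreasing_cvg_mu => //.
    - apply: le_lt_trans (wnu_fin fF dualF w); apply: le_measure; rewrite ?inE//.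
    - exact: bigcap_measurable.
    - move=> i j ij; apply/subsetPset => q /= /andP[-> qt]; apply: le_trans qt _.
      by rewrite lerD2l lef_pV2 ?posrE// ler_nat.
  apply/seteqP; split => [q /= /andP[q0 qt] n _ /=|q /= qn].
    by rewrite q0 (le_trans qt)// lerDl.
  have /andP[-> _] := qn 0%N I; rewrite /= leNgt; apply/negP => tq.
  have [n nq] : exists n : nat, n.+1%:R^-1 < q.1 - t by apply: natSinv_lt; rewrite subr_gt0.
  by have /andP[_] := qn n I; rewrite leNgt -ltrBrDl nq.
rewrite -(cvg_lim _ cv)//; apply: lime_ge; first by apply/cvg_ex; eexists; exact: cv.
by apply: nearW => n; exact: h.
Qed.

(* The first time at which the cumulated mass C reaches a. As C is
   right-continuous and predictable, this is a predictable time. *)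
Let hit (a : R) (w : Omega) : \bar R := ereal_inf (EFin @` [set t | 0 <= t /\ (a%:E <= C w t)%E]).

Let hit_le a w t : 0 <= t -> (hit a w <= t%:E)%E = (a%:E <= C w t)%E.
Proof.
move=> t0; apply/idP/idP => [ht|aC]; last by apply: ereal_inf_lbound; exists t.
apply: C_right_continuous => n.
have /ereal_inf_lt[_ [s [s0 aC] <-]] : (hit a w < (t + n.+1%:R^-1)%:E)%E.
  by apply: le_lt_trans ht _; rewrite lte_fin ltrDl.
by rewrite lte_fin => st; apply: le_trans aC (C_mono _ (ltW st)).
Qed.

(* Quasi-left continuity is a statement on finite predictable times, whence
   the truncation at K + 1. *)
Let hitK a (K : nat) w : \bar R := Order.min (hit a w) K.+1%:R%:E.

Let hitK_predictable a K : predictable_time F (hitK a K).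
Proof.
have mC : measurable ([set p | (a%:E <= C p.1 p.2)%E] : set (Pred F)).
  have := C_measurable measurableT (emeasurable_itv `[a%:E, +oo[); rewrite setTI.
  by congr measurable; apply/seteqP; split => p /=; rewrite in_itv/= andbT.
have hit0 w : (0 <= hitK a K w)%E.
  rewrite /hitK le_min lee_fin ler0n andbT.
  by apply: le_ereal_inf_tmp => _ [t [t0 _] <-]; rewrite lee_fin.
have [sF _ mF] := fF.
split.
  split => // t t0.
  rewrite (_ : mkset _ = [set w | (a%:E <= C w t)%E] `|` [set w | K.+1%:R <= t]); last first.
    apply/seteqP; split => w /=; rewrite /hitK ge_min hit_le// lee_fin.
      by move=> /orP.
    by move=> h; apply/orP.
  apply: (salgU (sF _ t0)); first exact: (Pred_section_time fF t0 mC).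
  have [Kt|Kt] := boolP (K.+1%:R <= t).
    by rewrite (_ : mkset _ = setT); [exact: (salgT (sF _ t0))|apply/seteqP].
  rewrite (_ : mkset _ = set0); first exact: (salg0 (sF _ t0)).
  by apply/seteqP; split => // w /=; rewrite (negbTE Kt).
apply/(predictableP _ fF); split; first by move=> p /= [p0 _]; rewrite time_spaceE.
have mlt : measurable (time_space `&` [set p | p.2 < K.+1%:R] : set (Pred F)).
  have := @Pred_left_continuous _ _ _ F (fun t _ => t) fF _ _.
  move=> h; have := h _ _ (Pred_time_space fF) _ (measurable_itv `]-oo, K.+1%:R[).
  rewrite (_ : (fun p : Pred F => p.2) @^-1` _ = [set p | p.2 < K.+1%:R]); last first.
    by apply/seteqP; split => p /=; rewrite in_itv.
  apply.
    move=> t t0 B mB.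
    have [Bt|Bt] := pselect (B t).
      by rewrite (_ : _ `&` _ = setT); [exact: (salgT (sF _ t0))|apply/seteqP; split].
    by rewrite (_ : _ `&` _ = set0); [exact: (salg0 (sF _ t0))|apply/seteqP; split => // w []].
  by move=> w t _; exact: cvg_at_left_filter.
rewrite (_ : mkset _ = (time_space `&` [set p | p.2 < K.+1%:R]) `\`
    [set p | (a%:E <= C p.1 p.2)%E]); first exact: measurableD.
apply/seteqP; split => p /=; rewrite time_spaceE/= /hitK lt_min lte_fin.
  by move=> [p0 /andP[ph ->]]; split => //; apply/negP; rewrite -hit_le// -ltNge.
by move=> [[p0 ->]] /negP; rewrite -hit_le// -ltNge => ->.
Qed.

(** By quasi-left continuity no jump occurs at sigma, so its graph contains
    no jump and is not charged by the compensator. *)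
Lemma predictable_time_null (sigma : Omega -> \bar R) : predictable_time F sigma ->
  (forall w, sigma w < +oo)%E ->
  {ae P, forall w, m w [set q | sigma w = q.1%:E] = 0%E}.
Proof.
move=> psig sfin.
have [sT Tcv Tlt xiP XE] := steps.
have T0 n v : (0 <= T n v)%E by case: (sT n).
have mgr := graph_measurable fF psig.
apply: (wnu_null_of_no_jump fF steps dualF mgr) => n.
have [_ _ /(_ _ psig sfin) jump0] := qlcF.
apply/negligibleP; first exact: (step_measurable_active_atom fF steps n mgr).
move: jump0; apply: negligibleS => w /= [[Tn0 Tny] sT'] j0.
have : jump (X ^~ w) (fine (T n w)) = xi n w.
  apply: (step_jump_at (T := T ^~ w) (xi := xi ^~ w)) => //.
  - exact: (Tcv w).1.
  - exact: (Tcv w).2.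
  - by move=> k; exact: Tlt.
  - by move=> t t0; exact: XE.
rewrite -[fine (T n w)]/(fine (fine (T n w))%:E) -sT' j0 => /esym/eqP xi0.
by have := ((xiP n).2 w).2 Tny; rewrite xi0.
Qed.

(** If the compensator had an atom at t > 0, its cumulated mass would leap
    over a rational a at t, and t would be the first time at which a is
    reached. So all atoms lie on the graphs of countably many predictable
    times. *)
Lemma wnu_no_time_atom : {ae P, forall w t, m w [set q | q.1 = t] = 0%E}.
Proof.
have hit_null : {ae P, forall w (j K : nat),
    m w [set q | hitK (if unpickle j is Some a then ratr (a : rat) else 0) K w = q.1%:E] = 0%E}.
  apply: ae_foralln => j; apply: ae_foralln => K.
  apply: (predictable_time_null (hitK_predictable _ _)) => w.
  by rewrite /hitK gt_min ltry orbT.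
apply: filterS2 hit_null (wnu_time0_ae fF steps dualF) => w hw w0 t.
have [t0|] := leP t 0.
  move: t0; rewrite le_eqVlt => /predU1P[->//|t0].
  apply/eqP; rewrite -measure_le0 -(wnu_neg fF dualF w); apply: le_measure; rewrite ?inE.
  - exact: measurable_instant.
  - exact: measurable_neg.
  - by move=> q /= ->.
move=> t0; apply: contrapT => /eqP mt.
have mt0 : (0 < m w [set q : R * E | q.1 = t])%E by rewrite lt0e mt measure_ge0.
have Cfin s : C w s \is a fin_num.
  rewrite ge0_fin_numE//; apply: le_lt_trans (wnu_fin fF dualF w).
  by apply: le_measure; rewrite ?inE.
have mtfin : m w [set q : R * E | q.1 = t] \is a fin_num.
  rewrite ge0_fin_numE//; apply: le_lt_trans (wnu_fin fF dualF w).
  by apply: le_measure; rewrite ?inE//; exact: measurable_instant.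
have Cjump s : s < t -> (C w s + m w [set q | q.1 = t] <= C w t)%E.
  move=> st; rewrite -measureU; first last.
  - by apply/seteqP; split => // q /= [/andP[_ qs] qt]; move: st; rewrite -qt ltNge qs.
  - exact: measurable_instant.
  - exact: mseg.
  apply: le_measure; rewrite ?inE//.
    by apply: measurableU => //; exact: measurable_instant.
  move=> q /= [/andP[-> qs]|->]; first by rewrite (le_trans qs)// ltW.
  by rewrite lexx ltW.
(* A rational strictly between the cumulated masses before and at t. *)
have [a] : exists a, ratr a \in
    `]fine (C w t) - fine (m w [set q : R * E | q.1 = t]), fine (C w t)[.
  by apply: rat_in_itvoo; rewrite ltrBlDr ltrDl fine_gt0// mt0 -ge0_fin_numE.
rewrite in_itv/= => /andP[Ca aC].
have hitE : hit (ratr a) w = t%:E.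
  apply/eqP; rewrite eq_le; apply/andP; split.
    rewrite hit_le; last exact: ltW.
    by rewrite -(fineK (Cfin t)) lee_fin ltW.
  apply: le_ereal_inf_tmp => _ [s [s0 aCs] <-]; rewrite lee_fin leNgt; apply/negP => st.
  have := Cjump s st; rewrite leNgt => /negP; apply.
  rewrite -(fineK (Cfin t)) -(fineK mtfin) -lteBlDr// -EFinB.
  by apply: lt_le_trans aCs; rewrite lte_fin.
have := hw (pickle a) (Num.trunc t); rewrite pickleK /hitK hitE min_l; last first.
  by rewrite lee_fin ltW// truncnS_gt.
rewrite (_ : [set q | t%:E = q.1%:E] = [set q : R * E | q.1 = t]).
  by move=> mt'; rewrite mt' ltxx in mt0.
by apply/seteqP; split => q /=; [case|move=> ->].
Qed.

End no_time_atom.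

(** * Quasi-left continuity in the enlarged filtration *)

Section enlarged_step_process.
Context {R : realType} {dO : measure_display} {Omega : measurableType dO}
  (P : probability Omega R) {d : nat}.
Local Notation E := (borel_rV R d).
Variables (F : R -> set (set Omega)) (X : R -> Omega -> 'rV[R]_d).
Variables (T : nat -> Omega -> \bar R) (xi : nat -> Omega -> 'rV[R]_d).
Hypothesis fF : filtration F.
Hypothesis steps : step_data X T xi F.
Variable nu : Omega -> {measure set (R * E) -> \bar R}.
Hypothesis dualF : dual_predictable_projection P F (jump_measure X) (fun w => nu w).
Variables (tau : Omega -> \bar R) (kappa : R -> Omega -> probability (measurableTypeR R) R).
Hypothesis mtau : measurable_fun setT tau.
Hypothesis tau0 : forall w, (0 < tau w)%E.
Hypothesis law1 : law P tau setT = 1%E.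
Hypothesis rcd : forall t, 0 <= t -> regular_conditional_distribution P F t tau (kappa t).
Hypothesis ac : forall t, 0 <= t -> {ae P, forall w, kappa t w `<< law P tau}.
Hypothesis qlcF : quasi_left_continuous P F X.
Local Notation G := (progressive_enlargement F tau).
Local Notation m := (wnu fF dualF).
Local Notation PXF := (Pred F * E)%type.
Local Notation PXG := (Pred G * E)%type.

Let fG : filtration G. Proof. exact: filtration_enlargement. Qed.
Let FG t : 0 <= t -> F t `<=` G t. Proof. exact: sub_enlargement. Qed.
Let stepsG : step_data X T xi G. Proof. exact: step_data_mono steps. Qed.

(** The graph of a G-predictable time meets each w in a single time, which
    the compensator does not charge; so absolute continuity in the enlarged
    filtration excludes jumps on it. *)
Lemma enlarged_quasi_left_continuous : quasi_left_continuous P G X.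
Proof.
have [aX cX _] := qlcF; split => //.
  by move=> t t0 B mB; apply: (FG t0); exact: aX.
move=> sigma psig sfin; have [[s0 _] _] := psig.
have mgr := graph_measurable (d := d) fG psig.
have [sT Tcv Tlt xiP XE] := steps.
have T0 n v : (0 <= T n v)%E by case: (sT n).
have null : (\int[P]_w m w [set q | sigma w = q.1%:E] = 0)%E.
  transitivity (\int[P]_w cst 0 w)%E; last exact: integral0.
  apply: ae_eq_integral => //.
    exact: (wnu_slice_measurable fF fG FG dualF mgr).
  apply: filterS (wnu_no_time_atom fF steps dualF qlcF) => w mw0 _.
  rewrite -(mw0 (fine (sigma w))); congr (m w _); apply/seteqP; split => q /=.
    by move=> ->.
  by move=> ->; rewrite fineK// ge0_fin_numE// s0.
have noT n : {ae P, forall w, ~ (active T n w /\ sigma w = (fine (T n w))%:E)}.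
  exists [set w | active T n w /\ sigma w = (fine (T n w))%:E]; split.
  - exact: (step_measurable_active_atom fG stepsG n mgr).
  - exact: (enlargement_null_no_jump steps (dualF:=dualF) mtau tau0 law1 rcd ac n mgr null).
  - by move=> w /= h; apply: contrapT => nh; apply: h.
apply: filterS (ae_foralln noT) => w hw.
have sw : sigma w = (fine (sigma w))%:E by rewrite fineK// ge0_fin_numE// s0.
have : 0 <= fine (sigma w) by apply: fine_ge0; exact: s0.
rewrite le_eqVlt => /predU1P[<-|t0]; first by rewrite /jump /left_lim eqxx subrr.
apply: contrapT => /eqP j0.
have : [set s | 0 < s /\ jump (X ^~ w) s != 0] (fine (sigma w)) by [].
rewrite (step_jump_set (T := T ^~ w) (xi := xi ^~ w))//; first last.
- by move=> t; exact: XE.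
- by move=> n; exact: (xiP n).2.
- by move=> n; exact: Tlt.
- exact: (Tcv w).2.
- exact: (Tcv w).1.
by move=> [n [Tn0 Tny] Ts]; apply: (hw n); split => //; rewrite Ts.
Qed.

Lemma enlarged_step_process : step_process P G X.
Proof.
have [aX cX _] := enlarged_quasi_left_continuous.
exact: (step_data_step_process P fG stepsG aX cX).
Qed.

(** On [0, tau] the density may be replaced by its F-predictable version. The
    two agree on ]0, tau], and almost surely the weighted compensator charges
    no time t <= 0. *)
Lemma enlarged_density_split : exists (kF : PXF -> R) (k : PXG -> R),
  [/\ measurable_fun setT kF, forall x, 0 <= kF x, measurable_fun setT k,
      forall x, 0 <= k x &
  let g (x : PXG) := if (x.1.2%:E <= tau x.1.1)%E then kF x else k x in
  [/\ measurable_fun setT g, forall x, 0 <= g x &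
  forall f : PXG -> R, measurable_fun setT f -> (forall x, 0 <= f x) ->
   (\sum_(n <oo) \int[P]_w
     ((fun w => (f (marked_atom T xi G n w) * weight nu (w, fine (T n w)))%:E)
      \_ (active T n)) w =
    \int[P]_w \int[m w]_q (f ((w, q.1), q.2) * g ((w, q.1), q.2))%:E)%E]].
Proof.
have [k [mk k0 kE]] := enlarged_density fF steps dualF mtau tau0 law1 rcd ac.
have [kF [mkF kF0 kFE]] := predictable_version_before fF mtau tau0 mk k0.
exists kF, k; split => //= ; set g := (fun x : PXG => _).
have mkFG : measurable_fun setT (kF : PXG -> R).
  move=> _ B mB; rewrite setTI; apply: (PredX_sub FG).
  by rewrite -[X in measurable X]setTI; exact: mkF.
have mbefore : measurable ([set x | (x.1.2%:E <= tau x.1.1)%E] : set PXG).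
  rewrite (_ : mkset _ = ~` ([set p | (tau p.1 < p.2%:E)%E] `*` setT)); last first.
    apply/seteqP; split => x /=; rewrite leNgt; first by move=> /negP h [].
    by move=> h; apply/negP => h'; apply: h.
  apply: measurableC; apply: measurableX => //.
  exact: (Pred_after_stopping (stopping_time_enlargement F tau0)).
have mg : measurable_fun setT g.
  apply: measurable_fun_ifT => //.
  by apply: (measurable_fun_bool true); rewrite setTI.
have g0 x : 0 <= g x by rewrite /g; case: ifP.
split => // f mf f0; rewrite kE//.
have sec (h : PXG -> R) w : measurable_fun setT h ->
    measurable_fun setT (fun q : R * E => h ((w, q.1), q.2)).
  by move=> mh; apply: (measurableT_comp mh); exact: PredX_section.
have fgm (h : PXG -> R) : measurable_fun setT h ->
    measurable_fun setT (fun x => (f x * h x)%:E).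
  by move=> mh; apply/measurable_EFinP; exact: measurable_funM.
apply: ae_eq_integral => //.
- exact: (wnu_measurable fF fG FG dualF (fgm _ mk) (fun x => mulr_ge0 (f0 x) (k0 x))).
- exact: (wnu_measurable fF fG FG dualF (fgm _ mg) (fun x => mulr_ge0 (f0 x) (g0 x))).
apply: filterS (wnu_time0_ae fF steps dualF) => w mw0 _.
apply: ae_eq_integral => //.
- apply/measurable_EFinP; apply: (sec (fun x => f x * k x)); exact: measurable_funM.
- apply/measurable_EFinP; apply: (sec (fun x => f x * g x)); exact: measurable_funM.
exists ([set q | q.1 = 0] `|` [set q | q.1 < 0]); split.
- by apply: measurableU; [exact: measurable_instant|exact: measurable_neg].
- by apply: null_set_setU => //;
    [exact: measurable_instant|exact: measurable_neg|exact: wnu_neg].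
- move=> q /= h; have [q0|q0|/esym q0] := ltgtP q.1 0; [by right| |by left].
  exfalso; apply: h => _; congr (_ * _)%:E; rewrite /g/=.
  by case: ifPn => // qt; rewrite kFE.
Qed.

End enlarged_step_process.

Section joined_natural_filtration.
Context {R : realType} {dO : measure_display} {Omega : measurableType dO}.

Lemma filtration_join (F : R -> set (set Omega)) (S : set (set Omega)) :
  filtration F -> S `<=` measurable -> filtration (join_filtration F S).
Proof.
move=> [sF Fm mF] Sm; split.
- by move=> t t0; exact: smallest_sigma_algebra.
- move=> t t0; apply: smallest_sub; first exact: sigma_algebra_measurable.
  by move=> A [|] //; [exact: Fm|exact: Sm].
- move=> s t s0 st; apply: sub_sigma_algebra2; apply: setSU; exact: mF.
Qed.

Lemma filtration_natural dE (E : measurableType dE) (Y : R -> Omega -> E) :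
  (forall t, 0 <= t -> measurable_fun setT (Y t)) -> filtration (natural_filtration Y).
Proof.
move=> mY; apply: (filtration_smallest (H0 := fun=> measurable)).
  split; last by move=> s s0 B /(_ (s + 1)); apply; rewrite /= ltrDl.
  split => [s s0|s s0|s r s0 sr]; [|exact: subset_refl|exact: subset_refl].
  exact: sigma_algebra_measurable.
by move=> s s0 B mB; exact: (mY s s0 measurableT B mB).
Qed.

End joined_natural_filtration.

(** * The compensator formula *)

Theorem theorem4p8 (R : realType) (dO : measure_display)
    (Omega : measurableType dO) (P : probability Omega R) (d : nat)
    (X : R -> Omega -> 'rV[R]_d) (Rs : set (set Omega))
    (tau : Omega -> \bar R)
    (Pt : R -> Omega -> probability (measurableTypeR R) R)
    (A : R -> Omega -> R)
    (nuF : Omega -> {measure set (R * borel_rV R d) -> \bar R}) :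
  let F := join_filtration
             (natural_filtration (X : R -> Omega -> borel_rV R d)) Rs in
  let G := progressive_enlargement F tau in
  (forall t, 0 <= t -> measurable_fun setT (X t : Omega -> borel_rV R d)) ->
  sigma_algebra setT Rs -> Rs `<=` measurable ->
  step_process P F X -> quasi_left_continuous P F X ->
  measurable_fun setT tau -> (forall w, (0 < tau w)%E) ->
  law P tau setT = 1%E -> (forall x : R, law P tau [set x] = 0%E) ->
  (forall t, 0 <= t -> regular_conditional_distribution P F t tau (Pt t)) ->
  (forall t, 0 <= t -> {ae P, forall w, Pt t w `<< law P tau}) ->
  azema P F tau A ->
  dual_predictable_projection P F (jump_measure X) nuF ->
  (exists W' U : Omega * R * borel_rV R d -> R,
    [/\ predictable_function F W',
        (forall w t x, 0 <= t -> 0 <= left_lim (A ^~ w) t + W' (w, t, x)),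
        predictable_function G U,
        (forall w t x, 0 <= t -> 0 <= 1 + U (w, t, x))
      & exists nuG : Omega -> {measure set (R * borel_rV R d) -> \bar R},
          dual_predictable_projection P G (jump_measure X) nuG /\
          {ae P, forall w, forall B : set (R * borel_rV R d), measurable B ->
             B `<=` `[0, +oo[ `*` setT ->
             nuG w B =
             (\int[nuF w]_(q in B)
                (if (q.1%:E <= tau w)%E
                 then (1 + W' (w, q.1, q.2) / left_lim (A ^~ w) q.1)%R
                 else (1 + U (w, q.1, q.2))%R)%:E)%E}]) /\
  step_process P G X /\ quasi_left_continuous P G X.
Proof.
move=> F G mX sRs Rsm stepX qlcX mtau tau0 law1 _ rcd ac azemaA dualF.
have fF : filtration F by apply: filtration_join => //; exact: filtration_natural.
have fG : filtration G by exact: filtration_enlargement.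
have FG t : 0 <= t -> F t `<=` G t by exact: sub_enlargement.
have [_ [T [xi steps]]] := stepX.
split; last first.
  by split; [exact: (enlarged_step_process fF steps dualF mtau tau0 law1 rcd ac)
            |exact: (enlarged_quasi_left_continuous fF steps dualF mtau tau0 law1 rcd ac)].
have [kF [k [mkF kF0 mk k0 [mg g0 gE]]]] :=
  enlarged_density_split fF steps dualF mtau tau0 law1 rcd ac.
pose L (p : Omega * R) := left_lim (A ^~ p.1) p.2.
have mL : @measurable_fun _ _ (Pred F * borel_rV R d)%type R
    (time_space `*` setT) (fun x => L x.1).
  have mD := Pred_time_space fF.
  apply: (measurable_comp (F := time_space : set (Pred F)) mD).
  - by move=> _ [x [xD _] <-].
  - exact: azema_left_lim_measurable azemaA.
  - by apply: measurable_funTS; exact: measurable_fst.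
(* The positive part of A_- makes A_- + W' nonnegative for every w and t; it
   changes nothing where A_- is positive, which is the case up to tau. *)
exists (fun x => Num.max (L x.1) 0 * kF x - L x.1), (fun x => k x - 1); split.
- apply/(predictable_functionP _ fF).
  apply: measurable_funB => //; apply: measurable_funM; last exact: measurable_funTS.
  by apply: measurable_maxr => //; exact: measurable_cst.
- by move=> w t x t0; rewrite addrC subrK mulr_ge0// le_max lexx orbT.
- apply/(predictable_functionP _ fG).
  by apply: measurable_funTS; apply: measurable_funB.
- by move=> w t x t0; rewrite addrC subrK.
exists (nu_enlarged fF dualF mg g0); split.
  exact: (nu_enlarged_dual steps mtau tau0 mg g0 gE).
apply: filterS2 (nu_enlargedE_ae fF steps dualF mg g0)
  (azema_left_lim_pos_ae fF mtau tau0 azemaA) => w nuE Lpos B mB Bpos.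
rewrite nuE//; apply: eq_integral => q /set_mem/Bpos[].
rewrite /= in_itv/= andbT => q0 _; congr (_%:E); case: ifPn => [qt|_].
  have Lq : 0 < left_lim (A ^~ w) q.1 by exact: Lpos.
  rewrite /L/= max_l ?ltW// [_ * kF _]mulrC mulrBl mulfK ?gt_eqF//.
  by rewrite divff ?gt_eqF// addrC subrK.
by rewrite addrC subrK.
Qed.
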